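(* Let $n,m\ge1$ and let $\mu,\nu$ be partitions. The following identity holds in the space of formal power series in $\kappa_1,\dots,\kappa_n,\chi_1,\dots,\chi_m,q$ with coefficients rational in $\mathsf{S}$: $$\sum_\lambda\mathbb{F}^*_{\lambda/\nu}(\chi_1,\dots,\chi_m\mid\bar{\mathsf{S}},\mathsf{S})\,\mathbb{F}_{\lambda/\mu}(\kappa_1,\dots,\kappa_n\mid\mathsf{S},\mathsf{S})$$ $$=\prod_{i=1}^n\prod_{j=1}^m\frac{(\kappa_i;q)_\infty(s_i^2\chi_j;q)_\infty}{(s_i^2;q)_\infty(\kappa_i\chi_j;q)_\infty}\ \sum_\lambda\mathbb{F}_{\nu/\lambda}(\kappa_1,\dots,\kappa_n\mid\mathsf{S},\mathsf{S})\,\mathbb{F}^*_{\mu/\lambda}(\chi_1,\dots,\chi_m\mid\tau^n\bar{\mathsf{S}},\tau^n\mathsf{S}),$$ where both sums are over all partitions $\lambda$.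
   Context: Write $(x;q)_n:=\prod_{i=1}^n(1-xq^{i-1})$, $(x;q)_0:=1$, $(x;q)_\infty:=\prod_{i\ge1}(1-xq^{i-1})$. A partition is a weakly decreasing sequence $\lambda=(\lambda_1\ge\lambda_2\ge\dots\ge0)$ of nonnegative integers with finitely many nonzero entries; $l(\lambda)$ is the number of nonzero parts and $\lambda'$ is the conjugate partition, so the number of parts of $\lambda'$ equal to $j$ is $m_j(\lambda')=\lambda_j-\lambda_{j+1}$. $\mathsf{S}=(s_0,s_1,\dots)$ is a sequence of parameters (indeterminates), $\bar{\mathsf{S}}:=(s_0^{-1},s_1^{-1},\dots)$, $\tau^n\mathsf{S}:=(s_n,s_{n+1},\dots)$, $\tau^n\bar{\mathsf{S}}:=(s_n^{-1},s_{n+1}^{-1},\dots)$. General functions. For sequences $\Xi=(\xi_0,\xi_1,\dots)$ and $\mathsf{S}$, and $k\ge0$, put $s_i^{(k)}:=\sqrt{s_{i+k}\xi_{i+k}s_i/\xi_i}$ and $\tau^k_{\Xi}\mathsf{S}:=(s^{(k)}_0,s^{(k)}_1,\dots)$. Only two cases are needed, with square roots chosen so that: if $\Xi=\mathsf{S}$ then $s_i^{(k)}=s_{i+k}$ (so $\tau^k_\Xi\mathsf{S}=\tau^k\mathsf{S}$); if $\Xi=\bar{\mathsf{S}}$ then $s_i^{(k)}=s_i$ (so $\tau^k_\Xi\mathsf{S}=\mathsf{S}$); the latter also applies with $(\tau^n\bar{\mathsf S},\tau^n\mathsf S)$ in place of $(\bar{\mathsf S},\mathsf S)$. Put $\mathsf{c}_{\mathsf{S}}(\lambda):=\prod_{i\ge1}\frac{(s_i^2;q)_{\lambda_i-\lambda_{i+1}}}{(q;q)_{\lambda_i-\lambda_{i+1}}}$,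 $(-\mathsf{S})^\lambda:=\prod_{i\ge1}(-s_{i-1})^{\lambda_i}$ (likewise for other sequences in place of $\mathsf S$). For $i,j,k,l\in\mathbb{Z}_{\ge0}$ (labels of the bottom, left, top, right edge) let $$W_{t,s}(i,j;k,l):=\mathbf{1}_{i+j=k+l}\,\mathbf{1}_{i\ge l}\,(s^2/t^2)^{l}\frac{(s^2/t^2;q)_{i-l}(t^2;q)_l}{(s^2;q)_i}\frac{(q;q)_i}{(q;q)_{i-l}(q;q)_l}.$$ For $a_1,\dots,a_n\in\mathbb{Z}_{\ge0}$ and $L>l(\lambda),l(\mu)$, $$ZW^{(a_1,\dots,a_n)}_{\lambda/\mu}(\kappa_1,\dots,\kappa_n\mid\Xi,\mathsf{S}):=\sum\prod_{r=1}^n\prod_{c=1}^L W_{t_{r,c},\,s^{(r)}_c}(v_{r,c},h_{r,c-1};v_{r-1,c},h_{r,c}),\qquad t_{r,c}^2=\frac{\xi_{r+c}s_{r+c}}{\kappa_r},$$ the sum being over all nonnegative integers $v_{r,c}$ ($0\le r\le n$, $1\le c\le L$) and $h_{r,c}$ ($1\le r\le n$, $0\le c\le L$) with $v_{0,c}=m_c(\lambda')$, $v_{n,c}=m_c(\mu')$, $h_{r,0}=a_r$, $h_{r,L}=0$ (independent of $L$). Then $$\mathbb{F}_{\lambda/\mu}(\kappa_1,\dots,\kappa_n\mid\Xi,\mathsf{S}):=\frac{(-\tau^n_\Xi\mathsf{S})^{\mu}}{(-\mathsf{S})^{\lambda}}\frac{\mathsf{c}_{\tau^n_\Xi\mathsf{S}}(\mu)}{\mathsf{c}_{\mathsf{S}}(\lambda)}\sum_{a_1+\dots+a_n=\lambda_1-\mu_1}\Bigl(\prod_{i=1}^n(\kappa_is_0/\xi_0)^{a_i}\frac{(\kappa_i^{-1}s_i\xi_i;q)_{a_i}}{(q;q)_{a_i}}\Bigr)ZW^{(a_1,\dots,a_n)}_{\lambda/\mu}(\kappa_1,\dots,\kappa_n\mid\Xi,\mathsf{S}),$$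 $$\mathbb{F}^*_{\lambda/\mu}(\kappa_1,\dots,\kappa_n\mid\Xi,\mathsf{S}):=\frac{\mathsf{c}_{\mathsf{S}}(\lambda)}{\mathsf{c}_{\tau^n_\Xi\mathsf{S}}(\mu)}\,\mathbb{F}_{\lambda/\mu}(\kappa_1,\dots,\kappa_n\mid\Xi,\mathsf{S}).$$ These are polynomials in the variables $\kappa_1,\dots,\kappa_n$, and are regarded as formal power series in the variables and $q$ with coefficients rational in $\mathsf{S}$. Convergence of infinite sums is in the ring of formal power series. *)

(* Defs.v *)
From HB Require Import structures.
From mathcomp Require Import all_boot all_order all_algebra.
From mathcomp Require Import boolp.
From mathcomp Require Import mpoly.

Set Implicit Arguments.
Unset Strict Implicit.
Unset Printing Implicit Defensive.

Import GRing.Theory.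
Local Open Scope ring_scope.

(* -------------------------------------------------------------------- *)
(* Formal power series in k variables over a field, with the Cauchy     *)
(* product. The type is wrapped in a record so that it does not inherit *)
(* the pointwise ring structure of functions.                           *)

Record mfps (k : nat) (K : fieldType) := MFPS { sercoef : 'X_{1..k} -> K }.

Section MFPS.
Variables (k : nat) (K : fieldType).
Implicit Types (f g h : mfps k K) (m : 'X_{1..k}) (p : {mpoly K[k]}).

HB.instance Definition _ := gen_eqMixin (mfps k K).
HB.instance Definition _ := gen_choiceMixin (mfps k K).

Lemma mfpsP f g : sercoef f =1 sercoef g -> f = g.
Proof. by case: f; case: g => f g /= /funext ->. Qed.

Definition ser_of_mpoly p : mfps k K := MFPS (fun m => p@_m).
Definition ser_zero : mfps k K := ser_of_mpoly 0.
Definition ser_one : mfps k K := ser_of_mpoly 1.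
Definition ser_opp f : mfps k K := MFPS (fun m => - sercoef f m).
Definition ser_add f g : mfps k K := MFPS (fun m => sercoef f m + sercoef g m).
Definition ser_mul f g : mfps k K := MFPS (fun m =>
  \sum_(u : 'X_{1..k < (mdeg m).+1, (mdeg m).+1} | m == (u.1 + u.2)%MM)
     sercoef f u.1 * sercoef g u.2).

Definition ser_trunc (d : nat) (P : pred 'X_{1..k}) f : {mpoly K[k]} :=
  \sum_(m : 'X_{1..k < d} | P m) sercoef f m *: 'X_[m].

Lemma ser_truncE d P f m :
  (ser_trunc d P f)@_m = if (mdeg m < d)%N && P m then sercoef f m else 0.
Proof.
rewrite /ser_trunc raddf_sum /=.
case: ifP => [/andP[md Pm]|H].
  rewrite (bigD1 (BMultinom md)) //= mcoeffZ mcoeffX eqxx mulr1.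
  rewrite big1 ?addr0 // => u /andP[_ /eqP um].
  rewrite mcoeffZ mcoeffX; case: eqP => [e|_]; last by rewrite mulr0.
  by case: um; apply/val_inj.
apply: big1 => u Pu; rewrite mcoeffZ mcoeffX.
case: eqP => [e|_]; last by rewrite mulr0.
by move: H; rewrite -e Pu bmdeg.
Qed.

Lemma mdeg_addE (m a b : 'X_{1..k}) :
  m = (a + b)%MM -> (mdeg a + mdeg b)%N = mdeg m.
Proof. by move=> ->; rewrite mdegD. Qed.
Lemma mdeg_addl (m a b : 'X_{1..k}) : m = (a + b)%MM -> (mdeg a <= mdeg m)%N.
Proof. by move=> ->; rewrite mdegD leq_addr. Qed.
Lemma mdeg_addr (m a b : 'X_{1..k}) : m = (a + b)%MM -> (mdeg b <= mdeg m)%N.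
Proof. by move=> ->; rewrite mdegD leq_addl. Qed.

Lemma mdeg_addlt d e (m a b : 'X_{1..k}) : m = (a + b)%MM ->
  (d <= mdeg a)%N -> (mdeg m < d + e)%N -> (mdeg b < e)%N.
Proof.
move=> -> da; rewrite mdegD => H; rewrite -(ltn_add2l d).
by apply: leq_ltn_trans H; rewrite leq_add2r.
Qed.

Lemma ser_mulE d f g m : (mdeg m < d)%N ->
  sercoef (ser_mul f g) m = (ser_trunc d predT f * ser_trunc d predT g)@_m.
Proof.
move=> md; rewrite mcoeffM /=; apply: eq_bigr => u /eqP mu.
rewrite !ser_truncE !andbT.
by rewrite !(leq_ltn_trans _ md) ?(mdeg_addl mu) ?(mdeg_addr mu).
Qed.

Lemma ser_trunc_mul d f g m : (mdeg m < d)%N ->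
  forall p : {mpoly K[k]},
  (ser_trunc d predT (ser_mul f g) * p)@_m =
  (ser_trunc d predT f * ser_trunc d predT g * p)@_m.
Proof.
move=> md p; rewrite !(mcoeffM _ p); apply: eq_bigr => u /eqP mu.
have ud : (mdeg u.1 < d)%N := leq_ltn_trans (mdeg_addl mu) md.
by rewrite ser_truncE ud andTb (ser_mulE f g ud).
Qed.

Lemma ser_addA : associative ser_add.
Proof. by move=> f g h; apply: mfpsP => m /=; rewrite addrA. Qed.
Lemma ser_addC : commutative ser_add.
Proof. by move=> f g; apply: mfpsP => m /=; rewrite addrC. Qed.
Lemma ser_add0 : left_id ser_zero ser_add.
Proof. by move=> f; apply: mfpsP => m /=; rewrite mcoeff0 add0r. Qed.
Lemma ser_addN : left_inverse ser_zero ser_opp ser_add.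
Proof. by move=> f; apply: mfpsP => m /=; rewrite addNr mcoeff0. Qed.

HB.instance Definition _ :=
  GRing.isZmodule.Build (mfps k K) ser_addA ser_addC ser_add0 ser_addN.

Lemma ser_mulC : commutative ser_mul.
Proof.
move=> f g; apply: mfpsP => m.
by rewrite !(ser_mulE _ _ (ltnSn (mdeg m))) mulrC.
Qed.

Lemma ser_mulA : associative ser_mul.
Proof.
move=> f g h; apply: mfpsP => m; have md := ltnSn (mdeg m).
by rewrite ser_mulC !(ser_mulE _ _ md) !(ser_trunc_mul _ _ md) mulrC mulrA.
Qed.

Lemma ser_trunc_of_mpoly d p m : (mdeg m < d)%N ->
  (ser_trunc d predT (ser_of_mpoly p))@_m = p@_m.
Proof. by move=> md; rewrite ser_truncE md. Qed.

Lemma ser_mul1 : left_id ser_one ser_mul.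
Proof.
move=> f; apply: mfpsP => m; have md := ltnSn (mdeg m).
rewrite (ser_mulE _ _ md).
suff -> : ser_trunc (mdeg m).+1 predT ser_one = 1 by rewrite mul1r ser_truncE md.
apply/mpolyP => u; rewrite ser_truncE andbT /= mcoeff1.
by case: ltnP => //; case: eqP => // ->; rewrite mdeg0.
Qed.

Lemma ser_mulDl : left_distributive ser_mul ser_add.
Proof.
move=> f g h; apply: mfpsP => m /=.
by rewrite -big_split; apply: eq_bigr => u _; rewrite mulrDl.
Qed.

Lemma ser_one_neq0 : ser_one != 0.
Proof.
apply/eqP => /(congr1 (fun f => sercoef f 0%MM)) /= /eqP.
by rewrite mcoeff1 mcoeff0 eqxx oner_eq0.
Qed.

HB.instance Definition _ := GRing.Zmodule_isComNzRing.Build (mfps k K)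
  ser_mulA ser_mulC ser_mul1 ser_mulDl ser_one_neq0.

Lemma sercoefD f g m : sercoef (f + g) m = sercoef f m + sercoef g m.
Proof. by []. Qed.
Lemma sercoefN f m : sercoef (- f) m = - sercoef f m.
Proof. by []. Qed.
Lemma sercoef0 m : sercoef (0 : mfps k K) m = 0.
Proof. exact: mcoeff0. Qed.
Lemma sercoef1 m : sercoef (1 : mfps k K) m = (m == 0%MM)%:R.
Proof. exact: mcoeff1. Qed.
Lemma sercoef_sum I (r : seq I) (P : pred I) (F : I -> mfps k K) m :
  sercoef (\sum_(i <- r | P i) F i) m = \sum_(i <- r | P i) sercoef (F i) m.
Proof. by elim/big_rec2: _ => [|i x y _ <-]; rewrite ?sercoef0. Qed.
Lemma sercoefM f g m : sercoef (f * g) m =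
  \sum_(u : 'X_{1..k < (mdeg m).+1, (mdeg m).+1} | m == (u.1 + u.2)%MM)
     sercoef f u.1 * sercoef g u.2.
Proof. by []. Qed.

Definition ser_ord (d : nat) f := forall m, (mdeg m < d)%N -> sercoef f m = 0.

Lemma ser_ordM d e f g : ser_ord d f -> ser_ord e g -> ser_ord (d + e) (f * g).
Proof.
move=> fd ge m md; rewrite sercoefM big1 // => u /eqP mu.
case: (ltnP (mdeg u.1) d) => [/fd ->|du]; first by rewrite mul0r.
by rewrite ge ?mulr0 // (mdeg_addlt mu du md).
Qed.

Lemma ser_ordX d f : ser_ord 1 f -> ser_ord d (f ^+ d).
Proof.
move=> f1; elim: d => [|d IH]; first by move=> m; rewrite ltn0.
by rewrite exprS -add1n; apply: ser_ordM.
Qed.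

Lemma ser_eq_modM d f f' g : ser_ord d (f - f') -> ser_ord d (f * g - f' * g).
Proof.
by move=> H; rewrite -mulrBl -[d]addn0; apply: ser_ordM => // m; rewrite ltn0.
Qed.

Lemma sercoef0M f g :
  sercoef (f * g) 0%MM = sercoef f 0%MM * sercoef g 0%MM.
Proof.
have md : (mdeg (0%MM : 'X_{1..k}) < 1)%N by rewrite mdeg0.
rewrite (ser_mulE _ _ md).
have c0 x : ser_trunc 1 predT x = (sercoef x 0%MM)%:MP.
  apply/mpolyP => u; rewrite ser_truncE andbT mcoeffC ltnS leqn0 mdeg_eq0.
  by case: eqP => [->|_]; rewrite ?mulr1 ?mulr0.
by rewrite !c0 -mpolyCM mcoeffC eqxx mulr1.
Qed.

(* Units: the series with nonzero constant term c; the inverse of        *)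
(* c * (1 - h) is the geometric series c^-1 * (1 + h + h^2 + ...).        *)
Definition ser_unit : {pred mfps k K} := fun f => sercoef f 0%MM != 0.
Definition ser_geom f : mfps k K :=
  MFPS (fun m => \sum_(i < (mdeg m).+1) sercoef (f ^+ i) m).
Definition ser_cst (c : K) : mfps k K := ser_of_mpoly c%:MP.
Definition ser_inv f : mfps k K :=
  if f \in ser_unit then
    ser_cst (sercoef f 0%MM)^-1 *
    ser_geom (1 - ser_cst (sercoef f 0%MM)^-1 * f)
  else f.

Lemma ser_geomE d f : ser_ord 1 f ->
  ser_ord d (ser_geom f - \sum_(i < d) f ^+ i).
Proof.
move=> f1 m md; rewrite sercoefD sercoefN sercoef_sum /=.
apply/eqP; rewrite subr_eq0; apply/eqP.
rewrite -(big_mkord xpredT (fun i => sercoef (f ^+ i) m)).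
rewrite -(big_mkord xpredT (fun i => sercoef (f ^+ i) m)).
rewrite (big_cat_nat (n := (mdeg m).+1) (p := d)) //=.
rewrite [X in _ + X]big_nat [X in _ + X]big1 ?addr0 // => i /andP[mi _].
exact: (ser_ordX f1).
Qed.

Lemma ser_geomM f : ser_ord 1 f -> ser_geom f * (1 - f) = 1.
Proof.
move=> f1; apply: mfpsP => m.
have md := ltnSn (mdeg m); set d := (mdeg m).+1 in md.
have /(_ m md) := ser_eq_modM (1 - f) (ser_geomE f1 (d := d)).
rewrite sercoefD sercoefN => /eqP; rewrite subr_eq0 => /eqP ->.
have -> : (\sum_(i < d) f ^+ i) * (1 - f) = 1 - f ^+ d.
  rewrite mulrC -[X in _ = X - _](expr1n _ d) subrXX.
  by congr (_ * _); apply: eq_bigr => i _; rewrite expr1n mul1r.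
by rewrite sercoefD sercoefN (ser_ordX f1 (m := m)) // subr0.
Qed.

Lemma ser_cst_coef0 c : sercoef (ser_cst c) 0%MM = c.
Proof. by rewrite /= mcoeffC eqxx mulr1. Qed.

Lemma ser_mulVx : {in ser_unit, left_inverse 1 ser_inv *%R}.
Proof.
move=> f Uf; rewrite /ser_inv Uf.
set c := ser_cst _; set h := 1 - c * f.
have -> : c * ser_geom h * f = ser_geom h * (1 - h).
  by rewrite /h subKr mulrAC mulrC.
apply: ser_geomM => m; rewrite ltnS leqn0 mdeg_eq0 => /eqP ->.
rewrite /h sercoefD sercoefN sercoef0M sercoef1 eqxx ser_cst_coef0.
by rewrite mulVf ?subrr.
Qed.

Lemma ser_unitPl f g : g * f = 1 -> ser_unit f.
Proof.
move=> /(congr1 (fun x => sercoef x 0%MM)); rewrite sercoef0M sercoef1 eqxx.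
by move=> gf; apply/eqP => f0; move/eqP: gf; rewrite f0 mulr0 eq_sym oner_eq0.
Qed.

Lemma ser_invr_out : {in [predC ser_unit], ser_inv =1 id}.
Proof. by move=> f; rewrite inE /= /ser_inv => /negbTE ->. Qed.

HB.instance Definition _ := GRing.ComNzRing_hasMulInverse.Build (mfps k K)
  ser_mulVx ser_unitPl ser_invr_out.

Lemma ser_unitE f : (f \is a GRing.unit) = (sercoef f 0%MM != 0).
Proof. by []. Qed.

Lemma ser_lowest f : f != 0 ->
  exists d, ser_ord d f /\ ser_trunc d.+1 [pred m | mdeg m == d] f != 0.
Proof.
move=> f0.
have [m fm] : exists m, sercoef f m != 0.
  apply: contrapT => H; move/eqP: f0; apply; apply: mfpsP => m.
  by rewrite sercoef0; apply/eqP/negPn/negP => fm; apply: H; exists m.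
pose P d := [exists u : 'X_{1..k < d.+1}, (mdeg u == d) && (sercoef f u != 0)].
have exP : exists d, P d.
  by exists (mdeg m); apply/existsP; exists (BMultinom (ltnSn _)); rewrite eqxx.
case: (ex_minnP exP) => d /existsP[u /andP[/eqP ud fu]] dmin.
exists d; split.
  move=> v vd; apply/eqP/negPn/negP => fv; move: vd; rewrite ltnNge dmin //.
  by apply/existsP; exists (BMultinom (ltnSn (mdeg v))); rewrite eqxx.
apply/eqP => /(congr1 (mcoeff u)); rewrite mcoeff0 ser_truncE /= ud eqxx ltnSn.
by apply/eqP.
Qed.

Lemma ser_integral : GRing.integral_domain_axiom (mfps k K).
Proof.
move=> f g fg0; apply/norP => -[/ser_lowest[d [fd Hf]] /ser_lowest[e [ge Hg]]].
set p := ser_trunc _ _ _ in Hf; set r := ser_trunc _ _ _ in Hg.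
have /negP[] : p * r != 0 by rewrite mulf_neq0.
apply/eqP/mpolyP => m; rewrite mcoeff0.
case: (eqVneq (mdeg m) (d + e)%N) => [mde|mde]; last first.
  rewrite mcoeffM big1 // => u /eqP mu; rewrite !ser_truncE /=.
  case: (eqVneq (mdeg u.1) d) => e1; last by rewrite andbF mul0r.
  case: (eqVneq (mdeg u.2) e) => e2; last by rewrite andbF mulr0.
  by have mdE := mdeg_addE mu; rewrite -mdE e1 e2 eqxx in mde.
have := congr1 (fun x => sercoef x m) fg0; rewrite sercoef0 => <-.
rewrite sercoefM mcoeffM; apply: eq_bigr => u /eqP mu; rewrite !ser_truncE /=.
have de : (mdeg u.1 + mdeg u.2 = d + e)%N by rewrite (mdeg_addE mu).
case: (ltngtP (mdeg u.1) d) => [u1|u1|u1].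
- by rewrite (fd _ u1) andbF !mul0r.
- have u2 : (mdeg u.2 < e)%N by rewrite -(ltn_add2l d) -de ltn_add2r.
  by rewrite (ge _ u2) !if_same !mulr0.
- have u2 : mdeg u.2 = e by apply/(@addnI d); rewrite -de u1.
  by rewrite u1 u2 eqxx !ltnSn.
Qed.

HB.instance Definition _ :=
  GRing.ComUnitRing_isIntegral.Build (mfps k K) ser_integral.

Definition ser_var (i : 'I_k) : mfps k K := ser_of_mpoly 'X_i.

(* The limit in the formal power series topology: each coefficient is
   eventually constant. *)
Definition ser_cvg (u : nat -> mfps k K) (f : mfps k K) : Prop :=
  forall m, exists N, forall i, (N <= i)%N -> sercoef (u i) m = sercoef f m.

(* The limit of a convergent sequence, and 0 for a divergent one. *)
Definition ser_lim (u : nat -> mfps k K) : mfps k K :=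
  if pselect (exists f, ser_cvg u f) is left e then projT1 (cid e) else 0.

Lemma ser_limE u f : ser_cvg u f -> ser_lim u = f.
Proof.
move=> uf; rewrite /ser_lim; case: pselect => [e|[]]; last by exists f.
case: (cid e) => g ug /=; apply: mfpsP => m.
have [N1 H1] := uf m; have [N2 H2] := ug m.
by rewrite -(H1 (maxn N1 N2)) ?leq_maxl // (H2 (maxn N1 N2)) ?leq_maxr.
Qed.

(* The terms x i, given in the field of fractions, are power series, and *)
(* their sum over i : I converges to f: each monomial occurs in only     *)
(* finitely many terms.                                                  *)
Definition ser_has_sum (I : choiceType) (x : I -> {fraction mfps k K})
    (f : mfps k K) : Prop :=
  exists2 g : I -> mfps k K, (forall i, x i = tofrac (g i)) &
    forall m, exists r : seq I,
      [/\ uniq r, (forall i, i \notin r -> sercoef (g i) m = 0)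
        & sercoef f m = \sum_(i <- r) sercoef (g i) m].

End MFPS.

(* -------------------------------------------------------------------- *)

Definition qpoch (R : nzRingType) (x q : R) (n : nat) : R :=
  \prod_(i < n) (1 - x * q ^+ i).

Lemma qpochS (R : nzRingType) (x q : R) n :
  qpoch x q n.+1 = qpoch x q n * (1 - x * q ^+ n).
Proof. by rewrite /qpoch big_ord_recr. Qed.

Definition qpoch_inf (k : nat) (K : fieldType) (x q : mfps k K) : mfps k K :=
  ser_lim (qpoch x q).

Lemma qpoch_inf_cvg (k : nat) (K : fieldType) (x q : mfps k K) :
  sercoef q 0%MM = 0 -> ser_cvg (qpoch x q) (qpoch_inf x q).
Proof.
move=> q0.
have q1 : ser_ord 1 q by move=> m; rewrite ltnS leqn0 mdeg_eq0 => /eqP ->.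
have stable m i : sercoef (qpoch x q ((mdeg m).+1 + i)) m
                = sercoef (qpoch x q (mdeg m).+1) m.
  elim: i => [|i IH]; first by rewrite addn0.
  rewrite addnS qpochS mulrBr mulr1 mulrA sercoefD sercoefN IH.
  rewrite [X in _ - X](_ : _ = 0) ?subr0 //.
  have Q := ser_ordX (d := ((mdeg m).+1 + i)%N) q1.
  have T (y : mfps k K) : ser_ord 0 y by move=> ?; rewrite ltn0.
  by apply: (ser_ordM (T _) Q); rewrite add0n ltnS leq_addr.
suff C : ser_cvg (qpoch x q) (MFPS (fun m => sercoef (qpoch x q (mdeg m).+1) m)).
  by rewrite /qpoch_inf (ser_limE C).
by move=> m; exists (mdeg m).+1 => i mi; rewrite -(subnKC mi) stable.
Qed.

(* -------------------------------------------------------------------- *)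
(* A partition is given by the list of its nonzero parts; the part of    *)
(* index i >= 1 is nth 0 la i.-1, so that it is 0 for i > l(la).         *)

Definition is_intpart (la : seq nat) : bool := sorted geq la && (0%N \notin la).

Record intpart := IntPart { parts :> seq nat; _ : is_intpart parts }.

HB.instance Definition _ := [isSub for parts].
HB.instance Definition _ := [Choice of intpart by <:].

Definition part (la : intpart) (i : nat) : nat := nth 0%N la i.-1.
Definition plen (la : intpart) : nat := size la.

(* The multiplicity of j >= 1 in the conjugate of la; the subtraction of *)
(* naturals is exact since the parts decrease.                           *)
Definition conj_mult (la : intpart) (j : nat) : nat := part la j - part la j.+1.

(* -------------------------------------------------------------------- *)
(* A sequence (s_0, s_1, ...) is a function on nat, and kappa i, for      *)
(* i : 'I_n, is the variable kappa_{i+1}.                                *)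

Definition seq_shift (T : Type) (k : nat) (S : nat -> T) : nat -> T :=
  fun i => S (i + k)%N.
Definition seq_inv (E : fieldType) (S : nat -> E) : nat -> E :=
  fun i => (S i)^-1.

Section SpinQWhittaker.
Variables (E : fieldType) (q : E).
Implicit Types (S Xi : nat -> E) (tau : nat -> nat -> E).

(* tau k i = s_i^(k) is a choice of the square roots which define the    *)
(* sequences tau^k_Xi S.                                                 *)
Definition is_tauXi Xi S tau : Prop :=
  forall k i, tau k i ^+ 2 = S (i + k)%N * Xi (i + k)%N * S i / Xi i.

(* For Xi = S, the roots with tau^k_Xi S = tau^k S. *)
Definition tau_self S : nat -> nat -> E := fun k => seq_shift k S.
(* For Xi = seq_inv S, the roots with tau^k_Xi S = S. *)
Definition tau_inv S : nat -> nat -> E := fun _ => S.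

Lemma tau_selfP S : (forall i, S i != 0) -> is_tauXi S S (tau_self S).
Proof.
by move=> S0 k i; rewrite /tau_self /seq_shift mulfK // expr2.
Qed.

Lemma tau_invP S : (forall i, S i != 0) -> is_tauXi (seq_inv S) S (tau_inv S).
Proof.
move=> S0 k i; rewrite /tau_inv /seq_inv divff ?S0 // mul1r invrK.
by rewrite expr2.
Qed.

Definition cS S (la : intpart) : E :=
  \prod_(1 <= i < (plen la).+1)
     (qpoch (S i ^+ 2) q (part la i - part la i.+1)
      / qpoch q q (part la i - part la i.+1)).

Definition negpow S (la : intpart) : E :=
  \prod_(1 <= i < (plen la).+1) (- S i.-1) ^+ part la i.

(* W_{t,s}(i,j;k,l), which depends on t and s only through t^2 and s^2. *)
Definition Wweight (t2 s2 : E) (i j k l : nat) : E :=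
  if (i + j == k + l)%N && (l <= i)%N then
    (s2 / t2) ^+ l
    * (qpoch (s2 / t2) q (i - l) * qpoch t2 q l / qpoch s2 q i)
    * (qpoch q q i / (qpoch q q (i - l) * qpoch q q l))
  else 0.

Section Row.
Variables (n : nat) (kappa : 'I_n -> E) (Xi S : nat -> E) (tau : nat -> nat -> E).
Variables (la mu : intpart).

(* A summand of ZW on a grid of n rows and L columns with labels below b.
   v (r, c) is the label v_{r,c+1} and h (r, c) the label h_{r+1,c}. *)
Definition ZWboundary (L b : nat) (a : 'I_n -> nat)
    (v : {ffun 'I_n.+1 * 'I_L -> 'I_b}) (h : {ffun 'I_n * 'I_L.+1 -> 'I_b}) :=
  [&& [forall c : 'I_L, v (ord0, c) == conj_mult la c.+1 :> nat],
      [forall c : 'I_L, v (ord_max, c) == conj_mult mu c.+1 :> nat],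
      [forall r : 'I_n, h (r, ord0) == a r :> nat] &
      [forall r : 'I_n, h (r, ord_max) == 0%N :> nat]].

Definition ZWweight (L b : nat)
    (v : {ffun 'I_n.+1 * 'I_L -> 'I_b}) (h : {ffun 'I_n * 'I_L.+1 -> 'I_b}) : E :=
  \prod_(r < n) \prod_(c < L)
    Wweight (Xi (r.+1 + c.+1)%N * S (r.+1 + c.+1)%N / kappa r)
            (tau r.+1 c.+1 ^+ 2)
            (v (lift ord0 r, c)) (h (r, widen_ord (leqnSn L) c))
            (v (widen_ord (leqnSn n) r, c)) (h (r, lift ord0 c)).

(* Only labels at most part la 1 contribute, by grid_labels_bounded below;
   any number of columns larger than l(la) and l(mu) gives the same sum. *)
Definition ZW (a : 'I_n -> nat) : E :=
  let L := (maxn (plen la) (plen mu)).+1 in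
  let b := (part la 1).+1 in
  \sum_(v : {ffun 'I_n.+1 * 'I_L -> 'I_b})
  \sum_(h : {ffun 'I_n * 'I_L.+1 -> 'I_b} | ZWboundary a v h) ZWweight v h.

(* The condition a_1 + ... + a_n = la_1 - mu_1 is an equality of integers:
   there is no summand when la_1 < mu_1. *)
Definition bbF : E :=
  negpow (tau n) mu / negpow S la * (cS (tau n) mu / cS S la)
  * \sum_(a : {ffun 'I_n -> 'I_(part la 1).+1}
            | ((\sum_(i < n) a i) + part mu 1 == part la 1)%N)
      (\prod_(i < n) ((kappa i * S 0%N / Xi 0%N) ^+ a i
         * (qpoch ((kappa i)^-1 * S i.+1 * Xi i.+1) q (a i)
            / qpoch q q (a i))))
      * ZW (fun i => a i).

Definition bbFstar : E := cS S la / cS (tau n) mu * bbF.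

End Row.
End SpinQWhittaker.

(* On a grid with conserved labels, h r L = 0 and h r c.+1 <= v r.+1 c, as
   imposed by the indicators of W, the labels are bounded by the sum of the
   top row v 0. *)
Lemma grid_labels_bounded (n L : nat) (v h : nat -> nat -> nat) :
  (forall r c, (r < n)%N -> (c < L)%N ->
     (v r.+1 c + h r c = v r c + h r c.+1)%N /\ (h r c.+1 <= v r.+1 c)%N) ->
  (forall r, (r < n)%N -> h r L = 0%N) ->
  (forall r c, (r <= n)%N -> (c < L)%N -> (v r c <= \sum_(j < L) v 0 j)%N) /\
  (forall r c, (r < n)%N -> (c <= L)%N -> (h r c <= \sum_(j < L) v 0 j)%N).
Proof.
move=> cons hL.
have row r : (r < n)%N ->
    (\sum_(j < L) v r.+1 j + h r 0 = \sum_(j < L) v r j)%N.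
  move=> rn.
  have H : forall c, (c <= L)%N ->
    (\sum_(j < c) v r.+1 j + h r 0 = \sum_(j < c) v r j + h r c)%N.
    elim=> [|c IH] cL; first by rewrite !big_ord0.
    rewrite !big_ord_recr /= addnAC IH 1?ltnW // -!addnA; congr (_ + _)%N.
    by have [] := cons r c rn cL; rewrite addnC.
  by rewrite H // hL // addn0.
have tot r : (r <= n)%N -> (\sum_(j < L) v r j <= \sum_(j < L) v 0 j)%N.
  elim: r => // r IH rn; apply: leq_trans (IH (ltnW rn)).
  by rewrite -(row r rn) leq_addr.
have vb r c : (r <= n)%N -> (c < L)%N -> (v r c <= \sum_(j < L) v 0 j)%N.
  move=> rn cL; apply: leq_trans (tot r rn).
  by rewrite (bigD1 (Ordinal cL)) //= leq_addr.
split=> // r [|c] rn cL.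
  by apply: leq_trans (tot r (ltnW rn)); rewrite -(row r rn) leq_addl.
by apply: leq_trans (vb r.+1 c rn cL); have [] := cons r c rn cL.
Qed.

(* -------------------------------------------------------------------- *)

(* The s_i are indeterminates: algebraically independent over Q. Since p
   may be a constant, K then has characteristic 0. *)
Definition alg_independent (K : fieldType) (s : nat -> K) : Prop :=
  forall (k : nat) (p : {mpoly int[k]}), p != 0 ->
    mmap intr (fun i : 'I_k => s i) p != 0.

(* The variables kappa_1..kappa_n, chi_1..chi_m, q, in this order. *)
Section Variables.
Variables (K : fieldType) (n m : nat).
Definition var_kappa (i : 'I_n) : mfps (n + m + 1) K :=
  ser_var K (lshift 1 (lshift m i)).
Definition var_chi (j : 'I_m) : mfps (n + m + 1) K :=
  ser_var K (lshift 1 (rshift n j)).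
Definition var_q : mfps (n + m + 1) K :=
  ser_var K (rshift (n + m) ord0).
End Variables.

(* Main.v *)
Require Import Defs.
From HB Require Import structures.
From mathcomp Require Import all_boot all_order all_algebra.
From mathcomp Require Import boolp.
From mathcomp Require Import mpoly.
From mathcomp Require Import ring zify.

(** Up to prefactors that telescope, F and F* are compositions of one-variable
    kernels [Fker] and [Gker] on partitions, so it suffices to move one F past
    one F*. Since a nonzero power series stays nonzero when each chi_j is
    replaced by a suitable power q^{k_j}, the identity may be checked after
    these substitutions, where all sums become finite. At chi = q^j, the kernel
    of F* is a product of j kernels [Hker] with u = 1, q, ..., q^{j-1}, of
    six-vertex type with horizontal labels 0 and 1: the kernel for q u is
    the kernel for u composed with [Hker u]. The kernels of F and [Hker] are
    exchanged by carrying a 2 x 2 R-matrix through the columns, which yields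
    the scalar (1 - kappa u) / (1 - u s_1^2); the product of these scalars
    over u is the prefactor of the theorem at chi = q^j. *)

Set Implicit Arguments.
Unset Strict Implicit.
Unset Printing Implicit Defensive.

Import GRing.Theory.
Local Open Scope ring_scope.

(** * Sums over sequences of bounded entries *)

(** For a generic chi the kernel of F* has unbounded horizontal labels, so a direct exchange would
    need an infinite R-matrix and a convergence argument at every column. At chi = q^j a part grows
    by at most j under F*, all intermediate partitions stay in one box, and each local identity
    becomes a rational one in finitely many letters. The scalar of the exchange appears because the
    row vector (1, 1) is a left eigenvector of the R-matrix. The parameters move only on one side: a
    variable of F shifts the sequence S, a variable of F* does not. Passing the i-th F therefore
    produces s_i^2 and leaves tau^n S in the F* on the right. Infinitely many terms occur only on
    the left-hand side of the theorem. Convergence there comes from F: its factors kappa - b q^i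
    with i > 0 have no constant term, so its order grows with the first part of lambda. For this the
    kernels must be honest power series, which is why they are written without division by kappa and
    are compared with the lattice sums in the field of fractions. *)

Fixpoint boxes (N B : nat) : seq (seq nat) :=
  if N is N'.+1 then [seq x :: l | x <- iota 0 B, l <- boxes N' B]
  else [:: [::]].

Lemma mem_boxes N B l :
  (l \in boxes N B) = (size l == N) && all (fun x => x < B)%N l.
Proof.
elim: N l => [|N IH] [|x l] //=.
  by apply/negbTE/allpairsP => -[[y k] /= [_ _]].
apply/allpairsP/idP => [[[y k] /= [yB kB [-> ->]]]|].
  by move: kB yB; rewrite IH mem_iota /= => /andP[/eqP-> ->] ->; rewrite eqxx.
case/andP => sl /andP[xB al]; exists (x, l); split=> //=.
  by rewrite mem_iota.
by rewrite IH -eqSS sl.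
Qed.

Lemma boxes_uniq N B : uniq (boxes N B).
Proof.
elim: N => //= N IH; apply: allpairs_uniq => //; first exact: iota_uniq.
by move=> [x l] [y k] _ _ /= [-> ->].
Qed.

Section SumBoxes.
Variable R : nmodType.
Implicit Types f : seq nat -> R.

Lemma big_boxes0 B f : \sum_(l <- boxes 0 B) f l = f [::].
Proof. by rewrite big_seq1. Qed.

Lemma big_boxesS N B f : \sum_(l <- boxes N.+1 B) f l =
  \sum_(0 <= x < B) \sum_(l <- boxes N B) f (x :: l).
Proof. by rewrite /= big_allpairs_dep /index_iota subn0. Qed.

Lemma big_boxes_rcons N B f : \sum_(l <- boxes N.+1 B) f l =
  \sum_(l <- boxes N B) \sum_(0 <= x < B) f (rcons l x).
Proof.
elim: N f => [|N IH] f.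
  by rewrite big_boxesS big_boxes0; apply: eq_bigr => x _; rewrite big_boxes0.
rewrite big_boxesS [RHS]big_boxesS; apply: eq_bigr => x _.
by rewrite IH.
Qed.

Lemma big_boxes_widen N B C f : (B <= C)%N ->
  (forall l, l \in boxes N C -> ~~ all (fun x => x < B)%N l -> f l = 0) ->
  \sum_(l <- boxes N C) f l = \sum_(l <- boxes N B) f l.
Proof.
move=> BC f0; rewrite (bigID (all (fun x => x < B)%N)) /=.
rewrite [X in _ + X]big_seq_cond [X in _ + X]big1 ?addr0; last first.
  by move=> l /andP[]; apply: f0.
rewrite -big_filter; apply: perm_big; apply: uniq_perm.
- exact/filter_uniq/boxes_uniq.
- exact: boxes_uniq.
move=> l; rewrite mem_filter !mem_boxes andbCA.
case: (size l == N) => //=; case: (boolP (all _ l)) => //= H.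
by apply/allP => x /(allP H) xB; apply: leq_trans BC.
Qed.

Lemma sum_nat_succ2 B n (F : nat -> R) : (n.+1 < B)%N ->
  (forall x, x != n -> x != n.+1 -> F x = 0) ->
  \sum_(0 <= x < B) F x = F n + F n.+1.
Proof.
move=> nB F0; have n1B := ltnW nB.
rewrite (bigD1_seq n) ?iota_uniq ?mem_index_iota //=; congr (_ + _).
rewrite -big_filter (bigD1_seq n.+1) ?filter_uniq ?iota_uniq //=; last first.
  by rewrite mem_filter mem_index_iota nB gtn_eqF.
by rewrite big1_seq ?addr0 // => x; rewrite mem_filter => /and3P[? ? _]; apply: F0.
Qed.

Lemma sum_nat_pred2 B n (F : nat -> R) : (n < B)%N ->
  (forall x, x != n -> x.+1 != n -> F x = 0) ->
  \sum_(0 <= x < B) F x = F n + (if n is p.+1 then F p else 0).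
Proof.
case: n => [|n] nB F0; last first.
  rewrite (sum_nat_succ2 nB) 1?addrC // => x xn xn1.
  by rewrite F0 // eqSS.
rewrite (bigD1_seq 0%N) ?iota_uniq ?mem_index_iota //= big1 // => x x0.
exact: F0.
Qed.

Lemma sum_nat_only B n (F : nat -> R) : (n < B)%N ->
  (forall x, x != n -> F x = 0) -> \sum_(0 <= x < B) F x = F n.
Proof.
move=> nB F0.
by rewrite (bigD1_seq n) ?iota_uniq ?mem_index_iota //= big1 ?addr0.
Qed.

End SumBoxes.

Arguments boxes : simpl never.

(** * One-variable kernels *)

Section Kernels.
Variables (R : comUnitRingType) (q : R).
Implicit Types (k x b u : R) (l m : nat) (la mu : seq nat).

(* With d = l - m, [wal] is k^d (b/k; q)_d / (q; q)_d, without the division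
   by k. It vanishes for d < 0, and so does [wbe]; [wga] is meant for l >= m
   only, because of the truncated subtraction. *)
Definition wal k b l m : R :=
  if (m <= l)%N then (\prod_(i < l - m) (k - b * q ^+ i)) / qpoch q q (l - m)
  else 0.
Definition wbe k m l : R :=
  if (l <= m)%N then qpoch k q (m - l) / qpoch q q (m - l) else 0.
Definition wga b l m : R := qpoch q q (l - m) / qpoch b q (l - m).

(* For b c = s_{c+1}^2, F_{la/mu}(k | S, S) is (-tau S)^mu / (-S)^la times
   [Fker], and F*_{la/nu}(x | S^{-1}, S) is (-S)^la / (-S)^nu times [Gker]. *)
Definition Fker k (b : nat -> R) N la mu : R :=
  \prod_(c < N) (wga (b c) (nth 0%N la c) (nth 0%N la c.+1)
    * wal k (b c) (nth 0%N la c) (nth 0%N mu c)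
    * wbe k (nth 0%N mu c) (nth 0%N la c.+1)).

Definition Gker x (b : nat -> R) N la nu : R :=
  \prod_(c < N) (wga (b c) (nth 0%N nu c) (nth 0%N nu c.+1)
    * wal x 1 (nth 0%N la c) (nth 0%N nu c)
    * wbe (b c * x) (nth 0%N nu c) (nth 0%N la c.+1)).

Lemma FkerS k (b : nat -> R) N l la m mu : Fker k b N.+1 (l :: la) (m :: mu) =
  wga (b 0%N) l (nth 0%N la 0%N) * wal k (b 0%N) l m * wbe k m (nth 0%N la 0%N)
  * Fker k (fun c => b c.+1) N la mu.
Proof. by rewrite /Fker big_ord_recl. Qed.

Lemma GkerS x (b : nat -> R) N l la m mu : Gker x b N.+1 (l :: la) (m :: mu) =
  wga (b 0%N) m (nth 0%N mu 0%N) * wal x 1 l m * wbe (b 0%N * x) m (nth 0%N la 0%N)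
  * Gker x (fun c => b c.+1) N la mu.
Proof. by rewrite /Gker big_ord_recl. Qed.

Lemma wal_eq0 k b l m : (l < m)%N -> wal k b l m = 0.
Proof. by rewrite /wal ltnNge => /negbTE->. Qed.
Lemma wbe_eq0 k l m : (l < m)%N -> wbe k l m = 0.
Proof. by rewrite /wbe ltnNge => /negbTE->. Qed.

Lemma wal_shift k b l m : wal k b l.+1 m.+1 = wal k b l m.
Proof. by rewrite /wal ltnS subSS. Qed.
Lemma wbe_shift k l m : wbe k l.+1 m.+1 = wbe k l m.
Proof. by rewrite /wbe ltnS subSS. Qed.

End Kernels.

(** * Fusion: raising the spectral parameter from u to q u *)

Section Identities.
Variable F : fieldType.
Implicit Types u b q k X Q Z D A B : F.

(** With l = p + 1, the letters are Z = q^(p - n) and D = q^(n - k'), while A and B stand for [wal]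
    at (p, n) and [wbe] at (n, k'). The two summands are k = l and k = p in [fusion_col], here for
    l' = k'; the next lemma is the case l' = k' + 1. *)
Lemma fusion_id0 u b q Z D A B : 1 - q * Z != 0 -> 1 - u * b != 0 ->
  (1 - u * b * (q * (Z * D))) / (1 - u * b)
    * ((u - Z) * A / (1 - q * Z) * B)
  + - (u * (1 - b * (Z * D))) / (1 - u * b) * (A * B)
  = Z * (q * u - 1) * A / (1 - q * Z) * (B * (1 - b * u * D) / (1 - u * b)).
Proof. by move=> Z0 ub0; field; rewrite Z0 ub0. Qed.

Lemma fusion_id1 u b q Z D A B : 1 - q * Z != 0 -> 1 - u * b != 0 ->
  (1 - q * (Z * D)) / (1 - u * b) * ((u - Z) * A / (1 - q * Z) * B)
  + - (u - Z * D) / (1 - u * b) * (A * B)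
  = Z * (q * u - 1) * A / (1 - q * Z) * (B * (1 - D) / (1 - u * b)).
Proof. by move=> Z0 ub0; field; rewrite Z0 ub0. Qed.

End Identities.

Section Exchange.
Variables (E : fieldType) (q : E).
Implicit Types (k b u : E) (l m n : nat) (la mu nu : seq nat).
Hypothesis q0 : q != 0.
Hypothesis qP : forall n, 1 - q ^+ n.+1 != 0.

(** This is q^(l - m) with an integer exponent. The entries of the R-matrix need it for l < m too,
    where a difference of naturals would be truncated. *)
Definition qr (l m : nat) : E := q ^+ l / q ^+ m.

Lemma qn0 n : q ^+ n != 0. Proof. exact: expf_neq0. Qed.
Lemma qpoch_qq n : qpoch q q n != 0.
Proof.
by apply/prodf_neq0 => i _; rewrite -exprS.
Qed.

Lemma qr_sub l m : (m <= l)%N -> qr l m = q ^+ (l - m).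
Proof. by move=> ml; rewrite /qr -{1}(subnK ml) exprD mulfK // qn0. Qed.
Lemma qrSl l m : qr l.+1 m = q * qr l m.
Proof. by rewrite /qr exprS mulrA. Qed.
Lemma qrSr l m : qr l m.+1 = qr l m / q.
Proof. by rewrite /qr exprS invfM [q^-1 * _]mulrC mulrA. Qed.
Lemma qrM l m n : qr l m * qr m n = qr l n.
Proof. by rewrite /qr mulrA divfK // qn0. Qed.
Lemma qrnn l : qr l l = 1.
Proof. by rewrite /qr divff // qn0. Qed.

(** No condition on l and m is required: at m = l + 1, where [wal] jumps from 0 to 1, the factor 1 -
    q * qr l m vanishes. In the same way 1 - qr m l vanishes in [wbe_rec] at m = l. *)
Lemma wal_rec k b l m :
  wal q k b l.+1 m * (1 - q * qr l m) = (k - b * qr l m) * wal q k b l m.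
Proof.
case: (leqP m l) => [ml|lm].
  rewrite /wal ml (leqW ml) subSn // big_ord_recr /= qpochS -exprS qr_sub // -exprS.
  by field; rewrite qpoch_qq qP.
rewrite [in RHS]wal_eq0 // mulr0; case: (ltngtP l.+1 m) lm => // [lm|<-] _.
  by rewrite wal_eq0 ?mul0r.
by rewrite -qrSl qrnn subrr mulr0.
Qed.

Lemma wbe_rec k m l :
  wbe q k m l * (1 - qr m l) = wbe q k m l.+1 * (1 - k * qr m l / q).
Proof.
case: (ltngtP l m) => [lm|ml|->]; last first.
- by rewrite qrnn subrr mulr0 wbe_eq0 // mul0r.
- by rewrite !wbe_eq0 ?mul0r // ltnW.
rewrite /wbe lm ltnW // qr_sub ?(ltnW lm) // subnS.
have -> : (m - l = (m - l).-1.+1)%N by move: lm; lia.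
set d := _.-1 => /=; rewrite !qpochS -exprS.
have -> : k * q ^+ d.+1 / q = k * q ^+ d by rewrite exprS; field.
by field; rewrite qpoch_qq qP.
Qed.

(* The kernel of a row of the higher spin six-vertex model, where all
   horizontal labels are at most 1. *)
Definition whh u b (l k l' k' : nat) : E :=
  (if l == k then
     if l' == k' then 1 - u * b * qr k k' else
     if l' == k'.+1 then 1 - qr k k' else 0
   else if l == k.+1 then
     if l' == k' then - (u * (1 - b * qr k k')) else
     if l' == k'.+1 then - (u - qr k k') else 0
   else 0) / (1 - u * b).

Definition Hker u (b : nat -> E) N la ka : E :=
  \prod_(c < N) whh u (b c) (nth 0%N la c) (nth 0%N ka c)
                     (nth 0%N la c.+1) (nth 0%N ka c.+1).

Lemma HkerS u (b : nat -> E) N l la m mu : Hker u b N.+1 (l :: la) (m :: mu) =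
  whh u (b 0%N) l m (nth 0%N la 0%N) (nth 0%N mu 0%N)
  * Hker u (fun c => b c.+1) N la mu.
Proof. by rewrite /Hker big_ord_recl. Qed.

Lemma whh_eq0 u b l (k l' k' : nat) : l != k -> l != k.+1 -> whh u b l k l' k' = 0.
Proof. by rewrite /whh => /negbTE-> /negbTE->; rewrite mul0r. Qed.
Lemma whh_eq0' u b l (k l' k' : nat) : l' != k' -> l' != k'.+1 -> whh u b l k l' k' = 0.
Proof. by rewrite /whh => /negbTE-> /negbTE->; rewrite !if_same mul0r. Qed.

Lemma whh00 u b (k k' : nat) : whh u b k k k' k' = (1 - u * b * qr k k') / (1 - u * b).
Proof. by rewrite /whh !eqxx. Qed.
Lemma whh01 u b (k k' : nat) : whh u b k k k'.+1 k' = (1 - qr k k') / (1 - u * b).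
Proof. by rewrite /whh !eqxx gtn_eqF. Qed.
Lemma whh10 u b (k k' : nat) :
  whh u b k.+1 k k' k' = - (u * (1 - b * qr k k')) / (1 - u * b).
Proof. by rewrite /whh !eqxx gtn_eqF. Qed.
Lemma whh11 u b (k k' : nat) : whh u b k.+1 k k'.+1 k' = - (u - qr k k') / (1 - u * b).
Proof. by rewrite /whh !eqxx !gtn_eqF. Qed.


(** For b = 1 the products at q u and at u share almost all factors: prod_{i<=d} (q u - q^i) = (q u
    - 1) q^d prod_{i<d} (u - q^i). The two lemmas on [wbe] below rest on (q k; q)_d (1 - k) = (k;
    q)_(d+1). *)
Lemma wal_mulq u l m :
  wal q (q * u) 1 l.+1 m * (1 - q * qr l m) = qr l m * (q * u - 1) * wal q u 1 l m.
Proof.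
case: (ltngtP m l.+1) => [|lm|->]; last first.
- by rewrite -qrSl qrnn subrr mulr0 wal_eq0 ?mulr0.
- by rewrite !wal_eq0 ?mul0r ?mulr0 // ltnW.
rewrite ltnS => ml; rewrite /wal ml (leqW ml) subSn // qr_sub //.
set d := (l - m)%N.
have -> : \prod_(i < d.+1) (q * u - 1 * q ^+ i)
        = (q * u - 1) * q ^+ d * \prod_(i < d) (u - 1 * q ^+ i).
  rewrite big_ord_recl expr0 mulr1 -mulrA; congr (_ * _).
  rewrite -[X in q ^+ X]card_ord -prodr_const -big_split /=.
  by apply: eq_bigr => i _; rewrite /bump /= exprS; ring.
rewrite qpochS -exprS.
by field; rewrite qpoch_qq qP.
Qed.

Lemma wbe_mulq k m l :
  wbe q (q * k) m l * (1 - k) = wbe q k m l * (1 - k * qr m l).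
Proof.
rewrite /wbe; case: leqP => lm; rewrite ?mul0r // qr_sub //.
rewrite mulrAC [RHS]mulrAC -qpochS; congr (_ / _).
rewrite mulrC /qpoch big_ord_recl expr0 mulr1; congr (_ * _).
by apply: eq_bigr => i _; rewrite /bump /= exprS; ring.
Qed.

Lemma wbe_mulqS k m l :
  wbe q (q * k) m l.+1 * (1 - k) = wbe q k m l * (1 - qr m l).
Proof.
case: (ltngtP m l) => [ml|lm|->]; last first.
- by rewrite qrnn subrr mulr0 wbe_eq0 // mul0r.
- rewrite /wbe lm ltnW // qr_sub ?(ltnW lm) // subnS.
  have -> : (m - l = (m - l).-1.+1)%N by move: lm; lia.
  set d := _.-1 => /=; rewrite [qpoch q q d.+1]qpochS -exprS.
  have -> : qpoch k q d.+1 = qpoch (q * k) q d * (1 - k).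
    rewrite /qpoch big_ord_recl expr0 mulr1 mulrC; congr (_ * _).
    by apply: eq_bigr => i _; rewrite /bump /= exprS; ring.
  by field; rewrite qpoch_qq qP.
- by rewrite !wbe_eq0 ?mul0r // ltnW.
Qed.

Lemma wal_nn k b l : wal q k b l l = 1.
Proof. by rewrite /wal leqnn subnn big_ord0 /qpoch big_ord0 divr1. Qed.

Lemma one_sub_qr l m : (m <= l)%N -> 1 - q * qr l m != 0.
Proof. by move=> ml; rewrite qr_sub // -exprS. Qed.

(** The right-hand side no longer contains k'. Once the first part k has been summed, the remaining
    columns therefore carry a sum of the same kind, and [fusion] follows by induction on the
    columns. At most k = l and k = l - 1 contribute; for l = n only the first does, since [wal]
    vanishes at (l - 1, l). *)
Lemma fusion_col u b (l n l' k' : nat) (L : nat) : (l < L)%N ->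
  (l' == k') || (l' == k'.+1) -> 1 - u * b != 0 ->
  \sum_(0 <= k < L) whh u b l k l' k' * (wal q u 1 k n * wbe q (b * u) n k')
   = wal q (q * u) 1 l n * wbe q (b * (q * u)) n l'.
Proof.
move=> lL l'k' ub0; rewrite (sum_nat_pred2 lL); last first.
  by move=> x xl xl1; rewrite whh_eq0 ?mul0r // eq_sym.
have -> : b * (q * u) = q * (b * u) by ring.
have H3 : wbe q (q * (b * u)) n k'
        = wbe q (b * u) n k' * (1 - b * u * qr n k') / (1 - u * b).
  by rewrite -wbe_mulq [u * b]mulrC mulfK // mulrC.
have H4 : wbe q (q * (b * u)) n k'.+1
        = wbe q (b * u) n k' * (1 - qr n k') / (1 - u * b).
  by rewrite -wbe_mulqS [u * b]mulrC mulfK // mulrC.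
case: (ltngtP l n) => [ln|nl|ln]; last first.
- rewrite -ln in H3 H4 *.
  have -> : (match l with 0%N => 0 | p.+1 => whh u b l p l' k' *
      (wal q u 1 p l * wbe q (b * u) l k') end = 0 :> E).
    by case: (l) => // p; rewrite wal_eq0 // !(mul0r, mulr0).
  rewrite addr0 !wal_nn !mul1r.
  case/orP: l'k' => /eqP ->; rewrite ?whh00 ?whh01 ?H3 ?H4; last first.
    by rewrite mulrC mulrA.
  by rewrite [b * u]mulrC [LHS]mulrC [LHS]mulrA.
- case: l nl lL => // p np lL; rewrite ltnS in np.
  have Z0 := one_sub_qr np.
  have H1 : wal q u 1 p.+1 n = (u - qr p n) * wal q u 1 p n / (1 - q * qr p n).
    by rewrite -{1}[qr p n]mul1r -wal_rec mulfK.
  have H2 : wal q (q * u) 1 p.+1 n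
          = qr p n * (q * u - 1) * wal q u 1 p n / (1 - q * qr p n).
    by rewrite -wal_mulq mulfK.
  have qZ : qr p k' = qr p n * qr n k' by rewrite qrM.
  case/orP: l'k' => /eqP ->.
    by rewrite whh00 whh10 qrSl qZ H1 H2 H3 fusion_id0.
  by rewrite whh01 whh11 qrSl qZ H1 H2 H4 fusion_id1.
- rewrite !(wal_eq0 _ _ _ ln) !mul0r mulr0 add0r.
  by case: l ln {lL} => // p /ltnW pn; rewrite (wal_eq0 _ _ _ pn) mul0r mulr0.
Qed.

Lemma Hker_head0 u (b : nat -> E) N la ka :
  nth 0%N la 0%N != nth 0%N ka 0%N -> nth 0%N la 0%N != (nth 0%N ka 0%N).+1 ->
  size la = N -> size ka = N -> Hker u b N la ka = 0.
Proof.
move=> lk lk1 <-; case: la ka lk lk1 => [|l la] [|k ka] //= lk lk1 _.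
by rewrite HkerS whh_eq0 ?mul0r.
Qed.

Lemma fusion (u : E) (b : nat -> E) N B la nu :
  (forall c, 1 - u * b c != 0) ->
  size la = N -> size nu = N -> all (fun x => x < B)%N la ->
  \sum_(ka <- boxes N B) Hker u b N la ka * Gker q u b N ka nu
  = Gker q (q * u) b N la nu.
Proof.
elim: N b la nu => [|N IH] b [|l la] [|n nu] //= ub.
  by rewrite big_seq1 /Hker /Gker !big_ord0 mulr1.
case=> sla [snu] /andP[lB alB].
rewrite -/(boxes N.+1 B) big_boxesS exchange_big /=.
rewrite GkerS -(IH _ _ _ (fun c => ub c.+1)) // mulr_sumr.
apply: eq_big_seq => ka kaB.
set K := (Hker _ _ _ _ _ * _).
transitivity ((\sum_(0 <= x < B) whh u (b 0%N) l x (nth 0%N la 0%N) (nth 0%N ka 0%N)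
   * (wal q u 1 x n * wbe q (b 0%N * u) n (nth 0%N ka 0%N)))
   * (wga q (b 0%N) n (nth 0%N nu 0%N) * K)).
  rewrite mulr_suml; apply: eq_bigr => x _.
  by rewrite HkerS GkerS /K; ring.
(* Outside these two cases [K] vanishes: the horizontal label l' - k' entering the next column is
   neither 0 nor 1. *)
have [l'k'|l'k'] := boolP ((nth 0%N la 0%N == nth 0%N ka 0%N)
                        || (nth 0%N la 0%N == (nth 0%N ka 0%N).+1)).
  by rewrite fusion_col //; ring.
move: kaB; rewrite mem_boxes => /andP[/eqP ska _].
move: l'k'; rewrite negb_or => /andP[lk lk1].
by rewrite /K (Hker_head0 u _ lk lk1) ?mul0r ?mulr0 // sla.
Qed.

End Exchange.

(** * Exchange of the kernels at powers of q *)

(* The R-matrix R(e, f) has the entries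
     R(0, 0) = 1 - u b X,      R(0, 1) = 1 - q X,
     R(1, 0) = - u (k - b X),  R(1, 1) = q X - k u,
   where X = q^{nu_c - mu_c}, and X' is its value in the next column; e and f
   are the horizontal labels of [Hker] on the two sides. The sums t0, t1 and
   l0, l1 over the columns further right are related by R in [H0] and [H1],
   and the identities below carry this relation one column to the left. *)
Section ZipperIdentities.
Variable F : fieldType.
Variables (u b b' q k X P X' a0 a1 B0 B1 : F).
Hypothesis Ha : a1 * (1 - q * X) = (k - b * X) * a0.
Hypothesis HB : B0 * (1 - q * P) = B1 * (1 - k * P).

Variables (d' l0 l1 t0 t1 : F).
Hypothesis H0 : d' * l0 = (1 - u * b' * X') * t0 + (1 - q * X') * t1.
Hypothesis H1 : d' * l1 = - (u * (k - b' * X')) * t0 + (q * X' - k * u) * t1.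

(** Here P = q^(m - n' - 1), so that X' (q P) = q^(m - m') and X (q P) = q^(n - n'); [Ha] and [HB]
    are the recursions of [wal] and [wbe]. Up to a common factor, [M0] and [M1] are the right-hand
    sides with first part m and m - 1. *)
Let M0 := a0 * B0 * ((1 - u * b' * (X' * (q * P))) * t0
                     + (1 - q * (X' * (q * P))) * t1).
Let M1 := a1 * B1 * (- (u * (1 - b' * (X' * P))) * t0
                     - (u - X' * (q * P)) * t1).

Lemma zipper_id0 :
  d' * (a0 * B0 * (1 - u * b * (X * (q * P))) * l0
        + a0 * B1 * (1 - b * (X * P)) * l1)
  = (1 - u * b * X) * M0 + (1 - q * X) * M1.
Proof.
transitivity (a0 * B0 * (1 - u * b * (X * (q * P))) * (d' * l0)
        + a0 * B1 * (1 - b * (X * P)) * (d' * l1)); first by ring.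
rewrite H0 H1 /M0 /M1; apply/eqP; rewrite -subr_eq0; apply/eqP.
(* What remains after eliminating [l0] and [l1] lies in the ideal generated by the relations [Ha]
   and [HB]; these are explicit cofactors. *)
transitivity ((u * B1 * (1 - b' * (X' * P)) * t0 + B1 * (u - X' * (q * P)) * t1)
              * (a1 * (1 - q * X) - (k - b * X) * a0)
     + a0 * (u * (b * X - b' * X') * t0 + (u * b * X - q * X') * t1)
       * (B0 * (1 - q * P) - B1 * (1 - k * P))); first by ring.
by rewrite Ha HB !subrr !mulr0 addr0.
Qed.

Lemma zipper_id1 :
  d' * (- (u * (1 - q * (X * (q * P)))) * (a1 * B0) * l0
        - (u - X * (q * P)) * (a1 * B1) * l1)
  = - (u * (k - b * X)) * M0 + (q * X - k * u) * M1.
Proof.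
transitivity (- (u * (1 - q * (X * (q * P)))) * (a1 * B0) * (d' * l0)
        - (u - X * (q * P)) * (a1 * B1) * (d' * l1)); first by ring.
rewrite H0 H1 /M0 /M1; apply/eqP; rewrite -subr_eq0; apply/eqP.
transitivity ((- (u * B0 * (1 - u * b' * (X' * (q * P)))) * t0
               - u * B0 * (1 - q * (X' * (q * P))) * t1)
              * (a1 * (1 - q * X) - (k - b * X) * a0)
     + a1 * (- (u * (q * X - u * b' * X')) * t0 + u * q * (X' - X) * t1)
       * (B0 * (1 - q * P) - B1 * (1 - k * P))); first by ring.
by rewrite Ha HB !subrr !mulr0 addr0.
Qed.

End ZipperIdentities.

(** * The R-matrix relation, column by column *)

Section Zipper.
Variables (E : fieldType) (q : E).
Hypothesis q0 : q != 0.
Hypothesis qP : forall n, 1 - q ^+ n.+1 != 0.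
Variables (k u : E) (B : nat).
Implicit Types (b : nat -> E) (l m n : nat) (la mu nu : seq nat).
Local Notation qr := (qr q).

Definition qgen b := forall c i, 1 - b c * q ^+ i != 0.

Lemma qgenS b : qgen b -> qgen (fun c => b c.+1).
Proof. by move=> H c i; apply: H. Qed.

Lemma qpoch_gen (b : E) n : (forall i, 1 - b * q ^+ i != 0) -> qpoch b q n != 0.
Proof. by move=> H; apply/prodf_neq0. Qed.

Definition Fcol (b : E) l m l' := wga q b l l' * wal q k b l m * wbe q k m l'.

Section Column.
Variables (b b' : E) (m n m' n' : nat).
Hypothesis bP : forall i, 1 - b * q ^+ i != 0.
Hypothesis n'n : (n' <= n)%N.
Let a0 := wal q k b n m.
Let a1 := wal q k b n.+1 m.
Let B0 := wbe q k m n'.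
Let B1 := wbe q k m n'.+1.
Let g := wga q b n n'.
Let D := 1 - u * b.
Let D' := 1 - u * b'.

Lemma wga_SS l l' : wga q b l.+1 l'.+1 = wga q b l l'.
Proof. by rewrite /wga subSS. Qed.

Lemma wga_rec l l' : (l' <= l)%N ->
  wga q b l.+1 l' * (1 - b * qr l l') = wga q b l l' * (1 - q * qr l l').
Proof.
move=> ll; rewrite /wga subSn // qr_sub // !qpochS -exprS.
have H := bP (l - l'); have H' := qpoch_gen (l - l') bP.
by field; rewrite H H'.
Qed.

(** In the names [colLxy] the digits are l - n and l' - n'; in [colMxy] they are m - y and m' - y'.
    All eight products are brought to the common factor g / D or g / D', with [wal] and [wbe]
    entering only through [a0], [a1], [B0], [B1]. *)
Lemma colL00 : Fcol b n m n' * whh q u b n n n' n'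
  = g / D * (a0 * B0 * (1 - u * b * qr n n')).
Proof. by rewrite /Fcol whh00 -/D -/g -/a0 -/B0; ring. Qed.

Lemma colL01 : Fcol b n m n'.+1 * whh q u b n n n'.+1 n'
  = g / D * (a0 * B1 * (1 - b * (qr n n' / q))).
Proof.
rewrite /Fcol whh01 -/D -/a0 -/B1.
case: (ltngtP n' n) n'n => // [lt|eq] _; last first.
  (* For n' = n the difference inside [wga] is truncated, but the term is zero anyway: a0 needs m <=
     n and B1 needs n' < m. *)
  have -> : a0 * B1 = 0.
    rewrite /a0 /B1; case: (ltnP n m) => [nm|mn]; first by rewrite wal_eq0 // mul0r.
    by rewrite wbe_eq0 ?mulr0 // eq ltnS.
  by rewrite eq qrnn // subrr !mul0r !mulr0.
have [p np] : exists p, n = p.+1 by exists n.-1; rewrite prednK //; move: lt; lia.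
have lt' : (n' <= p)%N by rewrite -ltnS -np.
have H := wga_rec lt'; rewrite -np -/g in H.
have -> : wga q b n n'.+1 = wga q b p n' by rewrite np wga_SS.
have -> : qr n n' / q = qr p n' by rewrite np qrSl mulrC mulKf.
have -> : qr n n' = q * qr p n' by rewrite np qrSl.
transitivity (wga q b p n' * (1 - q * qr p n') / D * (a0 * B1)); first by ring.
by rewrite -H; ring.
Qed.

Lemma colL10 : Fcol b n.+1 m n' * whh q u b n.+1 n n' n'
  = g / D * (- (u * (1 - q * qr n n')) * (a1 * B0)).
Proof.
rewrite /Fcol whh10 -/D -/a1 -/B0.
transitivity (- (u * (wga q b n.+1 n' * (1 - b * qr n n'))) / D * (a1 * B0)).
  by ring.
by rewrite wga_rec // -/g; ring.
Qed.

Lemma colL11 : Fcol b n.+1 m n'.+1 * whh q u b n.+1 n n'.+1 n'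
  = g / D * (- (u - qr n n') * (a1 * B1)).
Proof. by rewrite /Fcol whh11 wga_SS -/D -/a1 -/B1 -/g; ring. Qed.

Lemma colM00 : Fcol b n m n' * whh q u b' m m m' m'
  = g / D' * (a0 * B0 * (1 - u * b' * qr m m')).
Proof. by rewrite /Fcol whh00 -/D' -/g -/a0 -/B0; ring. Qed.

Lemma colM01 p' : m' = p'.+1 -> Fcol b n m n' * whh q u b' m m m' p'
  = g / D' * (a0 * B0 * (1 - q * qr m m')).
Proof.
move=> ->; rewrite /Fcol whh01 qrSr [q * _]mulrC mulfVK //.
by rewrite -/D' -/g -/a0 -/B0; ring.
Qed.

Lemma colM10 p : m = p.+1 -> Fcol b n p n' * whh q u b' m p m' m'
  = g / D' * (a1 * B1 * - (u * (1 - b' * (qr m m' / q)))).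
Proof.
move=> e; rewrite /Fcol /a1 /B1 e whh10 wal_shift wbe_shift qrSl.
rewrite [q * _]mulrC mulfK //.
by rewrite -/D' -/g; ring.
Qed.

Lemma colM11 p p' : m = p.+1 -> m' = p'.+1 ->
  Fcol b n p n' * whh q u b' m p m' p'
  = g / D' * (a1 * B1 * - (u - qr m m')).
Proof.
move=> e e'; rewrite /Fcol /a1 /B1 e e' whh11 wal_shift wbe_shift.
rewrite qrSl qrSr [q * _]mulrC mulfVK //.
by rewrite -/D' -/g; ring.
Qed.

End Column.

(* The two sides of the exchange relation restricted to the columns from some
   index on, with a fixed first part: l on the left, y on the right. *)
Definition zipL b N m mu n nu l := \sum_(la <- boxes N B)
  Fker q k b N.+1 (l :: la) (m :: mu) * Hker q u b N.+1 (l :: la) (n :: nu).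
Definition zipR b N m mu n nu y := \sum_(rho <- boxes N B)
  Fker q k b N.+1 (n :: nu) (y :: rho)
  * Hker q u (fun c => b c.+1) N.+1 (m :: mu) (y :: rho).
Definition zipR_pred b N m mu n nu := if m is p.+1 then zipR b N m mu n nu p else 0.

Lemma zipL0 b m n l : zipL b 0 m [::] n [::] l =
  Fcol (b 0%N) l m 0 * whh q u (b 0%N) l n 0 0.
Proof.
by rewrite /zipL big_boxes0 FkerS HkerS /Fker /Hker !big_ord0 /= !mulr1.
Qed.

Lemma zipR0 b m n y : zipR b 0 m [::] n [::] y =
  Fcol (b 0%N) n y 0 * whh q u (b 1%N) m y 0 0.
Proof.
by rewrite /zipR big_boxes0 FkerS HkerS /Fker /Hker !big_ord0 /= !mulr1.
Qed.

Lemma zipLS b N m m' mu n n' nu l : (n'.+1 < B)%N ->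
  zipL b N.+1 m (m' :: mu) n (n' :: nu) l =
    Fcol (b 0%N) l m n' * whh q u (b 0%N) l n n' n'
      * zipL (fun c => b c.+1) N m' mu n' nu n'
  + Fcol (b 0%N) l m n'.+1 * whh q u (b 0%N) l n n'.+1 n'
      * zipL (fun c => b c.+1) N m' mu n' nu n'.+1.
Proof.
move=> n'B; rewrite /zipL big_boxesS.
rewrite -(sum_nat_succ2 (F := fun l' => Fcol (b 0%N) l m l' * whh q u (b 0%N) l n l' n'
   * zipL (fun c => b c.+1) N m' mu n' nu l') n'B); last first.
  by move=> x xn xn1; rewrite whh_eq0' // mulr0 mul0r.
apply: eq_bigr => l' _; rewrite mulr_sumr; apply: eq_bigr => la _.
by rewrite FkerS HkerS /Fcol /=; ring.
Qed.

Lemma zipRS b N m m' mu n n' nu y : (m' < B)%N ->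
  zipR b N.+1 m (m' :: mu) n (n' :: nu) y =
    Fcol (b 0%N) n y n' * whh q u (b 1%N) m y m' m'
      * zipR (fun c => b c.+1) N m' mu n' nu m'
  + (if m' is p.+1 then
       Fcol (b 0%N) n y n' * whh q u (b 1%N) m y m' p
       * zipR (fun c => b c.+1) N m' mu n' nu p
     else 0).
Proof.
move=> m'B; rewrite /zipR big_boxesS.
rewrite -(sum_nat_pred2 (F := fun y' => Fcol (b 0%N) n y n' * whh q u (b 1%N) m y m' y'
   * zipR (fun c => b c.+1) N m' mu n' nu y') m'B); last first.
  move=> x xn xn1; rewrite whh_eq0' 1?eq_sym // ?mulr0 ?mul0r //.
apply: eq_bigr => l' _; rewrite mulr_sumr; apply: eq_bigr => la _.
by rewrite FkerS HkerS /Fcol /=; ring.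
Qed.

Lemma pred_term m' (A : nat -> E) (C t1 : E) :
  (m' = 0%N -> t1 = 0) -> (forall p, m' = p.+1 -> A p = C) ->
  (if m' is p.+1 then A p * t1 else 0) = C * t1.
Proof. by case: m' => [->|p _ ->] //; rewrite mulr0. Qed.

(** The sums over the further columns enter as arbitrary numbers satisfying the R-matrix relation.
    In this form the step also serves at the last column, with the values of an imaginary column of
    zeros behind it. *)
Lemma zipper_step (b b' : E) m n m' n' (l0 l1 t0 t1 : E) :
  (forall i, 1 - b * q ^+ i != 0) -> 1 - u * b != 0 -> 1 - u * b' != 0 ->
  (n' <= n)%N ->
  (1 - u * b') * l0
    = (1 - u * b' * qr n' m') * t0 + (1 - q * qr n' m') * t1 ->
  (1 - u * b') * l1
    = - (u * (k - b' * qr n' m')) * t0 + (q * qr n' m' - k * u) * t1 ->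
  (m' = 0%N -> t1 = 0) ->
  let lhs l := Fcol b l m n' * whh q u b l n n' n' * l0
             + Fcol b l m n'.+1 * whh q u b l n n'.+1 n' * l1 in
  let rhs y := Fcol b n y n' * whh q u b' m y m' m' * t0
    + (if m' is p.+1 then Fcol b n y n' * whh q u b' m y m' p * t1 else 0) in
  let t := if m is p.+1 then rhs p else 0 in
  (1 - u * b) * lhs n
    = (1 - u * b * qr n m) * rhs m + (1 - q * qr n m) * t /\
  (1 - u * b) * lhs n.+1
    = - (u * (k - b * qr n m)) * rhs m + (q * qr n m - k * u) * t.
Proof.
move=> bP ub0 ub'0 n'n H0 H1 t10 lhs rhs t.
have Ha := wal_rec q0 qP k b n m.
have HB := wbe_rec q0 qP k m n'.
set a0 := wal q k b n m in Ha; set a1 := wal q k b n.+1 m in Ha.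
set B0 := wbe q k m n' in HB; set B1 := wbe q k m n'.+1 in HB.
set X := qr n m in Ha *; set X' := qr n' m' in H0 H1.
pose P := qr m n' / q.
have qP' : qr m n' = q * P by rewrite /P mulrC divfK.
rewrite qP' in HB; rewrite -mulrA [q * P / q]mulrAC divff // mul1r in HB.
have nn' : qr n n' = X * (q * P) by rewrite -qP' /X qrM.
have mm' : qr m m' = X' * (q * P) by rewrite -qP' mulrC /X' qrM.
clearbody P.
have ZZ0 := zipper_id0 Ha HB H0 H1.
have ZZ1 := zipper_id1 Ha HB H0 H1.
have rhsE : (1 - u * b') * rhs m = wga q b n n' * (a0 * B0
   * ((1 - u * b' * (X' * (q * P))) * t0 + (1 - q * (X' * (q * P))) * t1)).
  rewrite -mm' /rhs colM00 // (pred_term t10 (colM01 b b' m n n')) -/a0 -/B0.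
  by field.
have tE : (1 - u * b') * t = wga q b n n' * (a1 * B1
   * (- (u * (1 - b' * (X' * P))) * t0 - (u - X' * (q * P)) * t1)).
  have e : X' * P = qr m m' / q by rewrite mm' [q * P]mulrC mulrA mulfK.
  rewrite e -mm'.
  have [m0|[p em]] : m = 0%N \/ exists p, m = p.+1.
  - by case: (m) => [|p]; [left | right; exists p].
  - have -> : t = 0 by rewrite /t m0.
    by rewrite /B1 m0 wbe_eq0 // !(mulr0, mul0r).
  have -> : t = rhs p by rewrite /t em.
  rewrite /rhs (colM10 _ _ _ _ _ em) // -/a1 -/B1.
  rewrite (pred_term t10 (fun p' => @colM11 b b' m n m' n' p p' em)) -/a1 -/B1.
  by field; rewrite q0.
split; apply: (mulfI ub'0).
  transitivity ((1 - u * b) * (1 - u * b') * lhs n); first by ring.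
  rewrite /lhs colL00 // colL01 // -/a0 -/B0 -/B1.
  have -> : qr n n' / q = X * P by rewrite nn' [q * P]mulrC mulrA mulfK.
  rewrite nn'.
  transitivity (wga q b n n' * ((1 - u * b') *
     (a0 * B0 * (1 - u * b * (X * (q * P))) * l0 + a0 * B1 * (1 - b * (X * P)) * l1))).
    by field.
  rewrite ZZ0.
  transitivity ((1 - u * b * X) * ((1 - u * b') * rhs m)
                + (1 - q * X) * ((1 - u * b') * t)); last by ring.
  by rewrite rhsE tE; ring.
transitivity ((1 - u * b) * (1 - u * b') * lhs n.+1); first by ring.
rewrite /lhs colL10 // colL11 // -/a1 -/B0 -/B1 nn'.
transitivity (wga q b n n' * ((1 - u * b') *
   (- (u * (1 - q * (X * (q * P)))) * (a1 * B0) * l0 - (u - X * (q * P)) * (a1 * B1) * l1))).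
  by field.
rewrite ZZ1.
transitivity (- (u * (k - b * X)) * ((1 - u * b') * rhs m) + (q * X - k * u) * ((1 - u * b') * t)).
  by rewrite rhsE tE; ring.
by ring.
Qed.


Lemma zipper b N m mu n nu :
  qgen b -> (forall c, 1 - u * b c != 0) ->
  size mu = N -> size nu = N -> nth 0%N (m :: mu) N = 0%N ->
  sorted geq (n :: nu) -> all (fun x => x.+1 < B)%N nu ->
  all (fun x => x < B)%N mu ->
  (1 - u * b 0%N) * zipL b N m mu n nu n
    = (1 - u * b 0%N * qr n m) * zipR b N m mu n nu m
      + (1 - q * qr n m) * zipR_pred b N m mu n nu /\
  (1 - u * b 0%N) * zipL b N m mu n nu n.+1
    = - (u * (k - b 0%N * qr n m)) * zipR b N m mu n nu m
      + (q * qr n m - k * u) * zipR_pred b N m mu n nu.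
Proof.
elim: N b m mu n nu => [|N IH] b m [|m' mu] n [|n' nu] // bP ub.
  move=> _ _ /= -> _ _ _.
  have D1 := ub 1%N.
  (* Beyond the last column all labels are 0, whence l0 = t0 = 1 and t1 = 0; [l1] is solved from the
     second relation, and its contribution disappears because [wbe] vanishes at (0, 1). *)
  set l1 := - (u * (k - b 1%N)) / (1 - u * b 1%N).
  have h0 : (1 - u * b 1%N) * 1
          = (1 - u * b 1%N * qr 0 0) * 1 + (1 - q * qr 0 0) * 0.
    by rewrite qrnn //; ring.
  have h1 : (1 - u * b 1%N) * l1
          = - (u * (k - b 1%N * qr 0 0)) * 1 + (q * qr 0 0 - k * u) * 0.
    by rewrite qrnn // /l1; field.
  have [] := @zipper_step (b 0%N) (b 1%N) 0 n 0 0 _ _ _ _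
    (bP 0%N) (ub 0%N) D1 (leq0n n) h0 h1 (fun _ => erefl).
  have w0 x : Fcol (b 0%N) x 0 1 = 0 by rewrite /Fcol (wbe_eq0 _ _ (ltn0Sn 0)) mulr0.
  by rewrite /= !w0 !zipL0 !zipR0 !mul0r !mulr1 !addr0.
move=> [smu] [snu] lastmu /= /andP[n'n srt] /andP[n'B nuB] /andP[m'B muB].
have [H0 H1] := IH _ m' mu n' nu (qgenS bP) (fun c => ub c.+1) smu snu lastmu
  srt nuB muB.
set b1 := (fun c => b c.+1) in H0 H1.
have t10 : m' = 0%N -> zipR_pred b1 N m' mu n' nu = 0 by move=> ->.
have [] := zipper_step m (bP 0%N) (ub 0%N) (ub 1%N) n'n H0 H1 t10.
rewrite !zipLS // /zipR_pred -/b1 => -> ->.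
have tmE y : zipR b N.+1 m (m' :: mu) n (n' :: nu) y =
    Fcol (b 0%N) n y n' * whh q u (b 1%N) m y m' m' * zipR b1 N m' mu n' nu m'
  + (if m' is p.+1 then Fcol (b 0%N) n y n' * whh q u (b 1%N) m y m' p
                        * zipR_pred b1 N m' mu n' nu else 0).
  by rewrite zipRS //; congr (_ + _); case: (m').
by case: m lastmu tmE => [|p] _ tmE; rewrite !tmE.
Qed.

End Zipper.

(** * Interlacing and the supports of the kernels *)

Definition interlaced N (la mu : seq nat) := [forall c : 'I_N,
  (nth 0%N mu c <= nth 0%N la c)%N && (nth 0%N la c.+1 <= nth 0%N mu c)%N].

Lemma interlacedP N la mu : reflect (forall c, (c < N)%N ->
  (nth 0%N mu c <= nth 0%N la c)%N /\ (nth 0%N la c.+1 <= nth 0%N mu c)%N)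
  (interlaced N la mu).
Proof.
apply: (iffP forallP) => [H c cN|H c]; last by apply/andP/H.
by have /andP := H (Ordinal cN).
Qed.

Lemma interlaced_sortedl la mu : interlaced (size la) la mu -> sorted geq la.
Proof.
move/interlacedP => H; apply/(sortedP 0%N) => i iN.
by have [h1 h2] := H i (ltnW iN); apply: leq_trans h2 h1.
Qed.

Lemma interlaced_sortedr la mu : interlaced (size mu) la mu -> sorted geq mu.
Proof.
move/interlacedP => H; apply/(sortedP 0%N) => i iN.
by have [_ h2] := H i (ltnW iN); have [h1 _] := H _ iN; apply: leq_trans h1 h2.
Qed.

Lemma sorted_le_head la : sorted geq la -> all (fun x => x <= nth 0%N la 0%N)%N la.
Proof.
case: la => //= l la H; rewrite leqnn /=.
by apply: order_path_min H => x y z /= h1 h2; apply: leq_trans h1.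
Qed.

Lemma all_ltP B (la : seq nat) :
  reflect (forall c, (c < size la)%N -> (nth 0%N la c < B)%N)
          (all (fun x => x < B)%N la).
Proof. exact: all_nthP. Qed.

Section KernelSupport.
Variables (R : comUnitRingType) (q : R).

(** This vanishing lets all sums run over boxes of arbitrary sequences instead of partitions, so
    that the first part can be summed independently of the others. *)
Lemma Fker_eq0 k (b : nat -> R) N la mu : ~~ interlaced N la mu -> Fker q k b N la mu = 0.
Proof.
rewrite negb_forall => /existsP[c]; rewrite negb_and -!ltnNge => H.
rewrite /Fker (bigD1 c) //=; case/orP: H => H.
  by rewrite wal_eq0 // !(mulr0, mul0r).
by rewrite wbe_eq0 // !(mulr0, mul0r).
Qed.

Lemma Gker_eq0 x (b : nat -> R) N la nu : ~~ interlaced N la nu -> Gker q x b N la nu = 0.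
Proof.
rewrite negb_forall => /existsP[c]; rewrite negb_and -!ltnNge => H.
rewrite /Gker (bigD1 c) //=; case/orP: H => H.
  by rewrite wal_eq0 // !(mulr0, mul0r).
by rewrite wbe_eq0 // !(mulr0, mul0r).
Qed.

(** The factor of index j in the product is q^j - q^j. This is the source of all finiteness after
    the substitution chi = q^j. *)
Lemma wal_qpow j l m : (m + j < l)%N -> wal q (q ^+ j) 1 l m = 0.
Proof.
move=> H; rewrite /wal (ltnW (leq_ltn_trans (leq_addr j m) H)).
have jl : (j < l - m)%N by rewrite ltn_subRL.
by rewrite (bigD1 (Ordinal jl)) //= mul1r subrr !mul0r.
Qed.

Lemma Gker_qpow j (b : nat -> R) N la nu : (0 < N)%N ->
  (nth 0%N nu 0%N + j < nth 0%N la 0%N)%N -> Gker q (q ^+ j) b N la nu = 0.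
Proof.
move=> N0 H; rewrite /Gker (bigD1 (Ordinal N0)) //= wal_qpow //.
by rewrite !(mulr0, mul0r).
Qed.

End KernelSupport.

(** * Exchanging one F kernel with one F* kernel *)

Section ExchangeFG.
Variables (E : fieldType) (q : E).
Hypothesis q0 : q != 0.
Hypothesis qP : forall n, 1 - q ^+ n.+1 != 0.
Implicit Types (b : nat -> E) (la mu nu : seq nat).

Lemma Hker_supp u b N la ka c : Hker q u b N la ka != 0 -> (c < N)%N ->
  (nth 0%N ka c <= nth 0%N la c)%N.
Proof.
move=> H cN; apply: contraR H; rewrite -ltnNge => lt.
rewrite /Hker (bigD1 (Ordinal cN)) //= whh_eq0 ?mul0r //.
  by rewrite ltn_eqF.
by rewrite ltn_eqF // ltnW.
Qed.

(** The left-hand side adds the two rows of the zipper relation, and (1, 1) is a left eigenvector of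
    the R-matrix: (1 - u b X) - u (k - b X) = (1 - q X) + (q X - k u) = 1 - k u. The bound on nu
    leaves room in the box for the first part nu_1 + 1, which the label 1 creates. *)
Lemma exchange_H k u b N B mu nu :
  qgen q b -> (forall c, 1 - u * b c != 0) ->
  size mu = N.+1 -> size nu = N.+1 -> nth 0%N mu N = 0%N ->
  sorted geq nu -> (nth 0%N nu 0%N + 1 < B)%N -> all (fun x => x < B)%N mu ->
  \sum_(la <- boxes N.+1 B) Fker q k b N.+1 la mu * Hker q u b N.+1 la nu
  = (1 - k * u) / (1 - u * b 0%N)
    * \sum_(rho <- boxes N.+1 B) Fker q k b N.+1 nu rho
                             * Hker q u (fun c => b c.+1) N.+1 mu rho.
Proof.
case: mu => // m mu; case: nu => // n nu bP ub [smu] [snu] last0 srt.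
rewrite [nth _ _ _]/= addn1 => nB /= /andP[mB muB].
have nuB : all (fun x => x.+1 < B)%N nu.
  have /= /andP[_ /allP H] := sorted_le_head srt.
  by apply/allP => x /H xn; apply: leq_ltn_trans nB.
have [H0 H1] := zipper q0 qP k bP ub smu snu last0 srt nuB muB.
rewrite -/(boxes N.+1 B) !big_boxesS.
rewrite (sum_nat_succ2 nB); last first.
  move=> x xn xn1; apply: big1 => la _.
  by rewrite HkerS whh_eq0 // mul0r mulr0.
rewrite -!/(zipL _ _ _ _ _ _ _ _ _ _ _) (sum_nat_pred2 mB); last first.
  move=> x xn xn1; apply: big1 => la _.
  by rewrite HkerS whh_eq0 1?eq_sym // mul0r mulr0.
rewrite -!/(zipR _ _ _ _ _ _ _ _ _ _ _).
apply: (mulfI (ub 0%N)).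
transitivity ((1 - k * u) * (zipR q k u B b N m mu n nu m + zipR_pred q k u B b N m mu n nu)).
  by rewrite mulrDr H0 H1; ring.
rewrite mulrA [(1 - _ * b _) * _]mulrC divfK //; congr (_ * (_ + _)).
Qed.

(** This is the value x = q^0 at which the induction on j starts: the first factor of [wal] is 1 -
    1, so no part can grow. *)
Lemma Gker1 b N la nu : (forall c i, 1 - b c * q ^+ i != 0) ->
  size la = N -> size nu = N -> sorted geq nu ->
  Gker q 1 b N la nu = (la == nu)%:R.
Proof.
move=> bP sla snu srt; case: eqP => [->|/eqP ne].
  rewrite /Gker big1 // => c _; rewrite wal_nn mulr1 mulr1 /wbe /wga.
  have -> : (nth 0%N nu c.+1 <= nth 0%N nu c)%N.
    case: (ltnP c.+1 (size nu)) => cN; last by rewrite [nth _ _ c.+1]nth_default.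
    by have /(sortedP 0%N) := srt; apply.
  have H1 := qpoch_qq qP (nth 0%N nu c - nth 0%N nu c.+1).
  have H2 := qpoch_gen (nth 0%N nu c - nth 0%N nu c.+1) (bP c).
  by field; rewrite H1 H2.
have /allPn[c] : ~~ all (fun c => nth 0%N la c == nth 0%N nu c)%N (iota 0 N).
  apply: contraNN ne => /allP H; apply/eqP/(@eq_from_nth _ 0%N).
    by rewrite sla snu.
  by move=> i iN; apply/eqP/H; rewrite mem_iota -sla.
rewrite mem_iota /= => cN lc.
rewrite /Gker (bigD1 (Ordinal cN)) //=.
suff -> : wal q 1 1 (nth 0%N la c) (nth 0%N nu c) = 0 by rewrite !(mulr0, mul0r).
case: (ltngtP (nth 0%N la c) (nth 0%N nu c)) lc => // lt _; first by rewrite wal_eq0.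
by rewrite -(addn0 (nth _ nu c)) in lt; have := wal_qpow q lt; rewrite expr0.
Qed.

Lemma exchange_G k j b N B mu nu :
  qgen q b -> size mu = N.+1 -> size nu = N.+1 -> nth 0%N mu N = 0%N ->
  sorted geq nu -> (nth 0%N nu 0%N + j < B)%N -> all (fun x => x < B)%N mu ->
  \sum_(la <- boxes N.+1 B) Fker q k b N.+1 la mu * Gker q (q ^+ j) b N.+1 la nu
  = qpoch k q j / qpoch (b 0%N) q j
    * \sum_(rho <- boxes N.+1 B) Fker q k b N.+1 nu rho
               * Gker q (q ^+ j) (fun c => b c.+1) N.+1 mu rho.
Proof.
move=> bP; elim: j mu => [|j IH] mu smu snu last0 srt nB muB.
  rewrite addn0 in nB; have nuB : all (fun x => x < B)%N nu.
    apply/allP => x /(allP (sorted_le_head srt)) xn; exact: leq_ltn_trans nB.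
  rewrite expr0 /qpoch !big_ord0 divr1 mul1r.
  have nu_in : nu \in boxes N.+1 B by rewrite mem_boxes snu eqxx.
  have mu_in : mu \in boxes N.+1 B by rewrite mem_boxes smu eqxx.
  transitivity (Fker q k b N.+1 nu mu).
    rewrite (bigD1_seq nu) ?boxes_uniq //= Gker1 // eqxx mulr1 big1_seq ?addr0 //.
    move=> la /andP[ne]; rewrite mem_boxes => /andP[/eqP sla _].
    by rewrite Gker1 // (negbTE ne) mulr0.
  rewrite (bigD1_seq mu) ?boxes_uniq //= big1_seq ?addr0.
    case: (boolP (interlaced N.+1 nu mu)) => [il|nil]; last by rewrite Fker_eq0 // mul0r.
    rewrite Gker1 ?eqxx ?mulr1 //.
    by rewrite -smu in il; apply: interlaced_sortedr il.
  move=> rho /andP[ne]; rewrite mem_boxes => /andP[/eqP srho _].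
  case: (boolP (interlaced N.+1 nu rho)) => [il|nil]; last by rewrite Fker_eq0 // mul0r.
  rewrite Gker1 // 1?eq_sym ?(negbTE ne) ?mulr0 //.
  by rewrite -srho in il; apply: interlaced_sortedr il.
have ub c : 1 - q ^+ j * b c != 0 by rewrite mulrC bP.
have ub' c : 1 - q ^+ j * b c.+1 != 0 by exact: ub.
have nBj : (nth 0%N nu 0%N + j < B)%N by apply: leq_ltn_trans nB; rewrite leq_add2l.
transitivity (\sum_(la <- boxes N.+1 B) \sum_(ka <- boxes N.+1 B)
   Fker q k b N.+1 la mu * Hker q (q ^+ j) b N.+1 la ka * Gker q (q ^+ j) b N.+1 ka nu).
  apply: eq_big_seq => la; rewrite mem_boxes => /andP[/eqP sla laB].
  rewrite exprS -(fusion q0 qP ub sla snu laB) mulr_sumr.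
  by apply: eq_bigr => ka _; rewrite mulrA.
rewrite exchange_big /=.
transitivity (\sum_(ka <- boxes N.+1 B) (1 - k * q ^+ j) / (1 - q ^+ j * b 0%N)
   * (\sum_(rho <- boxes N.+1 B) Fker q k b N.+1 ka rho
        * Hker q (q ^+ j) (fun c => b c.+1) N.+1 mu rho) * Gker q (q ^+ j) b N.+1 ka nu).
  apply: eq_big_seq => ka; rewrite mem_boxes => /andP[/eqP ska kaB].
  rewrite -mulr_suml; case: (boolP (interlaced N.+1 ka nu)) => [il|nil]; last first.
    by rewrite Gker_eq0 // !mulr0.
  (* The first part of ka exceeds that of nu by at most j, and [Hker] adds at most 1; hence one box
     with nu_1 + j + 1 < B serves the whole step. *)
  case: (leqP (nth 0%N ka 0%N) (nth 0%N nu 0%N + j)) => kn; last first.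
    by rewrite Gker_qpow // !mulr0.
  congr (_ * _); apply: exchange_H => //.
    by rewrite -ska in il; apply: interlaced_sortedl il.
  by rewrite addn1; apply: leq_ltn_trans nB; rewrite addnS ltnS.
transitivity ((1 - k * q ^+ j) / (1 - q ^+ j * b 0%N) * \sum_(rho <- boxes N.+1 B)
   (Hker q (q ^+ j) (fun c => b c.+1) N.+1 mu rho * (\sum_(ka <- boxes N.+1 B)
      Fker q k b N.+1 ka rho * Gker q (q ^+ j) b N.+1 ka nu))).
  rewrite mulr_sumr.
  under eq_bigr => ka _ do rewrite mulr_sumr mulr_suml.
  rewrite exchange_big /=; apply: eq_bigr => rho _; rewrite !mulr_sumr.
  by apply: eq_bigr => ka _; ring.
rewrite !qpochS invfM.
have -> : qpoch k q j * (1 - k * q ^+ j) * ((qpoch (b 0%N) q j)^-1 * (1 - b 0%N * q ^+ j)^-1)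
  = (1 - k * q ^+ j) / (1 - q ^+ j * b 0%N) * (qpoch k q j / qpoch (b 0%N) q j).
  by rewrite [q ^+ j * _]mulrC; ring.
rewrite -[RHS]mulrA; congr (_ * _); rewrite mulr_sumr.
transitivity (\sum_(rho <- boxes N.+1 B) Hker q (q ^+ j) (fun c => b c.+1) N.+1 mu rho
   * (qpoch k q j / qpoch (b 0%N) q j * \sum_(s <- boxes N.+1 B)
       Fker q k b N.+1 nu s * Gker q (q ^+ j) (fun c => b c.+1) N.+1 rho s)).
  apply: eq_big_seq => rho; rewrite mem_boxes => /andP[/eqP srho rhoB].
  have [->|H0] := eqVneq (Hker q (q ^+ j) (fun c => b c.+1) N.+1 mu rho) 0.
    by rewrite !mul0r.
  congr (_ * _); apply: IH => //.
  by have := Hker_supp H0 (ltnSn N); rewrite last0 leqn0 => /eqP.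
transitivity (\sum_(s <- boxes N.+1 B) qpoch k q j / qpoch (b 0%N) q j * (Fker q k b N.+1 nu s
   * \sum_(rho <- boxes N.+1 B) Hker q (q ^+ j) (fun c => b c.+1) N.+1 mu rho
       * Gker q (q ^+ j) (fun c => b c.+1) N.+1 rho s)).
  under eq_bigr => ka _ do rewrite !mulr_sumr.
  rewrite exchange_big /=; apply: eq_bigr => rho _; rewrite !mulr_sumr.
  by apply: eq_bigr => ka _; ring.
apply: eq_big_seq => s; rewrite mem_boxes => /andP[/eqP ss _].
by rewrite (fusion q0 qP ub' smu ss muB) -exprS.
Qed.
End ExchangeFG.

(** * Multivariate kernels *)

Section Chain.
Variable R : pzRingType.
Variables (P : Type) (K : P -> nat -> seq nat -> seq nat -> R).

Fixpoint chain N B (ps : seq P) (la mu : seq nat) : R :=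
  if ps is p :: ps' then
    \sum_(rho <- boxes N B) K p N la rho * chain N B ps' rho mu
  else (la == mu)%:R.

Lemma chainS N B p ps la mu : chain N B (p :: ps) la mu =
  \sum_(rho <- boxes N B) K p N la rho * chain N B ps rho mu.
Proof. by []. Qed.

Lemma chain_neq0 N B p ps la mu : chain N B (p :: ps) la mu != 0 ->
  exists rho, [/\ rho \in boxes N B, K p N la rho != 0 & chain N B ps rho mu != 0].
Proof.
have [|H] := boolP (has (fun rho => (K p N la rho != 0)
    && (chain N B ps rho mu != 0)) (boxes N B)).
  by case/hasP=> rho rhoB /andP[h1 h2]; exists rho.
move=> /= /negP[]; apply/eqP; rewrite big1_seq // => rho /andP[_ rhoB].
move/hasPn: H => /(_ _ rhoB); rewrite negb_and !negbK.
by case/orP => /eqP->; rewrite ?mul0r ?mulr0.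
Qed.

Hypothesis K0 : forall p N la mu, ~~ interlaced N la mu -> K p N la mu = 0.

Lemma kernel_neq0 p N la mu : K p N la mu != 0 -> interlaced N la mu.
Proof. by apply: contraR => /K0 ->. Qed.

Lemma chain_le N B ps la mu c : chain N B ps la mu != 0 -> (c < N)%N ->
  (nth 0%N mu c <= nth 0%N la c)%N.
Proof.
elim: ps la => [|p ps IH] la.
  by rewrite /=; case: (eqVneq la mu) => [->|_] //; rewrite eqxx.
case/chain_neq0 => rho [_ /kernel_neq0/interlacedP H /IH h2] cN.
by apply: leq_trans (h2 cN) _; case: (H c cN).
Qed.

(** Interlacing shifts the index by one per kernel, so a chain of n kernels adds at most n parts.
    This determines how many columns suffice. *)
Lemma chain_length N B ps la mu c : chain N B ps la mu != 0 -> size la = N ->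
  (nth 0%N la (c + size ps) <= nth 0%N mu c)%N.
Proof.
elim: ps la => [|p ps IH] la.
  by rewrite addn0 /=; case: (eqVneq la mu) => [->|_] //; rewrite eqxx.
case/chain_neq0 => rho [+ /kernel_neq0/interlacedP H /IH h2] sla.
rewrite mem_boxes => /andP[/eqP /h2 h _]; apply: leq_trans h; rewrite addnS.
case: (ltnP (c + size ps) N) => cN; first by case: (H _ cN).
by rewrite nth_default // sla leqW.
Qed.

Lemma chain_sorted N B ps la mu : chain N B ps la mu != 0 -> size la = N ->
  sorted geq mu -> sorted geq la.
Proof.
case: ps => [|p ps] H sla.
  by move: H => /=; case: (eqVneq la mu) => [->|_] //; rewrite eqxx.
by case/chain_neq0: H => rho [_ /kernel_neq0 + _] _; rewrite -sla; apply: interlaced_sortedl.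
Qed.

Lemma chain_widen N B C ps la mu : (B <= C)%N -> size la = N ->
  all (fun x => x < B)%N la -> chain N C ps la mu = chain N B ps la mu.
Proof.
move=> BC; elim: ps la => //= p ps IH la sla laB.
transitivity (\sum_(rho <- boxes N B) K p N la rho * chain N C ps rho mu).
  apply: big_boxes_widen => // rho; rewrite mem_boxes => /andP[/eqP srho _] rB.
  rewrite K0 ?mul0r //; apply: contra rB => /interlacedP H; apply/all_ltP => c.
  rewrite srho => cN; have [h _] := H c cN; apply: leq_ltn_trans h _.
  by move/all_ltP: laB; apply; rewrite sla.
apply: eq_big_seq => rho; rewrite mem_boxes => /andP[/eqP srho rB].
by rewrite IH.
Qed.

Hypothesis Kpad : forall p N la mu, size la = N -> size mu = N ->
  K p N.+1 (rcons la 0%N) (rcons mu 0%N) = K p N la mu.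

Lemma chain_pad N B ps la mu : (0 < B)%N -> size la = N -> size mu = N ->
  chain N.+1 B ps (rcons la 0%N) (rcons mu 0%N) = chain N B ps la mu.
Proof.
move=> B0; elim: ps la => [|p ps IH] la sla smu.
  by rewrite /= eqseq_rcons eqxx andbT.
rewrite !chainS big_boxes_rcons; apply: eq_big_seq => rho.
rewrite mem_boxes => /andP[/eqP srho _].
rewrite (sum_nat_only (n := 0%N)) // => [|x x0].
  by rewrite Kpad ?IH.
rewrite K0 ?mul0r //; apply/negP => /interlacedP /(_ N (leqnn _))[].
by rewrite !nth_rcons srho sla ltnn eqxx leqn0 (negbTE x0).
Qed.

End Chain.

(** * Kernels under ring morphisms *)

Section Rmorph.
Variables (R S : comUnitRingType) (f : {rmorphism R -> S}) (q : R).
Hypothesis qU : forall n, qpoch q q n \is a GRing.unit.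

Lemma rmorph_qpoch (x : R) n : f (qpoch x q n) = qpoch (f x) (f q) n.
Proof.
rewrite /qpoch rmorph_prod; apply: eq_bigr => i _.
by rewrite rmorphB rmorph1 rmorphM rmorphXn.
Qed.

Lemma rmorph_wal k b l m : f (wal q k b l m) = wal (f q) (f k) (f b) l m.
Proof.
rewrite /wal; case: ifP => _; rewrite ?rmorph0 // rmorph_div ?qU //.
rewrite rmorph_qpoch rmorph_prod; congr (_ / _); apply: eq_bigr => i _.
by rewrite rmorphB rmorphM rmorphXn.
Qed.

Lemma rmorph_wbe k l m : f (wbe q k l m) = wbe (f q) (f k) l m.
Proof.
by rewrite /wbe; case: ifP => _; rewrite ?rmorph0 // rmorph_div ?qU // !rmorph_qpoch.
Qed.

Variable b : nat -> R.
Hypothesis bU : forall c n, qpoch (b c) q n \is a GRing.unit.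

Lemma rmorph_wga c l m : f (wga q (b c) l m) = wga (f q) (f (b c)) l m.
Proof. by rewrite /wga rmorph_div ?bU // !rmorph_qpoch. Qed.

Lemma rmorph_Fker k N la mu :
  f (Fker q k b N la mu) = Fker (f q) (f k) (f \o b) N la mu.
Proof.
rewrite /Fker rmorph_prod; apply: eq_bigr => c _.
by rewrite 2!rmorphM rmorph_wga rmorph_wal rmorph_wbe.
Qed.

Lemma rmorph_Gker x N la mu :
  f (Gker q x b N la mu) = Gker (f q) (f x) (f \o b) N la mu.
Proof.
rewrite /Gker rmorph_prod; apply: eq_bigr => c _.
by rewrite 2!rmorphM rmorph_wga rmorph_wal rmorph_wbe rmorph1 rmorphM.
Qed.

End Rmorph.

Section KernelChains.
Variables (R : comUnitRingType) (q : R).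
Implicit Types (b : nat -> R) (p : R * (nat -> R)).

Definition Fp p := Fker q p.1 p.2.
Definition Gp p := Gker q p.1 p.2.

(** With Xi = S every variable shifts the sequence of parameters, with Xi = S^-1 it leaves the
    sequence fixed; hence the difference from [Gparams]. *)
Fixpoint Fparams (ks : seq R) b : seq (R * (nat -> R)) :=
  if ks is k :: ks' then (k, b) :: Fparams ks' (fun c => b c.+1) else [::].
Definition Gparams (xs : seq R) b : seq (R * (nat -> R)) := [seq (x, b) | x <- xs].

Definition Fchain N B ks b := chain Fp N B (Fparams ks b).
Definition Gchain N B xs b := chain Gp N B (Gparams xs b).

Lemma size_Fparams ks b : size (Fparams ks b) = size ks.
Proof. by elim: ks b => //= k ks IH b; rewrite IH. Qed.

Lemma Fp0 p N la mu : ~~ interlaced N la mu -> Fp p N la mu = 0.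
Proof. exact: Fker_eq0. Qed.
Lemma Gp0 p N la mu : ~~ interlaced N la mu -> Gp p N la mu = 0.
Proof. exact: Gker_eq0. Qed.

Lemma Fp_pad p N la mu : size la = N -> size mu = N ->
  Fp p N.+1 (rcons la 0%N) (rcons mu 0%N) = Fp p N la mu.
Proof.
move=> sla smu; rewrite /Fp /Fker big_ord_recr /= !nth_rcons_default.
rewrite !(nth_default 0%N) ?sla ?smu // /wga /wal /wbe !subnn /qpoch !big_ord0.
rewrite !divr1 !mulr1; apply: eq_bigr => c _.
by rewrite !nth_rcons_default.
Qed.

Lemma Gp_pad p N la mu : size la = N -> size mu = N ->
  Gp p N.+1 (rcons la 0%N) (rcons mu 0%N) = Gp p N la mu.
Proof.
move=> sla smu; rewrite /Gp /Gker big_ord_recr /= !nth_rcons_default.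
rewrite !(nth_default 0%N) ?sla ?smu // /wga /wal /wbe !subnn /qpoch !big_ord0.
rewrite !divr1 !mulr1; apply: eq_bigr => c _.
by rewrite !nth_rcons_default.
Qed.

End KernelChains.

Section RmorphChain.
Variables (R S : comUnitRingType) (f : {rmorphism R -> S}) (q : R).
Hypothesis qU : forall n, qpoch q q n \is a GRing.unit.

(** It serves both the embedding into the field of fractions and the substitutions for chi; the unit
    hypotheses let a morphism pass through the divisions. *)
Lemma rmorph_Fchain ks (b : nat -> R) N B la mu :
  (forall c n, qpoch (b c) q n \is a GRing.unit) ->
  f (Fchain q N B ks b la mu) = Fchain (f q) N B (map f ks) (f \o b) la mu.
Proof.
rewrite /Fchain; elim: ks b la => [|k ks IH] b la bU /=.
  by case: eqP; rewrite ?rmorph1 ?rmorph0.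
rewrite rmorph_sum; apply: eq_bigr => rho _; rewrite rmorphM.
by rewrite IH // rmorph_Fker.
Qed.

Lemma rmorph_Gchain xs (b : nat -> R) N B la mu :
  (forall c n, qpoch (b c) q n \is a GRing.unit) ->
  f (Gchain q N B xs b la mu) = Gchain (f q) N B (map f xs) (f \o b) la mu.
Proof.
move=> bU; rewrite /Gchain; elim: xs la => [|k ks IH] la /=.
  by case: eqP; rewrite ?rmorph1 ?rmorph0.
rewrite rmorph_sum; apply: eq_bigr => rho _; rewrite rmorphM.
by rewrite IH // rmorph_Gker.
Qed.
End RmorphChain.

(** * Exchanging chains of kernels *)

Section ExchangeChains.
Variables (E : fieldType) (q : E).
Hypothesis q0 : q != 0.
Hypothesis qP : forall n, 1 - q ^+ n.+1 != 0.
Implicit Types (b : nat -> E) (la mu nu : seq nat) (js : seq nat).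
Local Notation qpows js := [seq q ^+ j | j <- js].

Lemma Gchain_neq0 b N B js la nu : Gchain q N.+1 B (qpows js) b la nu != 0 ->
  (nth 0%N la 0%N <= nth 0%N nu 0%N + sumn js)%N.
Proof.
rewrite /Gchain; elim: js la => [|j js IH] la.
  by rewrite addn0 /=; case: (eqVneq la nu) => [->|_] //; rewrite eqxx.
case/(@chain_neq0 _ _ (@Gp _ q) _ _ (q ^+ j, b) (Gparams (qpows js) b)) => rho [_ H /IH h].
rewrite /= addnCA addnC.
apply: (@leq_trans (nth 0%N rho 0%N + j)%N); last by rewrite leq_add2r.
by rewrite leqNgt; apply: contra H => H; rewrite /Gp /= Gker_qpow.
Qed.

Lemma exchange_Gchain k js b N B mu nu :
  qgen q b -> size mu = N.+1 -> size nu = N.+1 -> nth 0%N mu N = 0%N ->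
  sorted geq nu -> (nth 0%N nu 0%N + sumn js < B)%N -> all (fun x => x < B)%N mu ->
  \sum_(la <- boxes N.+1 B)
     Fker q k b N.+1 la mu * Gchain q N.+1 B (qpows js) b la nu
  = (\prod_(j <- js) (qpoch k q j / qpoch (b 0%N) q j))
    * \sum_(rho <- boxes N.+1 B) Fker q k b N.+1 nu rho
               * Gchain q N.+1 B (qpows js) (fun c => b c.+1) mu rho.
Proof.
move=> bP; elim: js mu => [|j js IH] mu smu snu last0 srt nB muB.
  rewrite addn0 in nB; have nuB : all (fun x => x < B)%N nu.
    apply/allP => x /(allP (sorted_le_head srt)) xn; exact: leq_ltn_trans nB.
  have nu_in : nu \in boxes N.+1 B by rewrite mem_boxes snu eqxx.
  have mu_in : mu \in boxes N.+1 B by rewrite mem_boxes smu eqxx.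
  rewrite /Gchain big_nil mul1r (bigD1_seq nu) ?boxes_uniq //= eqxx mulr1 big1 ?addr0.
    rewrite (bigD1_seq mu) ?boxes_uniq //= eqxx mulr1 big1 ?addr0 // => rho.
    by rewrite eq_sym => /negbTE ->; rewrite mulr0.
  by move=> la /negbTE ->; rewrite mulr0.
rewrite big_cons.
have nBj : (nth 0%N nu 0%N + sumn js < B)%N.
  by apply: leq_ltn_trans nB; rewrite leq_add2l leq_addl.
set G := Gchain q N.+1 B (qpows js).
transitivity (\sum_(s <- boxes N.+1 B) (\sum_(la <- boxes N.+1 B)
   Fker q k b N.+1 la mu * Gker q (q ^+ j) b N.+1 la s) * G b s nu).
  under [RHS]eq_bigr => s _ do rewrite mulr_suml.
  rewrite exchange_big; apply: eq_bigr => la _.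
  rewrite /Gchain /= mulr_sumr; apply: eq_bigr => s _.
  by rewrite mulrA.
set c := qpoch k q j / _.
transitivity (\sum_(s <- boxes N.+1 B) (c * \sum_(rho <- boxes N.+1 B)
   Fker q k b N.+1 s rho * Gker q (q ^+ j) (fun c => b c.+1) N.+1 mu rho) * G b s nu).
  apply: eq_big_seq => s; rewrite mem_boxes => /andP[/eqP ss sB].
  have [->|G0] := eqVneq (G b s nu) 0; first by rewrite !mulr0.
  congr (_ * _); apply: exchange_G => //.
    by apply: (chain_sorted (@Gp0 _ q) G0).
  apply: leq_ltn_trans nB; rewrite /= addnCA addnC leq_add2l.
  exact: Gchain_neq0 G0.
transitivity (c * \sum_(rho <- boxes N.+1 B)
   Gker q (q ^+ j) (fun c => b c.+1) N.+1 mu rho *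
     \sum_(s <- boxes N.+1 B) Fker q k b N.+1 s rho * G b s nu).
  rewrite mulr_sumr; under [LHS]eq_bigr => s _ do rewrite -mulrA mulr_suml mulr_sumr.
  rewrite exchange_big; apply: eq_bigr => rho _ /=; rewrite !mulr_sumr.
  by apply: eq_bigr => s _; ring.
rewrite -[RHS]mulrA; congr (_ * _).
transitivity (\sum_(rho <- boxes N.+1 B)
   Gker q (q ^+ j) (fun c => b c.+1) N.+1 mu rho *
     ((\prod_(j <- js) (qpoch k q j / qpoch (b 0%N) q j)) *
       \sum_(t <- boxes N.+1 B) Fker q k b N.+1 nu t * G (fun c => b c.+1) rho t)).
  apply: eq_big_seq => rho; rewrite mem_boxes => /andP[/eqP srho rhoB].
  case: (boolP (interlaced N.+1 mu rho)) => [/interlacedP il|nil]; last by rewrite Gker_eq0 ?mul0r.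
  rewrite IH //; apply/eqP; rewrite -leqn0.
  by have [] := il N (ltnSn N); rewrite last0.
rewrite mulr_sumr; under [LHS]eq_bigr => rho _ do rewrite !mulr_sumr.
rewrite exchange_big; apply: eq_bigr => t _ /=.
rewrite /G /Gchain /= !mulr_sumr; apply: eq_bigr => rho _.
by rewrite /Gp /=; ring.
Qed.

(** Each F that is passed shifts the parameters of F*, so the scalar of the i-th variable contains b
    i. The zeros of mu from index N - [size ks] on leave room for one new part per F: every
    intermediate partition still ends in 0, as the exchange requires at its right boundary. *)
Lemma exchange_chains ks js b N B mu nu :
  qgen q b -> size mu = N.+1 -> size nu = N.+1 -> (size ks <= N)%N ->
  (forall c, N - size ks <= c -> nth 0%N mu c = 0)%N ->
  sorted geq nu -> (nth 0%N nu 0%N + sumn js < B)%N -> all (fun x => x < B)%N mu ->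
  \sum_(la <- boxes N.+1 B)
     Fchain q N.+1 B ks b la mu * Gchain q N.+1 B (qpows js) b la nu
  = (\prod_(i < size ks) \prod_(j <- js) (qpoch (nth 0 ks i) q j / qpoch (b i) q j))
    * \sum_(rho <- boxes N.+1 B) Fchain q N.+1 B ks b nu rho
               * Gchain q N.+1 B (qpows js) (fun c => b (size ks + c)%N) mu rho.
Proof.
elim: ks b nu => [|k ks IH] b nu bP smu snu ksN zmu srt nB muB.
  have nuB : all (fun x => x < B)%N nu.
    apply/allP => x /(allP (sorted_le_head srt)) xn.
    by apply: leq_ltn_trans nB; apply: leq_trans xn (leq_addr _ _).
  have nu_in : nu \in boxes N.+1 B by rewrite mem_boxes snu eqxx.
  have mu_in : mu \in boxes N.+1 B by rewrite mem_boxes smu eqxx.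
  rewrite /Fchain big_ord0 mul1r (bigD1_seq mu) ?boxes_uniq //= eqxx mul1r big1 ?addr0.
    rewrite (bigD1_seq nu) ?boxes_uniq //= eqxx mul1r big1 ?addr0 // => rho.
    by rewrite eq_sym => /negbTE ->; rewrite mul0r.
  by move=> la /negbTE ->; rewrite mul0r.
set F := Fchain q N.+1 B ks (fun c => b c.+1).
set G := Gchain q N.+1 B (qpows js).
transitivity (\sum_(s <- boxes N.+1 B) F s mu * (\sum_(la <- boxes N.+1 B)
   Fker q k b N.+1 la s * G b la nu)).
  under [RHS]eq_bigr => s _ do rewrite mulr_sumr.
  rewrite exchange_big; apply: eq_bigr => la _ /=.
  rewrite /Fchain /= mulr_suml; apply: eq_bigr => s _.
  by rewrite /Fp /= -/(Fchain _ _ _ _ _) -/F; ring.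
rewrite big_ord_recl /=.
set c := (X in X * _ * _).
transitivity (\sum_(s <- boxes N.+1 B) F s mu * (c * \sum_(r <- boxes N.+1 B)
   Fker q k b N.+1 nu r * G (fun c => b c.+1) s r)).
  apply: eq_big_seq => s; rewrite mem_boxes => /andP[/eqP ss sB].
  have [->|F0] := eqVneq (F s mu) 0; first by rewrite !mul0r.
  congr (_ * _); apply: exchange_Gchain => //.
  have := chain_length (@Fp0 _ q) (N - size ks)%N F0 ss.
  rewrite size_Fparams subnK ?(ltnW ksN) // zmu ?leqn0 => [/eqP //|].
  by rewrite leq_sub2l.
transitivity (c * \sum_(r <- boxes N.+1 B) Fker q k b N.+1 nu r *
     \sum_(s <- boxes N.+1 B) F s mu * G (fun c => b c.+1) s r).
  rewrite mulr_sumr; under [LHS]eq_bigr => s _ do rewrite mulrCA !mulr_sumr.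
  rewrite exchange_big; apply: eq_bigr => r _ /=; rewrite !mulr_sumr.
  by apply: eq_bigr => s _; ring.
rewrite -[RHS]mulrA; congr (_ * _).
set C := (X in _ = X * _).
transitivity (\sum_(r <- boxes N.+1 B) Fker q k b N.+1 nu r *
  (C * \sum_(t <- boxes N.+1 B) F r t * G (fun c => b (size ks + c).+1) mu t)).
  apply: eq_big_seq => r; rewrite mem_boxes => /andP[/eqP sr rB].
  case: (boolP (interlaced N.+1 nu r)) => [il|nil]; last by rewrite Fker_eq0 ?mul0r.
  congr (_ * _); apply: IH => //.
  - exact: ltnW.
  - by move=> c' h; apply: zmu; apply: leq_trans h; rewrite leq_sub2l.
  - by rewrite -sr in il; apply: interlaced_sortedr il.
  apply: leq_ltn_trans nB; rewrite leq_add2r.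
  by move/interlacedP: il => /(_ _ (ltn0Sn N))[].
rewrite mulr_sumr; under [LHS]eq_bigr => r _ do rewrite !mulr_sumr.
rewrite exchange_big; apply: eq_bigr => t _ /=.
rewrite /Fchain /= mulr_suml mulr_sumr; apply: eq_bigr => r _.
by rewrite /Fp /= -/(Fchain _ _ _ _ _) -/F; ring.
Qed.
End ExchangeChains.

(** * Substitution in power series *)

Lemma ser_of_mpolyM k (K : fieldType) (p r : {mpoly K[k]}) :
  ser_of_mpoly (p * r) = ser_of_mpoly p * ser_of_mpoly r.
Proof.
apply: mfpsP => m; rewrite (ser_mulE _ _ (ltnSn _)) /= !mcoeffM.
apply: eq_bigr => u /eqP mu.
by rewrite !ser_truncE !ltnS (mdeg_addl mu) (mdeg_addr mu).
Qed.

Lemma ser_of_mpolyX k (K : fieldType) (p : {mpoly K[k]}) n :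
  ser_of_mpoly (p ^+ n) = ser_of_mpoly p ^+ n.
Proof. by elim: n => // n IH; rewrite !exprS ser_of_mpolyM IH. Qed.

Section Substitution.
Variables (k : nat) (K : fieldType) (i0 t0 : 'I_k) (e : nat).
Implicit Types (f g : mfps k K) (p : {mpoly K[k]}) (m u : 'X_{1..k}).

Definition sub_tuple : k.-tuple {mpoly K[k]} :=
  [tuple if i == i0 then 'X_t0 ^+ e.+1 else 'X_i | i < k].

Definition sub_mon1 i : 'X_{1..k} := if i == i0 then (U_(t0) *+ e.+1)%MM else U_(i)%MM.
Definition sub_mon u : 'X_{1..k} := (\sum_(i < k) sub_mon1 i *+ u i)%MM.

(** The exponent e + 1 is positive, so the substitution never lowers degrees ([mdeg_sub_mon]). The
    coefficient at m thus depends only on the terms of f of degree at most mdeg m, and a polynomial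
    composition computes it. *)
Definition ser_sub f : mfps k K := MFPS (fun m =>
  (ser_trunc (mdeg m).+1 predT f \mPo sub_tuple)@_m).

Lemma sub_monE u :
  \prod_(i < k) (tnth sub_tuple i) ^+ u i = 'X_[K, sub_mon u].
Proof.
rewrite /sub_mon -mprodXnE; apply: eq_bigr => i _.
rewrite tnth_mktuple /sub_mon1; congr (_ ^+ _).
by case: ifP => _ //; rewrite mpolyXn.
Qed.

Lemma comp_subE p m :
  (p \mPo sub_tuple)@_m = \sum_(u <- msupp p | sub_mon u == m) p@_u.
Proof.
rewrite comp_mpolyE raddf_sum /= [RHS]big_mkcond /=; apply: eq_bigr => u _.
rewrite mcoeffZ sub_monE mcoeffX; case: eqP => _; by rewrite ?mulr1 ?mulr0.
Qed.

Lemma mdeg_sub_mon u : (mdeg u <= mdeg (sub_mon u))%N.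
Proof.
rewrite /sub_mon mdeg_sum mdegE; apply: leq_sum => i _.
rewrite mdegMn /sub_mon1; case: ifP => _; last by rewrite mdeg1 mul1n.
by rewrite mdegMn mdeg1 mul1n leq_pmull.
Qed.

Lemma sub_monEi u i : i0 != t0 -> sub_mon u i =
  if i == i0 then 0%N else
  if i == t0 then (u t0 + e.+1 * u i0)%N else u i.
Proof.
move=> it; rewrite /sub_mon mnm_sumE (bigD1 i0) //= mulmnE.
rewrite {1}/sub_mon1 eqxx mulmnE mnm1E.
have -> : (\sum_(j < k | j != i0) (sub_mon1 j *+ u j)%MM i
        = if i == i0 then 0 else u i)%N.
  rewrite (eq_bigr (fun j => (j == i) * u j)%N) => [|j ji]; last first.
    by rewrite mulmnE /sub_mon1 (negbTE ji) mnm1E.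
  case: eqP => [->|/eqP ii]; first by rewrite big1 // => j /negbTE ->.
  rewrite (bigD1 i) //= eqxx mul1n big1 ?addn0 // => j /andP[_ /negbTE->] //.
case: (eqVneq i i0) => [->|ii0]; first by rewrite eq_sym (negbTE it) !mul0n.
rewrite [t0 == i]eq_sym; case: (eqVneq i t0) => [->|_]; last by [].
by rewrite mul1n addnC mulnC.
Qed.

Lemma comp_sub_cong d p p' :
  (forall u, (mdeg u < d)%N -> p@_u = p'@_u) ->
  forall m, (mdeg m < d)%N -> (p \mPo sub_tuple)@_m = (p' \mPo sub_tuple)@_m.
Proof.
move=> pp m md; apply/eqP; rewrite -subr_eq0 -mcoeffB -linearB /=.
rewrite comp_subE big1 // => u /eqP um; rewrite mcoeffB pp ?subrr //.
by apply: leq_ltn_trans md; rewrite -um mdeg_sub_mon.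
Qed.

Lemma ser_subE d f m : (mdeg m < d)%N ->
  sercoef (ser_sub f) m = (ser_trunc d predT f \mPo sub_tuple)@_m.
Proof.
move=> md; apply: (@comp_sub_cong (mdeg m).+1) => // u um.
by rewrite !ser_truncE um (leq_trans um md).
Qed.

Lemma ser_sub_is_additive : {morph ser_sub : f g / f - g}.
Proof.
move=> f g; apply: mfpsP => m; rewrite sercoefD sercoefN /=.
rewrite -mcoeffB -linearB /=; apply: comp_sub_cong (ltnSn _) => u um.
by rewrite mcoeffB !ser_truncE um.
Qed.

Lemma ser_sub_poly p : ser_sub (ser_of_mpoly p) = ser_of_mpoly (p \mPo sub_tuple).
Proof.
apply: mfpsP => m /=; apply: comp_sub_cong (ltnSn _) => u um.
exact: ser_trunc_of_mpoly.
Qed.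

Lemma ser_sub_is_multiplicative : monoid_morphism ser_sub.
Proof.
split; first by rewrite ser_sub_poly rmorph1.
move=> f g; apply: mfpsP => m; have md := ltnSn (mdeg m).
rewrite [RHS](ser_mulE _ _ md) /=.
transitivity ((ser_trunc (mdeg m).+1 predT f * ser_trunc (mdeg m).+1 predT g
   \mPo sub_tuple)@_m).
  apply: comp_sub_cong md => u um.
  by rewrite ser_truncE um (ser_mulE _ _ um).
rewrite rmorphM !mcoeffM /=; apply: eq_bigr => u /eqP mu.
have ud := leq_ltn_trans (mdeg_addl mu) md; have ud' := leq_ltn_trans (mdeg_addr mu) md.
by rewrite !ser_truncE ud ud' !(ser_subE _ ud) !(ser_subE _ ud').
Qed.

HB.instance Definition _ := GRing.isZmodMorphism.Build (mfps k K) (mfps k K)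
  ser_sub ser_sub_is_additive.
HB.instance Definition _ := GRing.isMonoidMorphism.Build (mfps k K) (mfps k K)
  ser_sub ser_sub_is_multiplicative.

Lemma ser_sub_cst c : ser_sub (ser_cst k c) = ser_cst k c.
Proof. by rewrite ser_sub_poly comp_mpolyC. Qed.

Lemma ser_sub_var i : ser_sub (ser_var K i) =
  if i == i0 then ser_var K t0 ^+ e.+1 else ser_var K i.
Proof.
rewrite /ser_var ser_sub_poly comp_mpolyXU -tnth_nth tnth_mktuple.
by case: ifP => // _; rewrite ser_of_mpolyX.
Qed.

Lemma ser_sub_ord d f : ser_ord d f -> ser_ord d (ser_sub f).
Proof.
move=> fd m md; rewrite (ser_subE _ md) -(mcoeff0 K m) -(comp_mpoly0 sub_tuple).
apply: comp_sub_cong md => u ud; rewrite ser_truncE ud /= mcoeff0; exact: fd.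
Qed.

End Substitution.

(* Substituting a high power of one variable for another one keeps a series
   nonzero: among the monomials of the series with the least exponent [a] of
   the first variable, take [X^u]; after [X_i0 := X_t0^(e+1)] with [e = u_t0],
   no other monomial lands on the image of [X^u]. *)
Lemma ser_sub_neq0 k (K : fieldType) (i0 t0 : 'I_k) (f : mfps k K) :
  i0 != t0 -> f != 0 -> exists e, ser_sub i0 t0 e f != 0.
Proof.
move=> it f0.
have [v fv] : exists v, sercoef f v != 0.
  apply: contrapT => H; move/eqP: f0; apply; apply: mfpsP => v.
  by rewrite sercoef0; apply/eqP/negPn/negP => fv; apply: H; exists v.
pose P a := `[< exists2 u : 'X_{1..k}, u i0 = a & sercoef f u != 0 >].
have exP : exists a, P a by exists (v i0); apply/asboolP; exists v.
case: (ex_minnP exP) => a /asboolP[u ua fu] amin.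
exists (u t0); apply/eqP => /(congr1 (fun g => sercoef g (sub_mon i0 t0 (u t0) u))).
rewrite sercoef0 /=; set m := sub_mon _ _ _ _; set d := (mdeg m).+1.
rewrite comp_subE => /eqP; apply/negP.
set p := ser_trunc _ _ _.
have pu : p@_u = sercoef f u.
  by rewrite ser_truncE /= ltnS mdeg_sub_mon.
have usupp : u \in msupp p by rewrite mcoeff_msupp pu.
rewrite big_mkcond (bigD1_seq u) ?msupp_uniq //= eqxx big1 ?addr0 ?pu // => w wu.
case: eqP => // wm.
apply/eqP/negPn/negP; rewrite ser_truncE andbT; case: ifP => [_ fw|]; last by rewrite eqxx.
case/eqP: wu; have aw : (a <= w i0)%N by apply: amin; apply/asboolP; exists w.
have eqi i : sub_mon i0 t0 (u t0) w i = sub_mon i0 t0 (u t0) u i by rewrite wm.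
have := eqi t0; rewrite !sub_monEi // eq_sym (negbTE it) eqxx => h.
(* If w i0 > a, the exponent of t0 on the left is at least (u t0 + 1) (a + 1), which exceeds its
   value u t0 + (u t0 + 1) a for u. *)
have wi0 : w i0 = u i0.
  apply/eqP; rewrite eqn_leq ua aw andbT leqNgt; apply/negP => lt.
  by move: h lt; rewrite ua; nia.
apply/mnmP => i; have := eqi i; rewrite !sub_monEi //.
case: eqP => [->|_] //; case: eqP => [->|_] //.
by rewrite wi0 => /addIn.
Qed.

(** * Limits and infinite q-products *)

Section Limits.
Variables (k : nat) (K : fieldType).
Implicit Types (f : mfps k K) (q x : mfps k K).

(** Only finitely many monomials have degree below d, so the thresholds of their coefficients have a
    maximum and convergence is uniform in each degree range. *)
Lemma ser_cvg_ord (u : nat -> mfps k K) f : ser_cvg u f ->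
  forall d, exists N, forall i, (N <= i)%N -> ser_ord d (u i - f).
Proof.
move=> uf d; have /choice[N HN] := uf.
exists (\max_(m : 'X_{1..k < d}) N m)%N => i Ni m md.
rewrite sercoefD sercoefN HN ?subrr //.
apply: leq_trans Ni; exact: (leq_bigmax (BMultinom md)).
Qed.

Lemma ser_ord_cvg (u : nat -> mfps k K) f :
  (forall d, exists N, forall i, (N <= i)%N -> ser_ord d (u i - f)) ->
  ser_cvg u f.
Proof.
move=> uf m; have [N HN] := uf (mdeg m).+1; exists N => i /HN H.
by have /eqP := H m (ltnSn _); rewrite sercoefD sercoefN subr_eq0 => /eqP.
Qed.

Lemma qpoch_inf_split q x j : sercoef q 0%MM = 0 ->
  qpoch_inf x q = qpoch x q j * qpoch_inf (x * q ^+ j) q.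
Proof.
move=> q0; apply: ser_limE; apply: ser_ord_cvg => d.
have [N HN] := ser_cvg_ord (qpoch_inf_cvg (x * q ^+ j) q0) d.
exists (N + j)%N => i Ni; have ji : (j <= i)%N by apply: leq_trans Ni; apply: leq_addl.
have -> : qpoch x q i = qpoch x q j * qpoch (x * q ^+ j) q (i - j).
  rewrite -{1}(subnKC ji) /qpoch big_split_ord /=; congr (_ * _).
  by apply: eq_bigr => l _; rewrite exprD mulrA.
rewrite -mulrBr mulrC -[d]addn0; apply: ser_ordM; last by move=> ?; rewrite ltn0.
by apply: HN; rewrite leq_subRL // addnC.
Qed.

Lemma qpoch_inf_unit q x : sercoef q 0%MM = 0 -> sercoef x 0%MM != 1 ->
  qpoch_inf x q \is a GRing.unit.
Proof.
move=> q0 x1; rewrite ser_unitE.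
have [N /(_ N.+1 (leqnSn _)) <-] := qpoch_inf_cvg x q0 0%MM.
rewrite /qpoch big_ord_recl expr0 mulr1 sercoef0M mulf_neq0 //.
  by rewrite sercoefD sercoefN sercoef1 eqxx subr_eq0 eq_sym.
elim/big_rec: _ => [|i y _ y0]; first by rewrite sercoef1 eqxx oner_neq0.
rewrite sercoef0M mulf_neq0 // sercoefD sercoefN sercoef1 eqxx sercoef0M.
by rewrite exprS sercoef0M q0 mul0r mulr0 subr0 oner_neq0.
Qed.

Lemma rmorph_qpoch_inf (phi : {rmorphism mfps k K -> mfps k K}) q x :
  (forall d f, ser_ord d f -> ser_ord d (phi f)) -> sercoef q 0%MM = 0 ->
  phi (qpoch_inf x q) = qpoch_inf (phi x) (phi q).
Proof.
move=> phiC q0; symmetry; apply: ser_limE; apply: ser_ord_cvg => d.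
have [N HN] := ser_cvg_ord (qpoch_inf_cvg x q0) d.
exists N => i /HN /phiC; rewrite rmorphB /=.
suff -> : phi (qpoch x q i) = qpoch (phi x) (phi q) i by [].
rewrite /qpoch rmorph_prod; apply: eq_bigr => l _.
by rewrite rmorphB rmorph1 rmorphM rmorphXn.
Qed.

End Limits.

(** * From lattice sums to kernels *)

Section Rows.
Variables (L b : nat).
Local Notation row := {ffun 'I_L -> 'I_b}.
Implicit Types (z : row) (l : seq nat).

(* The partition with z_c parts equal to c + 1 in its conjugate. *)
Definition row_part z : seq nat :=
  mkseq (fun c => \sum_(j < L | c <= j) z j)%N L.

Lemma nth_row_part z c : nth 0%N (row_part z) c = (\sum_(j < L | c <= j) z j)%N.
Proof.
case: (ltnP c L) => cL; first by rewrite nth_mkseq.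
rewrite nth_default ?size_mkseq // big1 // => j cj.
by move: (leq_trans cL cj); rewrite leqNgt ltn_ord.
Qed.

Lemma row_part_rec z (c : 'I_L) :
  nth 0%N (row_part z) c = (z c + nth 0%N (row_part z) c.+1)%N.
Proof.
rewrite !nth_row_part (bigD1 c) //=; congr (_ + _)%N; apply: eq_bigl => j.
by rewrite ltn_neqAle eq_sym andbC.
Qed.

Lemma row_part_L z : nth 0%N (row_part z) L = 0%N.
Proof. by rewrite nth_default // size_mkseq. Qed.

Lemma eq_row_part z l : size l = L ->
  (forall c : 'I_L, nth 0%N l c = z c + nth 0%N l c.+1)%N -> row_part z = l.
Proof.
move=> sl H; apply: (@eq_from_nth _ 0%N); rewrite size_mkseq ?sl // => i iL.
have E k : forall c, (c + k = L)%N -> nth 0%N (row_part z) c = nth 0%N l c.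
  elim: k => [|k IH] c; first by rewrite addn0 => ->; rewrite row_part_L nth_default ?sl.
  rewrite addnS -addSn => ck; have cL : (c < L)%N by rewrite -ck leq_addr.
  by rewrite -[c]/(nat_of_ord (Ordinal cL)) row_part_rec H IH.
by apply: (E (L - i)%N); rewrite subnKC // ltnW.
Qed.

Lemma row_part_inj : injective row_part.
Proof.
move=> z y zy; apply/ffunP => c; apply/val_inj/eqP => /=.
by rewrite -(eqn_add2r (nth 0%N (row_part z) c.+1)) -row_part_rec zy -row_part_rec.
Qed.

Lemma row_part_sorted z : sorted geq (row_part z).
Proof.
apply/(sortedP 0%N) => i; rewrite size_mkseq => iL.
by rewrite -[i]/(nat_of_ord (Ordinal (ltnW iL))) row_part_rec /= leq_addl.
Qed.

Lemma row_part_surj l : l \in boxes L b -> sorted geq l ->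
  exists z, row_part z = l.
Proof.
rewrite mem_boxes => /andP[/eqP sl /all_ltP lB] /(sortedP 0%N) srt.
have zb (c : 'I_L) : (nth 0%N l c - nth 0%N l c.+1 < b)%N.
  by apply: leq_ltn_trans (leq_subr _ _) _; apply: lB; rewrite sl.
exists [ffun c => Ordinal (zb c)]; apply: eq_row_part => // c.
rewrite ffunE /= subnK //; case: (ltnP c.+1 L) => cL.
  by apply: srt; rewrite sl.
by rewrite nth_default ?sl.
Qed.

(** Rows and boxes do not match exactly: labels below b can add up to parts beyond b. The hypothesis
    on f removes these extra rows, as well as the unsorted sequences of the box. *)
Lemma big_row_part (R : nmodType) (f : seq nat -> R) :
  (forall l, size l = L ->
     ~~ (sorted geq l && all (fun x => x < b)%N l) -> f l = 0) ->
  \sum_(z : row) f (row_part z) = \sum_(l <- boxes L b) f l.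
Proof.
move=> f0; rewrite -[LHS](big_map row_part predT f) /=.
pose ok l := sorted geq l && all (fun x => x < b)%N l.
rewrite (bigID ok) /= [X in _ + X]big1_seq; last first.
  by move=> l /andP[nok /mapP[z _ zl]]; apply: f0; rewrite // zl size_mkseq.
rewrite [RHS](bigID ok) /= [X in _ = _ + X]big1_seq; last first.
  by move=> l /andP[nok]; rewrite mem_boxes => /andP[/eqP sl _]; apply: f0.
congr (_ + _); rewrite -[LHS]big_filter -[RHS]big_filter; apply: perm_big.
apply: uniq_perm.
- by rewrite filter_uniq // map_inj_uniq ?index_enum_uniq //; apply: row_part_inj.
- exact/filter_uniq/boxes_uniq.
move=> l; rewrite !mem_filter; case okl: (ok l) => //=; case/andP: okl => srt lb.
rewrite mem_boxes lb andbT; apply/mapP/eqP => [[z _ ->]|sl].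
  by rewrite size_mkseq.
have [|z zl] := row_part_surj _ srt; first by rewrite mem_boxes sl eqxx.
by exists z; rewrite ?mem_index_enum.
Qed.

End Rows.

Definition pad N (l : seq nat) : seq nat := mkseq (nth 0%N l) N.

Lemma nth_pad N l c : (size l <= N)%N -> nth 0%N (pad N l) c = nth 0%N l c.
Proof.
move=> lN; case: (ltnP c N) => cN; first by rewrite nth_mkseq.
by rewrite !nth_default ?size_mkseq // (leq_trans lN).
Qed.

Lemma size_pad N l : size (pad N l) = N.
Proof. exact: size_mkseq. Qed.

Lemma intpart_sorted (la : intpart) c : (nth 0%N la c.+1 <= nth 0%N la c)%N.
Proof.
case: la => /= l /andP[/(sortedP 0%N) srt _].
case: (ltnP c.+1 (size l)) => cl; first exact: srt.
by rewrite nth_default.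
Qed.

Lemma row_part_conj L b (z : {ffun 'I_L -> 'I_b}) (la : intpart) :
  (plen la <= L)%N ->
  [forall c : 'I_L, z c == conj_mult la c.+1 :> nat] = (row_part z == pad L la).
Proof.
move=> lL; apply/forallP/eqP => [H|H c].
  apply: eq_row_part => [|c]; first exact: size_pad.
  by rewrite !nth_pad // (eqP (H c)) subnK // intpart_sorted.
rewrite -(eqn_add2r (nth 0%N (row_part z) c.+1)) -row_part_rec H !nth_pad //.
by rewrite /conj_mult /part /= subnK // intpart_sorted.
Qed.

(** * Transfer matrices: the grid sum as a chain of row weights *)

Section PathSum.
Variables (R : comPzRingType) (T : finType).

Fixpoint pathsum n (w : nat -> T -> T -> R) (e : pred T) (x : T) : R :=
  if n is n'.+1 then \sum_z w 0%N x z * pathsum n' (fun i => w i.+1) e z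
  else (e x)%:R.

Lemma big_ffun_recl n (F : {ffun 'I_n.+1 -> T} -> R) :
  \sum_(V : {ffun 'I_n.+1 -> T}) F V =
  \sum_x \sum_(V : {ffun 'I_n -> T})
     F [ffun i => if unlift ord0 i is Some j then V j else x].
Proof.
rewrite pair_big /=.
rewrite (reindex (fun p : T * {ffun 'I_n -> T} =>
  [ffun i => if unlift ord0 i is Some j then p.2 j else p.1])) //=.
exists (fun V : {ffun 'I_n.+1 -> T} => (V ord0, [ffun j => V (lift ord0 j)])).
  move=> [x V] _ /=; rewrite ffunE unlift_none; congr (_, _).
  by apply/ffunP => j; rewrite !ffunE liftK.
move=> V _; apply/ffunP => i; rewrite !ffunE /=.
by case: unliftP => [j ->|->]; rewrite ?ffunE.
Qed.

Lemma pathsumE n (w : nat -> T -> T -> R) (s e : pred T) :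
  \sum_(V : {ffun 'I_n.+1 -> T} | s (V ord0) && e (V ord_max))
    \prod_(r < n) w r (V (widen_ord (leqnSn n) r)) (V (lift ord0 r))
  = \sum_(x | s x) pathsum n w e x.
Proof.
rewrite big_mkcond big_ffun_recl [RHS]big_mkcond /=; apply: eq_bigr => x _.
elim: n w s x => [|n IH] w s x.
  rewrite (big_pred1 [ffun=> x]) => [|V]; last first.
    by rewrite /= (_ : V = [ffun=> x]) ?eqxx //; apply/ffunP => -[].
  rewrite !ffunE unlift_none big_ord0.
  have -> : unlift ord0 (ord_max : 'I_1) = None.
    by rewrite (_ : ord_max = ord0) ?unlift_none //; apply/val_inj.
  by case: (s x) => /=; case: (e x).
rewrite big_ffun_recl /=.
case sx: (s x); last first.
  by rewrite big1 // => z _; rewrite big1 // => V _; rewrite !ffunE unlift_none sx.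
apply: eq_bigr => z _; have := IH (fun i => w i.+1) predT z; rewrite /= => <-.
rewrite mulr_sumr; apply: eq_bigr => V _; rewrite !ffunE unlift_none sx /=.
have -> : ord_max = lift ord0 (ord_max : 'I_n.+1) by apply/val_inj.
rewrite liftK ffunE; set em := e _; case: em => //; last by rewrite mulr0.
rewrite big_ord_recl; congr (_ * _).
  rewrite !ffunE liftK ffunE unlift_none.
  rewrite (_ : widen_ord _ ord0 = ord0) ?unlift_none //; exact/val_inj.
apply: eq_bigr => r _; congr (w _ _ _); rewrite !ffunE ?liftK ?ffunE //.
have -> : widen_ord (leqnSn n.+1) (lift ord0 r) = lift ord0 (widen_ord (leqnSn n) r).
  exact/val_inj.
  by rewrite liftK ffunE.
by rewrite liftK.
Qed.

End PathSum.

Lemma big_ffun_curry (R : nmodType) (A B C : finType)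
    (F : {ffun A * B -> C} -> R) :
  \sum_(v : {ffun A * B -> C}) F v =
  \sum_(V : {ffun A -> {ffun B -> C}}) F [ffun p => V p.1 p.2].
Proof.
rewrite (reindex (fun V : {ffun A -> {ffun B -> C}} => [ffun p => V p.1 p.2])) //=.
exists (fun v : {ffun A * B -> C} => [ffun a => [ffun c => v (a, c)]]).
  by move=> V _; apply/ffunP => a; apply/ffunP => c; rewrite !ffunE.
by move=> v _; apply/ffunP => -[a c]; rewrite !ffunE.
Qed.

Section Grid.
Variables (E : fieldType) (q : E) (n : nat).
Variables (Aw : nat -> nat -> E) (t2 s2 : nat -> nat -> E).

(** One row of the grid with its horizontal labels eliminated: the edge left of column c carries
    lam_c - rho_c, and the first one is a_r. The test for interlacing makes all the differences of
    naturals exact. *)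
Definition row_weight (r L : nat) (lam rho : seq nat) : E :=
  if interlaced L lam rho then
    Aw r (nth 0%N lam 0%N - nth 0%N rho 0%N)
    * \prod_(c < L) Wweight q (t2 r c) (s2 r c)
        (nth 0%N rho c - nth 0%N rho c.+1) (nth 0%N lam c - nth 0%N rho c)
        (nth 0%N lam c - nth 0%N lam c.+1) (nth 0%N lam c.+1 - nth 0%N rho c.+1)
  else 0.

Lemma row_weight0 r L lam rho : ~~ interlaced L lam rho -> row_weight r L lam rho = 0.
Proof. by rewrite /row_weight => /negbTE ->. Qed.

Lemma Wweight_neq0 x y i j k l : Wweight q x y i j k l != 0 ->
  (i + j = k + l)%N /\ (l <= i)%N.
Proof. by rewrite /Wweight; case: ifP => [/andP[/eqP -> ->]|]; rewrite ?eqxx. Qed.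

Section GridFixed.
Variables (L b : nat) (V : {ffun 'I_n.+1 -> {ffun 'I_L -> 'I_b.+1}}).
Let up (r : 'I_n) := row_part (V (widen_ord (leqnSn n) r)).
Let lo (r : 'I_n) := row_part (V (lift ord0 r)).

Definition gridW (h : {ffun 'I_n * 'I_L.+1 -> 'I_b.+1}) : E :=
  \prod_(r < n) \prod_(c < L) Wweight q (t2 r c) (s2 r c)
     (V (lift ord0 r) c) (h (r, widen_ord (leqnSn L) c))
     (V (widen_ord (leqnSn n) r) c) (h (r, lift ord0 c)).

(** Starting from the label 0 on the right, the conservation i + j = k + l determines the horizontal
    labels one column after the other. The condition l <= i of the weight then reads lam_(c+1) <=
    rho_c, the second half of interlacing. *)
Lemma grid_det (h : {ffun 'I_n * 'I_L.+1 -> 'I_b.+1}) :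
  [forall r : 'I_n, h (r, ord_max) == 0%N :> nat] ->
  gridW h != 0 -> forall r : 'I_n, interlaced L (up r) (lo r) /\
    forall c : 'I_L.+1, h (r, c) = (nth 0%N (up r) c - nth 0%N (lo r) c)%N :> nat.
Proof.
move=> /forallP h0 hW r.
have WN (c : 'I_L) := Wweight_neq0 (elimT (prodf_neq0 _ _) (elimT (prodf_neq0 _ _) hW r isT) c isT).
have hE k : forall c : 'I_L.+1, (c + k = L)%N ->
    (h (r, c) + nth 0%N (lo r) c = nth 0%N (up r) c)%N.
  elim: k => [|k IH] c ck.
    rewrite addn0 in ck; have -> : c = ord_max by apply/val_inj.
    by rewrite (eqP (h0 r)) /= !row_part_L.
  have cL : (c < L)%N
    by apply: (@leq_trans (c + k.+1)); [rewrite addnS ltnS leq_addr | rewrite ck].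
  have [w1 w2] := WN (Ordinal cL).
  have := IH (lift ord0 (Ordinal cL)); rewrite /= /bump /= add1n.
  rewrite addSnnS => /(_ ck) IHc.
  have -> : c = widen_ord (leqnSn L) (Ordinal cL) by apply/val_inj.
  rewrite /= -[X in nth _ _ X]/(nat_of_ord (Ordinal cL)) (row_part_rec _ (Ordinal cL)).
  rewrite (row_part_rec (V (widen_ord _ r)) (Ordinal cL)) /=.
  by move: w1 IHc; rewrite /up /lo; lia.
have hE' (c : 'I_L.+1) : (h (r, c) + nth 0%N (lo r) c = nth 0%N (up r) c)%N.
  by apply: (hE (L - c)%N); rewrite subnKC // -ltnS.
split; last by move=> c; rewrite -hE' addnK.
apply/interlacedP => c cL.
have [w1 w2] := WN (Ordinal cL).
have h1 := hE' (widen_ord (leqnSn L) (Ordinal cL)).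
have h2 := hE' (lift ord0 (Ordinal cL)).
have h3 := row_part_rec (V (lift ord0 r)) (Ordinal cL).
move: w2 h1 h2 h3; rewrite /= /bump /= add1n -/(lo r) => w2 h1 h2 h3.
split; first by rewrite -h1 leq_addl.
by rewrite -h2 h3 leq_add2r.
Qed.

Hypothesis L0 : (0 < L)%N.

Lemma row_part_le (z : {ffun 'I_L -> 'I_b.+1}) c :
  (nth 0%N (row_part z) c <= nth 0%N (row_part z) 0%N)%N.
Proof.
case: (ltnP c (size (row_part z))) => cs; last by rewrite nth_default.
by have /(all_nthP 0%N) := sorted_le_head (row_part_sorted z); apply.
Qed.

Let hd (i : nat) := nth 0%N (row_part (V (inord i))) 0.

Lemma hd_up (r : 'I_n) : nth 0%N (up r) 0%N = hd r.
Proof.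
by rewrite /hd /up; congr (nth _ (row_part (V _)) _); apply/val_inj; rewrite /= inordK // ltnS ltnW.
Qed.

Lemma hd_lo (r : 'I_n) : nth 0%N (lo r) 0%N = hd r.+1.
Proof.
by rewrite /hd /lo; congr (nth _ (row_part (V _)) _); apply/val_inj; rewrite /= inordK // ltnS.
Qed.

Hypothesis il : forall r, interlaced L (up r) (lo r).

Lemma hd_dec i : (i < n)%N -> (hd i.+1 <= hd i)%N.
Proof.
move=> iN; have := il (Ordinal iN) => /interlacedP /(_ _ L0)[+ _].
by rewrite hd_up hd_lo.
Qed.

Lemma hd_le i : (i <= n)%N -> (hd i <= hd 0)%N.
Proof.
by elim: i => // i IH iN; apply: leq_trans (hd_dec iN) (IH (ltnW iN)).
Qed.

Lemma hd_telescope : (\sum_(r < n) (hd r - hd r.+1) + hd n = hd 0)%N.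
Proof.
rewrite -(big_mkord xpredT (fun r => hd r - hd r.+1)%N).
have T i : (i <= n)%N -> (\sum_(0 <= r < i) (hd r - hd r.+1) + hd i = hd 0)%N.
  elim: i => [|i IH] iN; first by rewrite big_nil.
  by rewrite big_nat_recr //= -addnA subnK ?hd_dec // IH // ltnW.
exact: T.
Qed.

Lemma up_le (r : 'I_n) c : (nth 0%N (up r) c <= hd 0)%N.
Proof. by apply: leq_trans (row_part_le _ _) _; rewrite -/(up r) hd_up hd_le // ltnW. Qed.

End GridFixed.

Lemma grid_inner (L b : nat) (V : {ffun 'I_n.+1 -> {ffun 'I_L -> 'I_b.+1}})
    (la mu : intpart) :
  part la 1 = b -> (plen la < L)%N -> (plen mu < L)%N ->
  row_part (V ord0) = pad L la -> row_part (V ord_max) = pad L mu ->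
  \sum_(a : {ffun 'I_n -> 'I_b.+1}
        | ((\sum_(i < n) a i) + part mu 1 == part la 1)%N)
    (\prod_(i < n) Aw i (a i)) *
    (\sum_(h : {ffun 'I_n * 'I_L.+1 -> 'I_b.+1}
        | [forall r : 'I_n, h (r, ord0) == a r :> nat] &&
          [forall r : 'I_n, h (r, ord_max) == 0%N :> nat]) gridW V h)
  = \prod_(r < n) row_weight r L (row_part (V (widen_ord (leqnSn n) r)))
                            (row_part (V (lift ord0 r))).
Proof.
move=> bE laL muL V0 Vn.
case: (boolP [forall r : 'I_n, interlaced L (row_part (V (widen_ord (leqnSn n) r)))
                            (row_part (V (lift ord0 r)))]) => [/forallP il|]; last first.
  rewrite negb_forall => /existsP[r nil]; rewrite [RHS](bigD1 r) //= row_weight0 // mul0r.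
  apply: big1 => a _; rewrite [X in _ * X]big1 ?mulr0 // => h /andP[_ h0].
  apply/eqP; apply: contraNT nil => /(grid_det h0)/(_ r)[]//.
have L0 : (0 < L)%N by apply: leq_ltn_trans laL.
have upb r c : (nth 0%N (row_part (V (widen_ord (leqnSn n) r))) c < b.+1)%N.
  apply: leq_ltn_trans (up_le L0 il r c) _; rewrite (_ : inord 0 = ord0).
    by rewrite V0 nth_pad ?(ltnW laL) // -bE.
  by apply/val_inj; rewrite /= inordK.
(* By conservation, the horizontal labels are the differences of the parts of
   consecutive rows, so that the sum over a and h has a single term. *)
pose hs := [ffun p : 'I_n * 'I_L.+1 => inord
  (nth 0%N (row_part (V (widen_ord (leqnSn n) p.1))) p.2
   - nth 0%N (row_part (V (lift ord0 p.1))) p.2)%N : 'I_b.+1].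
have hsE r c : hs (r, c) = (nth 0%N (row_part (V (widen_ord (leqnSn n) r))) c
   - nth 0%N (row_part (V (lift ord0 r))) c)%N :> nat.
  by rewrite ffunE /= inordK //; apply: leq_ltn_trans (leq_subr _ _) (upb r c).
pose as_ := [ffun r => hs (r, ord0)].
rewrite (bigD1 as_) /=; last first.
  (* The constraint on a holds because its entries are the differences of consecutive first parts,
     whose sum telescopes. *)
  have T := hd_telescope L0 il.
  rewrite (_ : part mu 1 = nth 0%N (row_part (V (inord n))) 0); last first.
    rewrite (_ : inord n = ord_max) ?Vn ?nth_pad ?(ltnW muL) //.
    by apply/val_inj; rewrite /= inordK.
  rewrite (_ : part la 1 = nth 0%N (row_part (V (inord 0))) 0); last first.
    rewrite (_ : inord 0 = ord0) ?V0 ?nth_pad ?(ltnW laL) //.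
    by apply/val_inj; rewrite /= inordK.
  rewrite -T; apply/eqP; congr (_ + _)%N; apply: eq_bigr => r _.
  by rewrite [as_ r]ffunE hsE -hd_up -hd_lo.
rewrite [X in _ + X]big1 ?addr0 => [|a /andP[_ ne]]; last first.
  rewrite [X in _ * X]big1 ?mulr0 // => h /andP[/forallP ha h0]; apply/eqP.
  apply: contraNT ne => /(grid_det h0) H; apply/eqP/ffunP => r; apply/val_inj => /=.
  by rewrite -(eqP (ha r)) [as_ r]ffunE hsE; case: (H r) => _ ->.
rewrite (bigD1 hs) /=; last first.
  apply/andP; split; apply/forallP => r; first by rewrite [as_ r]ffunE.
  by rewrite hsE !row_part_L.
rewrite [X in _ + X]big1 ?addr0 => [|h /andP[/andP[_ h0] ne]]; last first.
  apply/eqP; apply: contraNT ne => /(grid_det h0) H.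
  apply/eqP/ffunP => -[r c]; apply/val_inj => /=.
  by rewrite hsE; case: (H r) => _ ->.
rewrite /gridW -big_split /=; apply: eq_bigr => r _.
rewrite /row_weight il; congr (Aw _ _ * _); first by rewrite [as_ r]ffunE hsE.
apply: eq_bigr => c _; rewrite !hsE /= /bump /= add1n.
by congr (Wweight _ _ _ _ _ _ _); rewrite row_part_rec addnK.
Qed.


Lemma eq_pathsum (T : finType) k (w w' : nat -> T -> T -> E) (e : pred T) x :
  (forall r y z, w r y z = w' r y z) -> pathsum k w e x = pathsum k w' e x.
Proof.
elim: k w w' x => //= k IH w w' x ww; apply: eq_bigr => z _; rewrite ww.
by congr (_ * _); apply: IH.
Qed.

Lemma pathsum_chain (L b i k : nat) (pmu : seq nat) (x : {ffun 'I_L -> 'I_b}) :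
  all (fun y => y < b)%N (row_part x) ->
  pathsum k (fun r y z => row_weight (i + r) L (row_part y) (row_part z))
    (fun z => row_part z == pmu) x
  = chain row_weight L b (iota i k) (row_part x) pmu.
Proof.
elim: k i x => [|k IH] i x xb //=.
have sup l : size l = L -> interlaced L (row_part x) l ->
    sorted geq l && all (fun y => y < b)%N l.
  move=> sl il; have -> /= : sorted geq l.
    by apply: (@interlaced_sortedr (row_part x)); rewrite sl.
  apply/all_ltP => c; rewrite sl => cl; move/interlacedP: il => /(_ c cl)[h _].
  apply: leq_ltn_trans h _; move/all_ltP: xb; apply.
  by rewrite size_mkseq.
rewrite -(@big_row_part L b _ (fun l => row_weight i L (row_part x) l
    * chain row_weight L b (iota i.+1 k) l pmu)); last first.
  move=> l sl nok; rewrite row_weight0 ?mul0r //; apply: contra nok; exact: sup.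
apply: eq_bigr => z _; rewrite addn0.
case: (boolP (interlaced L (row_part x) (row_part z))) => [il|nil]; last first.
  by rewrite row_weight0 ?mul0r.
congr (_ * _); rewrite -IH; last by case/andP: (sup _ (size_mkseq _ _) il).
by apply: eq_pathsum => r y t; rewrite addnS.
Qed.

(** With the vertical labels fixed, the sum over a and h collapses to a product over the rows; what
    remains is a sum over paths of partitions. *)
Lemma ZW_chain (kappa : 'I_n -> E) (Xi S : nat -> E) (tau : nat -> nat -> E)
    (la mu : intpart) :
  (forall (r : 'I_n) c,
     t2 r c = Xi (r.+1 + c.+1)%N * S (r.+1 + c.+1)%N / kappa r) ->
  (forall r c, s2 r c = tau r.+1 c.+1 ^+ 2) ->
  let L := (maxn (plen la) (plen mu)).+1 in
  \sum_(a : {ffun 'I_n -> 'I_(part la 1).+1}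
        | ((\sum_(i < n) a i) + part mu 1 == part la 1)%N)
    (\prod_(i < n) Aw i (a i)) * ZW q kappa Xi S tau la mu (fun i => a i)
  = chain row_weight L (part la 1).+1 (iota 0 n) (pad L la) (pad L mu).
Proof.
move=> t2E s2E L; set b := part la 1.
have laL : (plen la < L)%N by rewrite ltnS leq_maxl.
have muL : (plen mu < L)%N by rewrite ltnS leq_maxr.
have plab : all (fun y => y < b.+1)%N (pad L la).
  apply/all_ltP => c _; rewrite nth_pad ?(ltnW laL) // ltnS.
  rewrite /b /part /=; elim: c => // c IH.
  exact: leq_trans (intpart_sorted la c) IH.
transitivity (\sum_(V : {ffun 'I_n.+1 -> {ffun 'I_L -> 'I_b.+1}}
   | (row_part (V ord0) == pad L la) && (row_part (V ord_max) == pad L mu))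
  \prod_(r < n) row_weight (0 + r) L (row_part (V (widen_ord (leqnSn n) r)))
                            (row_part (V (lift ord0 r)))).
  rewrite /ZW -/b; under eq_bigr => a _ do rewrite big_ffun_curry mulr_sumr.
  rewrite exchange_big [RHS]big_mkcond /=; apply: eq_bigr => V _.
  set v := [ffun p => V p.1 p.2].
  have bdE (a : {ffun 'I_n -> 'I_b.+1}) (h : {ffun 'I_n * 'I_L.+1 -> 'I_b.+1}) :
      ZWboundary la mu (fun i => a i) v h = [&& row_part (V ord0) == pad L la,
        row_part (V ord_max) == pad L mu,
        [forall r : 'I_n, h (r, ord0) == a r :> nat] &
        [forall r : 'I_n, h (r, ord_max) == 0%N :> nat]].
    rewrite /ZWboundary -!row_part_conj ?(ltnW laL) ?(ltnW muL) //.
    by congr [&& _, _, _ & _]; apply: eq_forallb => c; rewrite ffunE.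
  have wE h : ZWweight q kappa Xi S tau v h = gridW V h.
    apply: eq_bigr => r _; apply: eq_bigr => c _.
    by rewrite !ffunE t2E s2E.
  case: ifP => [/andP[/eqP V0 /eqP Vn]|bd].
    rewrite -(grid_inner (erefl b) laL muL V0 Vn).
    apply: eq_bigr => a _; congr (_ * _); apply: eq_big => h.
      by rewrite bdE V0 Vn !eqxx.
    by rewrite wE.
  apply: big1 => a _; rewrite [X in _ * X]big_pred0 ?mulr0 // => h.
  by rewrite bdE andbA bd.
rewrite (@pathsumE _ _ n (fun r y z => row_weight (0 + r) L (row_part y) (row_part z))
   (fun z => row_part z == pad L la) (fun z => row_part z == pad L mu)).
have [||z0 z0E] := @row_part_surj L b.+1 (pad L la).
- by rewrite mem_boxes size_pad eqxx.
- apply/(sortedP 0%N) => i _; rewrite !nth_pad ?(ltnW laL) //.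
  exact: intpart_sorted.
rewrite (big_pred1 z0) => [|z]; last by rewrite -z0E (inj_eq (@row_part_inj _ _)).
by rewrite pathsum_chain z0E.
Qed.

End Grid.

Lemma prod_wide (R : pzRingType) n L (F : nat -> R) : (n <= L)%N ->
  (forall c, (n <= c)%N -> F c = 1) ->
  \prod_(1 <= i < n.+1) F i.-1 = \prod_(c < L) F c.
Proof.
move=> nL F1; rewrite big_add1 /= -(big_mkord xpredT F).
rewrite [RHS](big_cat_nat (n := n)) //= [X in _ * X]big_nat [X in _ * X]big1 ?mulr1 //.
by move=> c /andP[nc _]; apply: F1.
Qed.

Lemma interlaced_le N la mu c : interlaced N la mu -> size la = N -> size mu = N ->
  (nth 0%N mu c <= nth 0%N la c)%N.
Proof.
move=> /interlacedP il sla smu; case: (ltnP c N) => cN; first by have [] := il c cN.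
by rewrite !nth_default ?sla ?smu.
Qed.

(** * Gauge factors between lattice weights and kernels *)

Section Gauge.
Variables (E : fieldType) (q : E).
Hypothesis qP : forall n, 1 - q ^+ n.+1 != 0.

(** The factors at intermediate partitions cancel in pairs. The gauge may depend on the step, since
    the parameters of F shift from row to row. *)
Lemma chain_gauge (K K' : nat -> nat -> seq nat -> seq nat -> E)
    (g : nat -> seq nat -> E) L B i k la mu :
  (forall p la, size la = L -> g p la != 0) ->
  (forall p la rho, size la = L -> size rho = L ->
     K' p L la rho = g p la * K p L la rho / g p.+1 rho) ->
  size la = L ->
  chain K' L B (iota i k) la mu
    = g i la * chain K L B (iota i k) la mu / g (i + k)%N mu.
Proof.
move=> g0 KK; elim: k i la => [|k IH] i la sla /=.
  rewrite addn0; case: (eqVneq la mu) => [<-|_]; last by rewrite mulr0 mul0r.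
  by rewrite mulr1 divff // g0.
rewrite mulr_sumr mulr_suml; apply: eq_big_seq => rho.
rewrite mem_boxes => /andP[/eqP srho _]; rewrite KK // IH // addnS addSn.
have H := g0 i.+1 rho srho; set x := (g (i + k).+1 mu)^-1.
by field.
Qed.

(** The vertex weight is shared by two columns: i - l = r - l' gives [wbe] and i = r - r' gives
    [wga], while the middle factor depends only on the right-edge label l' - r' and so belongs to
    the [wal] of the next column. *)
Lemma Wweight_col (t2 s2 : E) l l' r r' : (r <= l)%N -> (l' <= r)%N -> (r' <= l')%N ->
  Wweight q t2 s2 (r - r') (l - r) (l - l') (l' - r')
  = wbe q (s2 / t2) r l'
    * ((s2 / t2) ^+ (l' - r') * (qpoch t2 q (l' - r') / qpoch q q (l' - r')))
    * wga q s2 r r'.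
Proof.
move=> rl lr' rl'; rewrite /Wweight /wbe lr' /wga.
have -> : ((r - r' + (l - r) == l - l' + (l' - r'))%N && (l' - r' <= r - r')%N).
  by apply/andP; split; [apply/eqP|]; lia.
have -> : (r - r' - (l' - r') = r - l')%N by lia.
by rewrite invfM; ring.
Qed.

Lemma wal_qpoch (k b : E) l m : k != 0 -> (m <= l)%N ->
  wal q k b l m = k ^+ (l - m) * (qpoch (b / k) q (l - m) / qpoch q q (l - m)).
Proof.
move=> k0 ml; rewrite /wal ml mulrA; congr (_ / _).
rewrite -[X in k ^+ X]card_ord -prodr_const /qpoch -big_split /=.
by apply: eq_bigr => i _; field.
Qed.

(** It realigns edges with columns: the factor of a_r is the [wal] of column 0, each right-edge
    factor is that of the next column, and the one at index L is 1. *)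
Lemma prod_shift (L : nat) (f : nat -> E) : f L = 1 ->
  f 0%N * \prod_(c < L) f c.+1 = \prod_(c < L) f c.
Proof.
move=> fL; transitivity (\prod_(c < L.+1) f c); first by rewrite big_ord_recl.
by rewrite big_ord_recr /= fL mulr1.
Qed.

Definition cgauge (b : nat -> E) N (la : seq nat) : E :=
  \prod_(c < N) (wga q (b c) (nth 0%N la c) (nth 0%N la c.+1))^-1.

Lemma cS_gauge (S : nat -> E) (la : intpart) L : (plen la <= L)%N ->
  cS q S la = cgauge (fun c => S c.+1 ^+ 2) L (pad L la).
Proof.
move=> laL; pose F c := (wga q (S c.+1 ^+ 2) (nth 0%N la c) (nth 0%N la c.+1))^-1.
transitivity (\prod_(c < L) F c); last first.
  by apply: eq_bigr => c _; rewrite !nth_pad.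
rewrite -(prod_wide laL) => [|c cl].
  rewrite /cS !big_add1 /=; apply: eq_bigr => c _.
  by rewrite /F /wga /part /= invf_div.
by rewrite /F !nth_default ?leqW // /wga subnn /qpoch !big_ord0 divr1 invr1.
Qed.

Lemma negpow_wide (S : nat -> E) (la : intpart) L : (plen la <= L)%N ->
  negpow S la = \prod_(c < L) (- S c) ^+ nth 0%N (pad L la) c.
Proof.
move=> laL; pose F c := (- S c) ^+ nth 0%N la c.
transitivity (\prod_(c < L) F c); last first.
  by apply: eq_bigr => c _; rewrite nth_pad.
rewrite -(prod_wide laL) => [|c cl]; last by rewrite /F nth_default.
by rewrite /negpow !big_add1.
Qed.

Variables (n : nat) (kappa : 'I_n -> E) (S : nat -> E).
Hypothesis kappa0 : forall i, kappa i != 0.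
Hypothesis S0 : forall i, S i != 0.
Let b c := S c.+1 ^+ 2.
Hypothesis bP : forall c i, qpoch (b c) q i != 0.
(** The variables extended to all naturals; the default 1 keeps every value nonzero, as the gauge
    relation is stated for all rows. *)
Let kap r := nth 1 [seq kappa i | i <- enum 'I_n] r.

Lemma kapE (r : 'I_n) : kap r = kappa r.
Proof.
by rewrite /kap (nth_map r) ?size_enum_ord // nth_ord_enum.
Qed.

Lemma kap0 r : kap r != 0.
Proof.
case: (ltnP r n) => rn; first by rewrite -[r]/(nat_of_ord (Ordinal rn)) kapE.
by rewrite /kap nth_default ?oner_neq0 // size_map size_enum_ord.
Qed.

Lemma cgauge_neq0 (b' : nat -> E) N la :
  (forall c i, qpoch (b' c) q i != 0) -> cgauge b' N la != 0.
Proof.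
move=> b'P; apply/prodf_neq0 => c _; rewrite invr_eq0 /wga mulf_neq0 ?invr_eq0 //.
exact: qpoch_qq.
Qed.

Lemma mkseq_kap : [seq kap r | r <- iota 0 n] = [seq kappa i | i <- enum 'I_n].
Proof.
by rewrite -[RHS](mkseq_nth 1) size_map size_enum_ord.
Qed.

Lemma Fchain_iota L B i k la mu :
  chain (fun r N => Fker q (kap r) (fun c => b (r + c)%N) N) L B (iota i k) la mu
  = Fchain q L B [seq kap r | r <- iota i k] (fun c => b (i + c)%N) la mu.
Proof.
rewrite /Fchain; elim: k i la => [|k IH] i la //=.
apply: eq_bigr => rho _; rewrite IH; congr (_ * chain _ _ _ (Fparams _ _) _ _).
by apply/funext => c; rewrite addnS.
Qed.

Lemma Gchain_iota L B i k la mu :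
  chain (fun r N => Gker q (kap r) b N) L B (iota i k) la mu
  = Gchain q L B [seq kap r | r <- iota i k] b la mu.
Proof.
by rewrite /Gchain; elim: k i la => [|k IH] i la //=; apply: eq_bigr => rho _; rewrite IH.
Qed.

Let AwF r a := (kap r * S 0%N / S 0%N) ^+ a
   * (qpoch ((kap r)^-1 * S r.+1 * S r.+1) q a / qpoch q q a).
Let t2F r c := S (r.+1 + c.+1)%N * S (r.+1 + c.+1)%N / kap r.
Let s2F r c := tau_self S r.+1 c.+1 ^+ 2.

(** With Xi = S one has s^2 / t^2 = kappa. The row weight contains [wga] of the lower partition with
    shifted parameters, the kernel that of the upper one. Conjugation by [cgauge] exchanges them,
    and the factors c_S in F then cancel the gauge at the two ends. *)
Lemma row_weight_F r L la rho : size la = L -> size rho = L ->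
  row_weight q AwF t2F s2F r L la rho
  = cgauge (fun c => b (r + c)%N) L la * Fker q (kap r) (fun c => b (r + c)%N) L la rho
    / cgauge (fun c => b (r.+1 + c)%N) L rho.
Proof.
move=> sla srho; rewrite /row_weight; case: (boolP (interlaced L la rho)) => [il|nil]; last first.
  by rewrite Fker_eq0 // mulr0 mul0r.
have k0 := kap0 r.
pose f c := wal q (kap r) (b (r + c)) (nth 0%N la c) (nth 0%N rho c).
have fL : f L = 1 by rewrite /f !nth_default ?sla ?srho // wal_nn.
transitivity ((\prod_(c < L) f c) * \prod_(c < L)
   (wbe q (kap r) (nth 0%N rho c) (nth 0%N la c.+1)
    * wga q (b (r.+1 + c)) (nth 0%N rho c) (nth 0%N rho c.+1))).
  rewrite -(prod_shift fL) -[RHS]mulrA -big_split /=; congr (_ * _).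
    by rewrite /AwF /f wal_qpoch ?(interlaced_le _ il) // mulfK // addn0 /b expr2
      [_ / kap r]mulrC [(kap r)^-1 * (_ * _)]mulrA.
  apply: eq_bigr => c _; have [h1 h2] := elimT (interlacedP _ _ _) il c (ltn_ord c).
  rewrite Wweight_col ?(interlaced_le _ il) //.
  have -> : s2F r c = b (r.+1 + c).
    by rewrite /s2F /tau_self /seq_shift /b addnC addnS.
  have -> : t2F r c = b (r.+1 + c) / kap r by rewrite /t2F /b addnS expr2.
  have -> : b (r.+1 + c) / (b (r.+1 + c) / kap r) = kap r.
    by rewrite invf_div mulrCA divff ?mulr1 // /b expf_neq0.
  rewrite /f wal_qpoch ?(interlaced_le _ il) // addnS.
  by rewrite -mulrA mulrCA.
rewrite [X in _ * X = _]big_split /= /Fker [X in _ = _ * X / _]big_split /=.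
rewrite [X in _ = _ * (X * _) / _]big_split /= /cgauge !prodfV invrK.
have H c : wga q (b (r + c)) (nth 0%N la c) (nth 0%N la c.+1) != 0.
  by rewrite /wga mulf_neq0 ?invr_eq0 // qpoch_qq.
set X := \prod_(c < L) wga q (b (r + c)) _ _.
have X0 : X != 0 by apply/prodf_neq0.
by rewrite -!mulrA mulKf.
Qed.

Lemma bbF_chain (la mu : intpart) (L := (maxn (plen la) (plen mu)).+1) :
  bbF q kappa S S (tau_self S) la mu =
  negpow (seq_shift n S) mu / negpow S la
  * Fchain q L (part la 1).+1 [seq kappa i | i <- enum 'I_n] b (pad L la) (pad L mu).
Proof.
have laL : (plen la <= L)%N by rewrite leqW // leq_maxl.
have muL : (plen mu <= L)%N by rewrite leqW // leq_maxr.
rewrite /bbF; set pre := negpow _ _ / _; rewrite -mulrA; congr (_ * _).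
have -> : \sum_(a : {ffun 'I_n -> 'I_(part la 1).+1}
            | ((\sum_(i < n) a i) + part mu 1 == part la 1)%N)
      (\prod_(i < n) ((kappa i * S 0%N / S 0%N) ^+ a i
         * (qpoch ((kappa i)^-1 * S i.+1 * S i.+1) q (a i)
            / qpoch q q (a i)))) * ZW q kappa S S (tau_self S) la mu (fun i => a i)
   = chain (row_weight q AwF t2F s2F) L (part la 1).+1 (iota 0 n) (pad L la) (pad L mu).
  rewrite -(@ZW_chain _ q n AwF t2F s2F kappa S S (tau_self S)) //; last first.
    by move=> r c; rewrite /t2F kapE.
  by apply: eq_bigr => a _; congr (_ * _); apply: eq_bigr => r _; rewrite /AwF kapE.
rewrite (chain_gauge (K := fun r N => Fker q (kap r) (fun c => b (r + c)%N) N)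
   (g := fun r => cgauge (fun c => b (r + c)%N) L)); last 3 first.
- by move=> p l _; apply: cgauge_neq0 => c i; apply: bP.
- by move=> p l r sl sr; rewrite row_weight_F.
- by rewrite size_pad.
rewrite Fchain_iota mkseq_kap (cS_gauge S laL) (cS_gauge _ muL).
have H1 : cgauge (fun c => S c.+1 ^+ 2) L (pad L la) != 0.
  by apply: cgauge_neq0; apply: bP.
have -> : (fun c => tau_self S n c.+1 ^+ 2) = (fun c => b (0 + n + c)).
  by apply/funext => c; rewrite /tau_self /seq_shift /b addnC addnS.
have H2 : cgauge (fun c => b (0 + n + c)) L (pad L mu) != 0.
  by apply: cgauge_neq0 => c i; apply: bP.
rewrite -/b; set x := cgauge _ _ (pad L mu) in H2 *.
rewrite -/(cgauge b L (pad L la)); set y := cgauge b _ (pad L la) in H1 *.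
set z := Fchain _ _ _ _ _ _ _.
by field; rewrite H1 H2.
Qed.

Variable Xi : nat -> E.
Hypothesis XiS : forall i, Xi i * S i = 1.

Lemma XiE i : Xi i = (S i)^-1.
Proof. by apply: (mulIf (S0 i)); rewrite XiS mulVf. Qed.

Let AwG r a := (kap r * S 0%N / Xi 0%N) ^+ a
   * (qpoch ((kap r)^-1 * S r.+1 * Xi r.+1) q a / qpoch q q a).
Let t2G r c := Xi (r.+1 + c.+1)%N * S (r.+1 + c.+1)%N / kap r.
Let s2G (r c : nat) := tau_inv S r.+1 c.+1 ^+ 2.

(** This is the square of (-S)^la. It arises since t^2 = 1 / kappa turns (s^2 / t^2)^l into (s^2
    kappa)^l, while [wal] has only kappa^l. The square reverses the prefactor (-S)^mu / (-S)^la of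
    the definition. *)
Definition ggauge N (la : seq nat) : E := \prod_(c < N) (S c ^+ 2) ^+ nth 0%N la c.

Lemma ggauge_neq0 N la : ggauge N la != 0.
Proof. by apply/prodf_neq0 => c _; rewrite !expf_neq0. Qed.

Lemma row_weight_G r L la rho : size la = L -> size rho = L ->
  row_weight q AwG t2G s2G r L la rho
  = ggauge L la * Gker q (kap r) b L la rho / ggauge L rho.
Proof.
move=> sla srho; rewrite /row_weight; case: (boolP (interlaced L la rho)) => [il|nil]; last first.
  by rewrite Gker_eq0 // mulr0 mul0r.
have k0 := kap0 r.
pose f c := (S c ^+ 2) ^+ (nth 0%N la c - nth 0%N rho c)
            * wal q (kap r) 1 (nth 0%N la c) (nth 0%N rho c).
have fL : f L = 1 by rewrite /f !nth_default ?sla ?srho // wal_nn mulr1.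
transitivity ((\prod_(c < L) f c) * \prod_(c < L)
   (wbe q (b c * kap r) (nth 0%N rho c) (nth 0%N la c.+1)
    * wga q (b c) (nth 0%N rho c) (nth 0%N rho c.+1))).
  rewrite -(prod_shift fL) -[RHS]mulrA -big_split /=; congr (_ * _).
    have -> : AwG r (nth 0%N la 0%N - nth 0%N rho 0%N) = (S 0%N ^+ 2 * kap r)
        ^+ (nth 0%N la 0%N - nth 0%N rho 0%N) * (qpoch (1 / kap r) q
        (nth 0%N la 0%N - nth 0%N rho 0%N) / qpoch q q (nth 0%N la 0%N - nth 0%N rho 0%N)).
      rewrite /AwG -[_ * S r.+1 * _]mulrA [S r.+1 * _]mulrC XiS mulr1 mul1r.
      by rewrite XiE invrK -[_ * S _ * S _]mulrA -expr2 [kap r * _]mulrC.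
    by rewrite /f wal_qpoch ?(interlaced_le _ il) // exprMn -mulrA.
  apply: eq_bigr => c _; have [h1 h2] := elimT (interlacedP _ _ _) il c (ltn_ord c).
  rewrite Wweight_col ?(interlaced_le _ il) // -[s2G r c]/(b c).
  have -> : t2G r c = 1 / kap r by rewrite /t2G XiS.
  have -> : b c / (1 / kap r) = b c * kap r by rewrite mul1r invrK.
  rewrite /f wal_qpoch ?(interlaced_le _ il) // exprMn.
  by rewrite -/(b c); ring.
rewrite !big_split /= /Gker /ggauge !big_split /=.
have -> : \prod_(c < L) (S c ^+ 2) ^+ nth 0%N la c
  = (\prod_(c < L) (S c ^+ 2) ^+ (nth 0%N la c - nth 0%N rho c))
    * \prod_(c < L) (S c ^+ 2) ^+ nth 0%N rho c.
  rewrite -big_split /=; apply: eq_bigr => c _.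
  by rewrite -exprD subnK // (interlaced_le _ il).
have H := ggauge_neq0 L rho; rewrite /ggauge in H.
set x := \prod_(c < L) _ ^+ nth 0%N rho c in H *.
set y := \prod_(c < L) _ ^+ (_ - _).
rewrite -!mulrA [x * _]mulrC -!mulrA mulVf ?mulr1 //.
by ring.
Qed.

Lemma bbFstar_chain (la mu : intpart) (L := (maxn (plen la) (plen mu)).+1) :
  bbFstar q kappa Xi S (tau_inv S) la mu =
  negpow S la / negpow S mu
  * Gchain q L (part la 1).+1 [seq kappa i | i <- enum 'I_n] b (pad L la) (pad L mu).
Proof.
have laL : (plen la <= L)%N by rewrite leqW // leq_maxl.
have muL : (plen mu <= L)%N by rewrite leqW // leq_maxr.
rewrite /bbFstar /bbF.
have -> : \sum_(a : {ffun 'I_n -> 'I_(part la 1).+1}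
            | ((\sum_(i < n) a i) + part mu 1 == part la 1)%N)
      (\prod_(i < n) ((kappa i * S 0%N / Xi 0%N) ^+ a i
         * (qpoch ((kappa i)^-1 * S i.+1 * Xi i.+1) q (a i)
            / qpoch q q (a i)))) * ZW q kappa Xi S (tau_inv S) la mu (fun i => a i)
   = chain (row_weight q AwG t2G s2G) L (part la 1).+1 (iota 0 n) (pad L la) (pad L mu).
  rewrite -(@ZW_chain _ q n AwG t2G s2G kappa Xi S (tau_inv S)) //; last first.
    by move=> r c; rewrite /t2G kapE.
  by apply: eq_bigr => a _; congr (_ * _); apply: eq_bigr => r _; rewrite /AwG kapE.
rewrite (chain_gauge (K := fun r N => Gker q (kap r) b N) (g := fun r => ggauge L));
  last 3 first.
- by move=> p l _; apply: ggauge_neq0.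
- by move=> p l r sl sr; rewrite row_weight_G.
- by rewrite size_pad.
rewrite Gchain_iota mkseq_kap -[tau_inv S n]/S.
have gE (l : intpart) : (plen l <= L)%N -> ggauge L (pad L l) = negpow S l ^+ 2.
  move=> lL; rewrite (negpow_wide S lL) -prodrXl; apply: eq_bigr => c _.
  by rewrite -(sqrrN (S c)) -!exprM mulnC.
have n0 (l : intpart) : negpow S l != 0.
  by rewrite (negpow_wide S (leqnn (plen l))); apply/prodf_neq0 => c _; rewrite expf_neq0 // oppr_eq0.
have c0 (l : intpart) : (plen l <= L)%N -> cS q S l != 0.
  by move=> lL; rewrite (cS_gauge S lL); apply: cgauge_neq0; apply: bP.
rewrite !gE //; set z := Gchain _ _ _ _ _ _ _.
by field; rewrite !n0 !c0.
Qed.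

End Gauge.

(** * Convergence *)

Section Orders.
Variables (k : nat) (K : fieldType).
Implicit Types (f g : mfps k K).

Lemma ser_ord_le d e f : (e <= d)%N -> ser_ord d f -> ser_ord e f.
Proof. by move=> ed H m me; apply: H; apply: leq_trans ed. Qed.

Lemma ser_ordB d f g : ser_ord d f -> ser_ord d g -> ser_ord d (f - g).
Proof. by move=> F G m md; rewrite sercoefD sercoefN F // G // subr0. Qed.

Lemma ser_ordMl d f g : ser_ord d g -> ser_ord d (f * g).
Proof. by move=> G; rewrite -[d]add0n; apply: ser_ordM. Qed.

Lemma ser_ordMr d f g : ser_ord d f -> ser_ord d (f * g).
Proof. by move=> F; rewrite mulrC; apply: ser_ordMl. Qed.

Lemma ser_ord_sum d I (r : seq I) (P : pred I) (F : I -> mfps k K) :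
  (forall i, P i -> ser_ord d (F i)) -> ser_ord d (\sum_(i <- r | P i) F i).
Proof. by move=> H m md; rewrite sercoef_sum big1 // => i Pi; apply: H. Qed.

Lemma ser_ord_eq0 f : (forall d, ser_ord d f) -> f = 0.
Proof. by move=> H; apply: mfpsP => m; rewrite (H _ m (ltnSn _)) sercoef0. Qed.

Lemma ser_ord1 f : sercoef f 0%MM = 0 -> ser_ord 1 f.
Proof. by move=> f0 m; rewrite ltnS leqn0 mdeg_eq0 => /eqP ->. Qed.

Variable q : mfps k K.
Hypothesis q0 : sercoef q 0%MM = 0.

Lemma qpoch_unit x n : sercoef x 0%MM != 1 -> qpoch x q n \is a GRing.unit.
Proof.
move=> x1; elim: n => [|n IH]; first by rewrite /qpoch big_ord0 unitr1.
rewrite qpochS unitrM IH ser_unitE sercoefD sercoefN sercoef1 eqxx sercoef0M.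
case: n {IH} => [|n]; first by rewrite expr0 sercoef1 eqxx mulr1 subr_eq0 eq_sym.
by rewrite exprS sercoef0M q0 mul0r mulr0 subr0 oner_neq0.
Qed.

Lemma qpoch_qq_unit n : qpoch q q n \is a GRing.unit.
Proof. by apply: qpoch_unit; rewrite q0 eq_sym oner_neq0. Qed.

(** Each factor x - b q^i with i > 0 has no constant term; the factor i = 0 may have one, hence the
    predecessor. *)
Lemma wal_ord x b l m : sercoef x 0%MM = 0 -> ser_ord (l - m).-1 (wal q x b l m).
Proof.
move=> x0; rewrite /wal; case: ifP => _; last by move=> u _; rewrite sercoef0.
apply: ser_ordMr; case: (l - m)%N => [|d] //=.
rewrite big_ord_recl; apply: ser_ordMl; elim: d => [|d IH]; first by rewrite big_ord0.
rewrite big_ord_recr /= -addn1; apply: ser_ordM => //.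
apply: ser_ord1; rewrite sercoefD sercoefN x0 sercoef0M /bump /= exprS.
by rewrite sercoef0M q0 mul0r mulr0 subr0.
Qed.

(** The first column alone gives this bound, with one order lost per variable. It is the reason why
    the sum over lambda on the left converges. *)
Lemma Fchain_ord N B xs b la mu : (forall x, x \in xs -> sercoef x 0%MM = 0) ->
  ser_ord (nth 0%N la 0%N - nth 0%N mu 0%N - size xs) (Fchain q N.+1 B xs b la mu).
Proof.
rewrite /Fchain; elim: xs b la => [|x xs IH] b la x0 /=.
  case: eqP => [->|_]; first by rewrite subnn.
  by move=> u _; rewrite sercoef0.
apply: ser_ord_sum => rho _.
apply: (@ser_ord_le ((nth 0%N la 0%N - nth 0%N rho 0%N).-1
   + (nth 0%N rho 0%N - nth 0%N mu 0%N - size xs))%N).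
  by move: (nth _ la _) (nth _ rho _) (nth _ mu _) (size xs); clear; lia.
apply: ser_ordM; last first.
  by apply: IH => y yx; apply: x0; rewrite inE yx orbT.
rewrite /Fp /Fker big_ord_recl; apply: ser_ordMr; apply: ser_ordMr.
by apply: ser_ordMl; apply: wal_ord; apply: x0; rewrite inE eqxx.
Qed.

End Orders.

(** * Infinite sums over partitions *)

Section BoxSums.
Variables (k : nat) (K : fieldType) (N D : nat) (term : seq nat -> mfps k K).
Hypothesis term0 : forall l, size l = N.+1 ->
  ~~ (sorted geq l && (nth 0%N l N == 0%N)) -> term l = 0.
Hypothesis term_ord : forall l d, size l = N.+1 -> (D + d <= nth 0%N l 0%N)%N ->
  ser_ord d (term l).

(** Terms whose first part reaches D + (mdeg m).+1 have order above mdeg m, so the box of this size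
    carries the whole coefficient at m. *)
Definition box_sum : mfps k K := MFPS (fun m =>
  \sum_(l <- boxes N.+1 (D + (mdeg m).+1)) sercoef (term l) m).

Lemma term_big B m l : (D + (mdeg m).+1 <= B)%N -> size l = N.+1 ->
  ~~ all (fun x => x < B)%N l -> sercoef (term l) m = 0.
Proof.
move=> DB sl nB; case: (boolP (sorted geq l)) => [srt|nsrt]; last first.
  by rewrite term0 ?sercoef0 // (negbTE nsrt).
apply: (@term_ord l (mdeg m).+1) => //; apply: leq_trans DB _; rewrite leqNgt.
apply: contra nB => lB; apply/allP => x /(allP (sorted_le_head srt)) xl.
exact: leq_ltn_trans lB.
Qed.

Lemma box_sumE B m : (D + (mdeg m).+1 <= B)%N ->
  sercoef box_sum m = \sum_(l <- boxes N.+1 B) sercoef (term l) m.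
Proof.
move=> DB; symmetry; apply: big_boxes_widen => // l.
by rewrite mem_boxes => /andP[/eqP sl _]; apply: term_big.
Qed.

Lemma box_sum_ord B d : (D + d <= B)%N ->
  ser_ord d (box_sum - \sum_(l <- boxes N.+1 B) term l).
Proof.
move=> DB m md; rewrite sercoefD sercoefN sercoef_sum (@box_sumE B) ?subrr //.
by apply: leq_trans DB; rewrite leq_add2l.
Qed.

Definition topart (l : seq nat) : intpart :=
  insubd (@IntPart [::] isT) [seq x <- l | x != 0%N].

Let ok (l : seq nat) := sorted geq l && (nth 0%N l N == 0%N).

Lemma topart_parts l : sorted geq l -> parts (topart l) = [seq x <- l | x != 0%N].
Proof.
move=> srt; rewrite /topart /insubd insubT //= /is_intpart sorted_filter //=.
  by rewrite mem_filter eqxx.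
by move=> x y z /= h1 h2; apply: leq_trans h1.
Qed.

Lemma nth_filter0 l c : sorted geq l -> nth 0%N [seq x <- l | x != 0%N] c = nth 0%N l c.
Proof.
elim: l c => [|x l IH] c //= srt; have srt' := path_sorted srt.
case: x srt => [|x] srt /=; last by case: c => //= c; apply: IH.
have l0 y : y \in l -> y = 0%N.
  move=> yl; have := order_path_min _ srt => /(_ _)/allP/(_ _ yl) /=.
  by rewrite leqn0 => H; apply/eqP; apply: H => a b c' /= h1 h2; apply: leq_trans h1.
have -> : [seq y <- l | y != 0%N] = [::].
  by rewrite -(filter_pred0 l); apply: eq_in_filter => y /l0 ->.
rewrite nth_nil; case: c => //= c; case: (ltnP c (size l)) => cl.
  by rewrite [RHS]l0 ?mem_nth.
by rewrite nth_default.
Qed.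

Lemma topart_pad l : size l = N.+1 -> ok l ->
  pad N.+1 (topart l) = l /\ (plen (topart l) <= N)%N.
Proof.
move=> sl /andP[srt lN]; split.
  apply: (@eq_from_nth _ 0%N); rewrite size_pad ?sl // => i iN.
  by rewrite nth_mkseq // topart_parts // nth_filter0.
rewrite leqNgt; apply/negP => H.
have := mem_nth 0%N H; rewrite [X in nth _ X](topart_parts srt) nth_filter0 //.
rewrite (eqP lN); case: (topart l) => p /= /andP[_ /negP]; exact.
Qed.

Lemma pad_inj (la la' : intpart) : (plen la <= N)%N -> (plen la' <= N)%N ->
  pad N.+1 la = pad N.+1 la' -> la = la'.
Proof.
move=> lN l'N H; apply/val_inj.
have E c : nth 0%N la c = nth 0%N la' c.
  by rewrite -(@nth_pad N.+1 la) ?leqW // H nth_pad // leqW.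
have nz (p p' : intpart) : (forall c, nth 0%N p c = nth 0%N p' c) -> (size p <= size p')%N.
  move=> e; rewrite leqNgt; apply/negP => lt; have := mem_nth 0%N lt.
  rewrite e nth_default //; case: p {e lt} => p /= /andP[_ /negP]; exact.
apply: (@eq_from_nth _ 0%N) => //.
by apply/eqP; rewrite eqn_leq !nz.
Qed.

Lemma box_has_sum (x : intpart -> {fraction mfps k K}) :
  (forall la, x la = tofrac (if (plen la <= N)%N then term (pad N.+1 la) else 0)) ->
  ser_has_sum x box_sum.
Proof.
move=> xE; exists (fun la => if (plen la <= N)%N then term (pad N.+1 la) else 0) => // m.
set B := (D + (mdeg m).+1)%N.
exists [seq topart l | l <- boxes N.+1 B & ok l]; split.
- rewrite map_inj_in_uniq ?filter_uniq ?boxes_uniq // => l l'.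
  rewrite !mem_filter !mem_boxes => /and3P[okl /eqP sl _] /and3P[okl' /eqP sl' _] e.
  by rewrite -(proj1 (topart_pad sl okl)) -(proj1 (topart_pad sl' okl')) e.
- move=> la; case: ifP => [lN la_r|]; last by rewrite sercoef0.
  apply: (@term_big B) => //; first by rewrite size_pad.
  apply: contra la_r => aB; have okl : ok (pad N.+1 la).
    rewrite /ok nth_pad ?leqW // nth_default // andbT.
    apply/(sortedP 0%N) => i _; rewrite !nth_pad ?leqW //; exact: intpart_sorted.
  apply/mapP; exists (pad N.+1 la).
    by rewrite mem_filter okl mem_boxes size_pad eqxx.
  have [e1 e2] := topart_pad (size_pad _ _) okl.
  by apply: pad_inj => //.
rewrite big_map big_filter (@box_sumE B) // (bigID ok) /=.
rewrite [X in _ + X]big1_seq ?addr0; last first.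
  move=> l /andP[nok]; rewrite mem_boxes => /andP[/eqP sl _].
  by rewrite term0 ?sercoef0.
rewrite big_seq_cond [RHS]big_seq_cond; apply: eq_bigr => l /andP[].
rewrite mem_boxes => /andP[/eqP sl _] okl.
by have [-> ->] := topart_pad sl okl.
Qed.

End BoxSums.

(** * The Cauchy identity *)

Section Evaluation.
Variables (K : fieldType) (n m : nat).
Local Notation M := (mfps (n + m + 1) K).
Local Notation q := (var_q K n m).

(** The number i counts the chi already replaced, and the exponents are positive so that degrees do
    not drop. [eval_ord] is continuity: it lets phi pass through infinite products and infinite
    sums. *)
Record chi_eval (e : 'I_m -> nat) (i : nat) (phi : {rmorphism M -> M}) : Prop :=
  ChiEval {
    eval_ord : forall d f, ser_ord d f -> ser_ord d (phi f);
    eval_cst : forall c, phi (ser_cst _ c) = ser_cst _ c;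
    eval_q : phi q = q;
    eval_kappa : forall j, phi (var_kappa K m j) = var_kappa K m j;
    eval_chi : forall j : 'I_m, phi (var_chi K n j) =
      if (j < i)%N then q ^+ (e j).+1 else var_chi K n j }.

Lemma ser_var_neq0 k (i : 'I_k) : ser_var K i != 0.
Proof.
apply/eqP => /(congr1 (fun f => sercoef f U_(i)%MM)) /eqP.
by rewrite sercoef0 /= mcoeffX eqxx oner_eq0.
Qed.

Lemma ser_var_coef0 k (i : 'I_k) : sercoef (ser_var K i) 0%MM = 0.
Proof.
rewrite /= mcoeffX; case: eqP => // /(congr1 (@mdeg _)).
by rewrite mdeg1 mdeg0.
Qed.

(** The exponents are found one at a time, each depending on the series left by the earlier
    substitutions. All of them fix q, so the powers already introduced are not disturbed. *)
Lemma chi_eval_exists (f : M) i : f != 0 -> (i <= m)%N ->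
  exists e, exists2 phi : {rmorphism M -> M}, chi_eval e i phi & phi f != 0.
Proof.
move=> f0; elim: i => [|i IH] im.
  by exists (fun=> 0%N), idfun.
have [e [phi [phiO phiC phiq phik phichi] phif]] := IH (ltnW im).
pose j0 : 'I_m := Ordinal im.
pose i0 : 'I_(n + m + 1) := lshift 1 (rshift n j0).
pose t0 : 'I_(n + m + 1) := rshift (n + m) ord0.
have it : i0 != t0 by rewrite eq_lrshift.
have [d fd] := ser_sub_neq0 it phif.
pose psi : {rmorphism M -> M} := ser_sub i0 t0 d.
exists (fun j => if j == j0 then d else e j), (psi \o phi) => //.
have psiq : psi q = q by rewrite [LHS]ser_sub_var eq_sym (negbTE it).
split=> /=.
- by move=> a g /phiO; apply: ser_sub_ord.
- by move=> c; rewrite phiC [LHS]ser_sub_cst.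
- by rewrite phiq.
- by move=> j; rewrite phik [LHS]ser_sub_var eq_lshift eq_lrshift.
move=> j; rewrite phichi; case: (eqVneq j j0) => [->|jj0].
  have -> : (j0 < i)%N = false by rewrite /= ltnn.
  by rewrite /= ltnSn [LHS]ser_sub_var eqxx.
have ji : (j != i :> nat) by apply: contraNneq jj0 => ji; apply/eqP/val_inj.
rewrite ltnS [(j <= i)%N]leq_eqVlt (negbTE ji) /=; case: ifP => _; first by rewrite rmorphXn psiq.
by rewrite [LHS]ser_sub_var eq_lshift eq_rshift (negbTE jj0).
Qed.

End Evaluation.

Section Independence.
Variables (K : fieldType) (s : nat -> K) (s_indep : alg_independent s).

Lemma indep_neq0 i : s i != 0.
Proof.
have := s_indep (k := i.+1) (p := 'X_ord_max).
rewrite mmapX mmap1U; apply.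
by apply/eqP => /(congr1 (mcoeff U_(ord_max)%MM)) /eqP; rewrite mcoeffX mcoeff0 eqxx.
Qed.

(** It makes the constant term 1 - s_i^2 of (s_i^2; q)_n with n > 0 nonzero, so that the
    denominators of the kernels are invertible power series. *)
Lemma indep_sqr_neq1 i : s i ^+ 2 != 1.
Proof.
have p0 : 'X_ord_max ^+ 2 - 1 != 0 :> {mpoly int[i.+1]}.
  apply/eqP => /(congr1 (mcoeff 0%MM)) /eqP.
  rewrite mcoeffB mcoeff1 mcoeff0 eqxx expr2 -mpolyXD mcoeffX.
  rewrite (_ : (_ + _ == _)%MM = false) ?sub0r //.
  by apply/negbTE/eqP => /(congr1 (@mdeg _)); rewrite mdegD mdeg1 mdeg0.
by have := s_indep p0; rewrite rmorphB rmorphXn rmorph1 /= mmapX mmap1U subr_eq0.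
Qed.

End Independence.

Lemma pad_rcons L l : (size l <= L)%N -> pad L.+1 l = rcons (pad L l) 0%N.
Proof. by move=> lL; rewrite /pad mkseqS nth_default. Qed.

Lemma part_pad_lt N (la : intpart) :
  all (fun x => x < (part la 1).+1)%N (pad N la).
Proof.
apply/all_ltP => c; rewrite size_pad => cN; rewrite nth_mkseq // ltnS /part /=.
by elim: c {cN} => // c IH; apply: leq_trans (intpart_sorted la c) IH.
Qed.

Lemma pad_sorted N (la : intpart) : (plen la <= N)%N -> sorted geq (pad N la).
Proof.
by move=> lN; apply/(sortedP 0%N) => i _; rewrite !nth_pad //=; apply: intpart_sorted.
Qed.

Section ChainPad.
Variables (R : pzRingType) (P : Type) (k : P -> nat -> seq nat -> seq nat -> R).
Hypothesis k0 : forall p N la mu, ~~ interlaced N la mu -> k p N la mu = 0.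
Hypothesis kpad : forall p N la mu, size la = N -> size mu = N ->
  k p N.+1 (rcons la 0%N) (rcons mu 0%N) = k p N la mu.

Lemma chain_pad_le L N B ps la mu : (0 < B)%N -> (size la <= L)%N -> (size mu <= L)%N ->
  (L <= N)%N -> chain k N B ps (pad N la) (pad N mu) = chain k L B ps (pad L la) (pad L mu).
Proof.
move=> B0 laL muL; elim: N => [|N IH]; first by rewrite leqn0 => /eqP ->.
rewrite leq_eqVlt => /orP[/eqP-> //|]; rewrite ltnS => LN.
have laN := leq_trans laL LN; have muN := leq_trans muL LN.
by rewrite !pad_rcons // chain_pad ?size_pad // IH.
Qed.

Lemma chain_sortedr N B ps la mu : chain k N B ps la mu != 0 -> size mu = N ->
  sorted geq la -> sorted geq mu.
Proof.
elim: ps la => [|p ps IH] la H smu.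
  by move: H => /=; case: (eqVneq la mu) => [->|_] //; rewrite eqxx.
case: (chain_neq0 H) => rho [+ /(kernel_neq0 k0) il H2] srt.
rewrite mem_boxes => /andP[/eqP srho _]; apply: IH H2 smu _.
by rewrite -srho in il; apply: interlaced_sortedr il.
Qed.

End ChainPad.

(** * F and F* as power series *)

Section Bridge.
Variables (K : fieldType) (n m : nat) (a : nat -> K).
Hypotheses (a0 : forall i, a i != 0) (a1 : forall i, a i ^+ 2 != 1).
Local Notation M := (mfps (n + m + 1) K).
Local Notation q := (var_q K n m).
Local Notation qF := (tofrac q).
Local Notation sB i := (ser_cst (n + m + 1) (a i)).
Local Notation S := (fun i : nat => tofrac (sB i)).
Local Notation b := (fun c : nat => sB c.+1 ^+ 2).

Lemma q_coef0 : sercoef q 0%MM = 0. Proof. exact: ser_var_coef0. Qed.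

Lemma tofrac_unit (x : M) : x \is a GRing.unit -> tofrac x != 0.
Proof. by move=> xU; rewrite tofrac_eq0; apply: contraTneq xU => ->; rewrite unitr0. Qed.

Lemma sB_unit i : sB i \is a GRing.unit.
Proof. by rewrite ser_unitE ser_cst_coef0. Qed.

Lemma b_coef0 c : sercoef (sB c.+1 ^+ 2) 0%MM != 1.
Proof. by rewrite expr2 sercoef0M ser_cst_coef0 -expr2. Qed.

Lemma b_qpoch_unit c i : qpoch (sB c.+1 ^+ 2) q i \is a GRing.unit.
Proof. by apply: qpoch_unit; [apply: q_coef0 | apply: b_coef0]. Qed.

Lemma qF_neq0 : qF != 0. Proof. by rewrite tofrac_eq0 ser_var_neq0. Qed.

Lemma qF_gen i : 1 - qF ^+ i.+1 != 0.
Proof.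
rewrite -tofracXn -tofrac1 -tofracB; apply: tofrac_unit.
rewrite ser_unitE sercoefD sercoefN sercoef1 eqxx exprS sercoef0M q_coef0 mul0r.
by rewrite subr0 oner_neq0.
Qed.

Lemma S_neq0 i : tofrac (sB i) != 0. Proof. exact/tofrac_unit/sB_unit. Qed.

Lemma bF_qpoch c i : qpoch (tofrac (sB c.+1) ^+ 2) qF i != 0.
Proof.
by rewrite -tofracXn -rmorph_qpoch; apply/tofrac_unit/b_qpoch_unit.
Qed.

Lemma tofrac_b : @tofrac M \o b = (fun c => tofrac (sB c.+1) ^+ 2).
Proof. by apply/funext => c /=; rewrite tofracXn. Qed.

(** The definition of F divides by kappa and lives in the field of fractions; the chain exhibits it
    as a power series times powers of the parameters. Padding with zeros replaces the number of
    columns of the definition by one that suits all partitions. *)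
Lemma bbF_tofrac N (la mu : intpart) : (plen la <= N)%N -> (plen mu <= N)%N ->
  bbF qF (fun i : 'I_n => tofrac (var_kappa K m i)) S S (tau_self S) la mu
  = negpow (seq_shift n S) mu / negpow S la
    * tofrac (Fchain q N.+1 (part la 1).+1 [seq var_kappa K m i | i <- enum 'I_n] b
                (pad N.+1 la) (pad N.+1 mu)).
Proof.
move=> laN muN; rewrite bbF_chain; first last.
- exact: bF_qpoch.
- exact: S_neq0.
- by move=> i; rewrite tofrac_eq0 ser_var_neq0.
- exact: qF_gen.
congr (_ * _); rewrite rmorph_Fchain; [|exact: qpoch_qq_unit q_coef0|exact: b_qpoch_unit].
rewrite tofrac_b -[in RHS]map_comp /Fchain.
rewrite (@chain_pad_le _ _ (@Fp _ qF) (@Fp0 _ qF) (@Fp_pad _ qF) (maxn (plen la) (plen mu)).+1 N.+1) //.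
- by rewrite leqW // leq_maxl.
- by rewrite leqW // leq_maxr.
by rewrite ltnS geq_max laN muN.
Qed.

Lemma bbF_long (la mu : intpart) : (plen mu + n < plen la)%N ->
  bbF qF (fun i : 'I_n => tofrac (var_kappa K m i)) S S (tau_self S) la mu = 0.
Proof.
move=> long; pose N := maxn (plen la) (plen mu).
rewrite (@bbF_tofrac N) ?leq_maxl ?leq_maxr //.
set F := Fchain _ _ _ _ _ _ _.
suff -> : F = 0 by rewrite tofrac0 mulr0.
apply/eqP; apply: contraTT long => F0.
have := chain_length (@Fp0 _ q) (plen mu) F0 (size_pad _ _).
rewrite size_Fparams size_map size_enum_ord !nth_pad ?leqW ?leq_maxl ?leq_maxr //.
rewrite [X in (_ <= X)%N]nth_default // leqn0 -leqNgt leqNgt => H; apply/negP => lt.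
have := mem_nth 0%N lt; rewrite (eqP H); case: (la) => p /= /andP[_ /negP]; exact.
Qed.

Lemma bbF_notin (la mu : intpart) : (plen la < plen mu)%N ->
  bbF qF (fun i : 'I_n => tofrac (var_kappa K m i)) S S (tau_self S) la mu = 0.
Proof.
move=> lt; rewrite (@bbF_tofrac (plen mu)) ?(ltnW lt) //.
set F := Fchain _ _ _ _ _ _ _.
suff -> : F = 0 by rewrite tofrac0 mulr0.
apply/eqP/negPn/negP => F0.
have := chain_le (@Fp0 _ q) F0 (ltnW lt : (plen la < (plen mu).+1)%N).
rewrite !nth_pad ?leqW ?(ltnW lt) // [X in (_ <= X)%N]nth_default // leqn0 => H.
have := mem_nth 0%N lt; rewrite (eqP H); case: (mu) => p /= /andP[_ /negP]; exact.
Qed.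

Lemma bbFstar_tofrac Xi N (la mu : intpart) : (forall i, Xi i * tofrac (sB i) = 1) ->
  (plen la <= N)%N -> (plen mu <= N)%N ->
  bbFstar qF (fun j : 'I_m => tofrac (var_chi K n j)) Xi S (tau_inv S) la mu
  = negpow S la / negpow S mu
    * tofrac (Gchain q N.+1 (part la 1).+1 [seq var_chi K n j | j <- enum 'I_m] b
                (pad N.+1 la) (pad N.+1 mu)).
Proof.
move=> XiS laN muN; rewrite bbFstar_chain //; first last.
- exact: bF_qpoch.
- exact: S_neq0.
- by move=> i; rewrite tofrac_eq0 ser_var_neq0.
- exact: qF_gen.
congr (_ * _); rewrite rmorph_Gchain; [|exact: qpoch_qq_unit q_coef0|exact: b_qpoch_unit].
rewrite tofrac_b -[in RHS]map_comp /Gchain.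
rewrite (@chain_pad_le _ _ (@Gp _ qF) (@Gp0 _ qF) (@Gp_pad _ qF) (maxn (plen la) (plen mu)).+1 N.+1) //.
- by rewrite leqW // leq_maxl.
- by rewrite leqW // leq_maxr.
by rewrite ltnS geq_max laN muN.
Qed.

(** The exchange is proved over a field, so it is applied in the field of fractions and pulled back
    along the injection [tofrac]. *)
Lemma exchange_ser ks js N B mu nu :
  size mu = N.+1 -> size nu = N.+1 -> (size ks <= N)%N ->
  (forall c, N - size ks <= c -> nth 0 mu c = 0)%N ->
  sorted geq nu -> (nth 0 nu 0 + sumn js < B)%N -> all (fun x => x < B)%N mu ->
  \sum_(la <- boxes N.+1 B)
     Fchain q N.+1 B ks b la mu * Gchain q N.+1 B [seq q ^+ j | j <- js] b la nu
  = (\prod_(i < size ks) \prod_(j <- js) (qpoch (nth 0 ks i) q j / qpoch (sB i.+1 ^+ 2) q j))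
    * \sum_(rho <- boxes N.+1 B) Fchain q N.+1 B ks b nu rho
       * Gchain q N.+1 B [seq q ^+ j | j <- js] (fun c => sB (size ks + c).+1 ^+ 2) mu rho.
Proof.
move=> smu snu ksN zmu srt nB muB; apply/eqP; rewrite -tofrac_eq; apply/eqP.
have gen : qgen qF (@tofrac M \o b).
  move=> c i; have := bF_qpoch c i.+1; rewrite qpochS mulf_eq0 negb_or => /andP[_].
  by rewrite /= tofracXn.
have := @exchange_chains _ qF qF_neq0 qF_gen [seq tofrac x | x <- ks] js (@tofrac M \o b) N B mu nu gen.
rewrite size_map => /(_ smu snu ksN zmu srt nB muB).
have qU := qpoch_qq_unit q_coef0.
have mapq : [seq qF ^+ j | j <- js] = [seq tofrac x | x <- [seq q ^+ j | j <- js]].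
  by rewrite -map_comp; apply: eq_map => j /=; rewrite tofracXn.
rewrite rmorph_sum rmorphM rmorph_sum /= => H.
transitivity (\sum_(la <- boxes N.+1 B)
  Fchain qF N.+1 B [seq tofrac x | x <- ks] (@tofrac M \o b) la mu *
  Gchain qF N.+1 B [seq qF ^+ j | j <- js] (@tofrac M \o b) la nu).
  apply: eq_bigr => la _; rewrite tofracM mapq rmorph_Fchain ?rmorph_Gchain //; exact: b_qpoch_unit.
rewrite H; congr (_ * _).
  rewrite rmorph_prod; apply: eq_bigr => i _; rewrite rmorph_prod; apply: eq_bigr => j _.
  rewrite rmorph_div ?b_qpoch_unit // !rmorph_qpoch (nth_map 0) //.
apply: eq_bigr => rho _; rewrite tofracM mapq rmorph_Fchain ?rmorph_Gchain //.
  by move=> c i; apply: (b_qpoch_unit (size ks + c)).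
exact: b_qpoch_unit.
Qed.

End Bridge.

Lemma frac_cancel (R : comUnitRingType) (w x y z : R) :
  x \is a GRing.unit -> y \is a GRing.unit -> z \is a GRing.unit ->
  (w * x * y) / ((z * y) * x) = w / z.
Proof.
move=> xU yU zU; apply: (mulIr (x := z * y * x)); first by rewrite !unitrM zU yU xU.
by rewrite divrK ?unitrM ?zU ?yU ?xU // !mulrA divrK // mulrAC.
Qed.

Section Cauchy.
Variables (K : fieldType) (s : nat -> K) (n m : nat) (mu nu : intpart).
Hypotheses (s0 : forall i, s i != 0) (s1 : forall i, s i ^+ 2 != 1).
Local Notation M := (mfps (n + m + 1) K).
Local Notation q := (var_q K n m).
Local Notation sB i := (ser_cst (n + m + 1) (s i)).
Local Notation b := (fun c : nat => sB c.+1 ^+ 2).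
Local Notation bn := (fun c : nat => sB (n + c).+1 ^+ 2).
Local Notation ks := [seq var_kappa K m i | i <- enum 'I_n].
Local Notation xs := [seq var_chi K n j | j <- enum 'I_m].

(** F adds at most n parts, so every lambda with a nonzero term has at most N parts and entry 0 at
    index N. The summand n also provides the free columns of mu that [exchange_chains] asks for. *)
Let N := (plen mu + plen nu + n)%N.
Let pmu := pad N.+1 mu.
Let pnu := pad N.+1 nu.

Lemma plen_mu : (plen mu <= N)%N. Proof. by rewrite /N -addnA leq_addr. Qed.
Lemma plen_nu : (plen nu <= N)%N. Proof. by rewrite /N addnAC leq_addl. Qed.

Lemma size_ks : size ks = n. Proof. by rewrite size_map size_enum_ord. Qed.

Lemma ks_coef0 x : x \in ks -> sercoef x 0%MM = 0.
Proof. by case/mapP => i _ ->; apply: ser_var_coef0. Qed.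

Variable pre : M.

Definition lhs_term (l : seq nat) : M := pre *
  (Gchain q N.+1 (nth 0%N l 0%N).+1 xs b l pnu
   * Fchain q N.+1 (nth 0%N l 0%N).+1 ks b l pmu).

Definition rhs_term (l : seq nat) : M := pre *
  (Fchain q N.+1 (part nu 1).+1 ks b pnu l
   * Gchain q N.+1 (part mu 1).+1 xs bn pmu l).

Lemma lhs_term0 l : size l = N.+1 ->
  ~~ (sorted geq l && (nth 0%N l N == 0%N)) -> lhs_term l = 0.
Proof.
move=> sl nok; rewrite /lhs_term; set F := Fchain _ _ _ _ _ _ _.
suff -> : F = 0 by rewrite !mulr0.
apply/eqP; apply: contraNT nok => F0.
rewrite (chain_sorted (@Fp0 _ q) F0 sl (pad_sorted _)) ?leqW ?plen_mu //=.
have := chain_length (@Fp0 _ q) (plen mu + plen nu)%N F0 sl.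
rewrite size_Fparams size_ks nth_pad ?leqW ?plen_mu //.
by rewrite [X in (_ <= X)%N]nth_default ?leqn0 // leq_addr.
Qed.

Lemma rhs_term0 l : size l = N.+1 ->
  ~~ (sorted geq l && (nth 0%N l N == 0%N)) -> rhs_term l = 0.
Proof.
move=> sl nok; rewrite /rhs_term; set F := Fchain _ _ _ _ _ _ _.
suff -> : F = 0 by rewrite mul0r mulr0.
apply/eqP; apply: contraNT nok => F0.
rewrite (chain_sortedr (@Fp0 _ q) F0 sl (pad_sorted _)) ?leqW ?plen_nu //=.
have := chain_le (@Fp0 _ q) F0 (ltnSn N).
by rewrite nth_pad ?leqW ?plen_nu // [X in (_ <= X)%N]nth_default ?leqn0 // plen_nu.
Qed.

Lemma nth_pmu0 : nth 0%N pmu 0%N = part mu 1. Proof. by rewrite nth_pad // leqW // plen_mu. Qed.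
Lemma nth_pnu0 : nth 0%N pnu 0%N = part nu 1. Proof. by rewrite nth_pad // leqW // plen_nu. Qed.

Lemma lhs_term_ord l d : size l = N.+1 -> (part mu 1 + n + d <= nth 0%N l 0%N)%N ->
  ser_ord d (lhs_term l).
Proof.
move=> sl dl; apply: ser_ordMl; apply: ser_ordMl.
set F := Fchain _ _ _ _ _ _ _.
have : ser_ord (nth 0%N l 0%N - nth 0%N pmu 0%N - size ks) F.
  by apply: Fchain_ord ks_coef0; apply: q_coef0.
apply: ser_ord_le; rewrite nth_pmu0 size_ks; move: dl; move: (part mu 1) (nth _ l _) n; clear; lia.
Qed.

Lemma rhs_term_ord l d : size l = N.+1 -> ((part nu 1).+1 + d <= nth 0%N l 0%N)%N ->
  ser_ord d (rhs_term l).
Proof.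
move=> sl dl; rewrite /rhs_term; set F := Fchain _ _ _ _ _ _ _.
suff -> : F = 0 by rewrite mul0r mulr0 => u _; rewrite sercoef0.
apply/eqP; apply: contraTT dl => F0.
have := chain_le (@Fp0 _ q) F0 (ltn0Sn N).
by rewrite nth_pnu0 -ltnNge => h; apply: (leq_ltn_trans h); rewrite leq_addr.
Qed.

Lemma lhs_term_widen B l : l \in boxes N.+1 B -> lhs_term l = pre *
  (Gchain q N.+1 B xs b l pnu * Fchain q N.+1 B ks b l pmu).
Proof.
rewrite mem_boxes => /andP[/eqP sl lB]; rewrite /lhs_term.
have l0B : (nth 0%N l 0%N < B)%N by move/all_ltP: lB; apply; rewrite sl.
case: (boolP (sorted geq l)) => [srt|nsrt].
  have lh : all (fun x => x < (nth 0%N l 0%N).+1)%N l by apply: sorted_le_head.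
  have GE := chain_widen (@Gp0 _ q) (Gparams xs b) pnu l0B sl lh.
  have FE := chain_widen (@Fp0 _ q) (Fparams ks b) pmu l0B sl lh.
  by congr (_ * (_ * _)); symmetry; [exact: GE | exact: FE].
have F0 C : Fchain q N.+1 C ks b l pmu = 0.
  apply/eqP; apply: contraNT nsrt => F0.
  by apply: (chain_sorted (@Fp0 _ q) F0 sl); rewrite pad_sorted // leqW // plen_mu.
by rewrite !F0 !mulr0.
Qed.

Lemma rhs_term_widen B l : (part mu 1 < B)%N -> (part nu 1 < B)%N ->
  rhs_term l = pre * (Fchain q N.+1 B ks b pnu l * Gchain q N.+1 B xs bn pmu l).
Proof.
move=> muB nuB.
have FE := chain_widen (@Fp0 _ q) (Fparams ks b) l nuB (size_pad N.+1 nu)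
  (part_pad_lt _ _).
have GE := chain_widen (@Gp0 _ q) (Gparams xs bn) l muB (size_pad N.+1 mu)
  (part_pad_lt _ _).
by congr (_ * (_ * _)); symmetry; [exact: FE | exact: GE].
Qed.

Let P : M := \prod_(i < n) \prod_(j < m)
  ((qpoch_inf (var_kappa K m i) q * qpoch_inf (sB i.+1 ^+ 2 * var_chi K n j) q)
   / (qpoch_inf (sB i.+1 ^+ 2) q * qpoch_inf (var_kappa K m i * var_chi K n j) q)).

Section Eval.
Variables (e : 'I_m -> nat) (phi : {rmorphism M -> M}).
Hypothesis He : chi_eval e m phi.
Let js := [seq (e j).+1 | j <- enum 'I_m].

Lemma phi_b c : phi (sB c ^+ 2) = sB c ^+ 2.
Proof. by rewrite rmorphXn (eval_cst He). Qed.

Lemma phi_chi j : phi (var_chi K n j) = q ^+ (e j).+1.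
Proof. by rewrite (eval_chi He) ltn_ord. Qed.

Lemma phi_F B l mu' : phi (Fchain q N.+1 B ks b l mu') = Fchain q N.+1 B ks b l mu'.
Proof.
rewrite rmorph_Fchain; [|exact: qpoch_qq_unit (q_coef0 K n m)|exact: b_qpoch_unit].
rewrite (eval_q He) -map_comp; congr (Fchain _ _ _ _ _ _ _).
  by apply: eq_map => i /=; rewrite (eval_kappa He).
by apply/funext => c /=; rewrite phi_b.
Qed.

Lemma phi_G d B l mu' : phi (Gchain q N.+1 B xs (fun c => sB (d + c).+1 ^+ 2) l mu')
  = Gchain q N.+1 B [seq q ^+ j | j <- js] (fun c => sB (d + c).+1 ^+ 2) l mu'.
Proof.
rewrite rmorph_Gchain; [|exact: qpoch_qq_unit (q_coef0 K n m)|by move=> c i; apply: b_qpoch_unit].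
rewrite (eval_q He) -!map_comp; congr (Gchain _ _ _ _ _ _ _).
  by apply: eq_map => i /=; rewrite phi_chi.
by apply/funext => c /=; rewrite phi_b.
Qed.

Let cst : M := \prod_(i < size ks) \prod_(j <- js)
  (qpoch (nth 0 ks i) q j / qpoch (sB i.+1 ^+ 2) q j).

Lemma phi_frac (x y z w x' y' z' w' : M) :
  z \is a GRing.unit -> w \is a GRing.unit ->
  phi x = x' -> phi y = y' -> phi z = z' -> phi w = w' ->
  phi ((x * y) / (z * w)) = (x' * y') / (z' * w').
Proof. by move=> zU wU <- <- <- <-; rewrite rmorph_div ?unitrM ?zU // !rmorphM. Qed.

(** At chi = q^j the infinite products become finite: (kappa; q)_oo / (kappa q^j; q)_oo = (kappa;
    q)_j and (s^2 q^j; q)_oo / (s^2; q)_oo = 1 / (s^2; q)_j. *)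
Lemma phi_P : phi P = cst.
Proof.
have qc := q_coef0 K n m.
have kc i : sercoef (var_kappa K m i) 0%MM = 0 by apply: ser_var_coef0.
have bc i : sercoef (sB i.+1 ^+ 2) 0%MM != 1.
  by rewrite expr2 sercoef0M ser_cst_coef0 -expr2.
have U1 i : qpoch_inf (sB i.+1 ^+ 2) q \is a GRing.unit by apply: qpoch_inf_unit.
have U2 i (y : M) : qpoch_inf (var_kappa K m i * y) q \is a GRing.unit.
  by apply: qpoch_inf_unit => //; rewrite sercoef0M kc mul0r eq_sym oner_neq0.
have qX0 j : sercoef (q ^+ j.+1) 0%MM = 0 by rewrite exprS sercoef0M qc mul0r.
have U3 i j : qpoch_inf (sB i.+1 ^+ 2 * q ^+ j.+1) q \is a GRing.unit.
  apply: qpoch_inf_unit => //.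
  by rewrite sercoef0M qX0 mulr0 eq_sym oner_neq0.
have infE x y : phi x = y -> phi (qpoch_inf x q) = qpoch_inf y q.
  by move=> <-; rewrite rmorph_qpoch_inf ?(eval_q He) //; apply: (eval_ord He).
rewrite /cst size_ks /P rmorph_prod; apply: eq_bigr => i _.
rewrite rmorph_prod big_map big_enum; apply: eq_bigr => j _.
have EA : phi (qpoch_inf (var_kappa K m i) q) = qpoch_inf (var_kappa K m i) q.
  exact: infE (eval_kappa He i).
have EB : phi (qpoch_inf (sB i.+1 ^+ 2 * var_chi K n j) q)
        = qpoch_inf (sB i.+1 ^+ 2 * q ^+ (e j).+1) q.
  apply: infE.
  exact: etrans (rmorphM _ _ _) (congr2 *%R (phi_b _) (phi_chi j)).
have EC : phi (qpoch_inf (sB i.+1 ^+ 2) q) = qpoch_inf (sB i.+1 ^+ 2) q.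
  exact: infE (phi_b _).
have ED : phi (qpoch_inf (var_kappa K m i * var_chi K n j) q)
        = qpoch_inf (var_kappa K m i * q ^+ (e j).+1) q.
  apply: infE.
  exact: etrans (rmorphM _ _ _) (congr2 *%R (eval_kappa He i) (phi_chi j)).
apply: etrans (phi_frac (U1 i) (U2 i _) EA EB EC ED) _.
rewrite (nth_map i) ?size_enum_ord // nth_ord_enum.
rewrite (qpoch_inf_split (var_kappa K m i) (e j).+1 qc).
rewrite (qpoch_inf_split (sB i.+1 ^+ 2) (e j).+1 qc).
have V1 := U2 i (q ^+ (e j).+1); have V2 := U3 i (e j).
have V3 : qpoch (sB i.+1 ^+ 2) q (e j).+1 \is a GRing.unit by apply: qpoch_unit.
exact: frac_cancel V1 V2 V3.
Qed.

Lemma phi_sums B : (part nu 1 + sumn js < B)%N -> (part mu 1 < B)%N ->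
  phi (\sum_(l <- boxes N.+1 B) lhs_term l)
  = cst * phi (\sum_(l <- boxes N.+1 B) rhs_term l).
Proof.
move=> nuB muB.
have nuB' : (part nu 1 < B)%N by apply: leq_ltn_trans nuB; apply: leq_addr.
rewrite !rmorph_sum /=.
transitivity (\sum_(l <- boxes N.+1 B) phi pre *
  (Fchain q N.+1 B ks b l pmu * Gchain q N.+1 B [seq q ^+ j | j <- js] b l pnu)).
  apply: eq_big_seq => l lB; rewrite (lhs_term_widen lB) !rmorphM phi_F (phi_G 0).
  by rewrite [Gchain _ _ _ _ _ _ _ * _]mulrC.
rewrite -mulr_sumr exchange_ser //.
- rewrite mulrCA; congr (_ * _); rewrite mulr_sumr; apply: eq_big_seq => l lB.
  rewrite (rhs_term_widen _ muB nuB') !rmorphM phi_F phi_G size_ks.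
  by [].
- by rewrite size_pad.
- by rewrite size_pad.
- by rewrite size_ks /N leq_addl.
- move=> c; rewrite size_ks /N addnK => cN.
  rewrite nth_pad ?leqW ?plen_mu // nth_default //.
  by apply: leq_trans cN; apply: leq_addr.
- by apply: pad_sorted; rewrite leqW // plen_nu.
apply/allP => x /(allP (part_pad_lt _ _)); rewrite ltnS => h.
exact: leq_ltn_trans muB.
Qed.

(** Up to order d both infinite sums may be replaced by finite ones, since phi does not lower the
    order; the finite sums satisfy the identity exactly, and d is arbitrary. *)
Lemma phi_eq0 : phi (box_sum N (part mu 1 + n) lhs_term
                     - P * box_sum N (part nu 1).+1 rhs_term) = 0.
Proof.
apply: ser_ord_eq0 => d.
(* The first two bounds make both truncation errors of order d; the other two are the conditions of
   the finite identity [phi_sums]. *)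
set B := maxn (maxn (part mu 1 + n + d) ((part nu 1).+1 + d))
              (maxn (part nu 1 + sumn js).+1 (part mu 1).+1).
have B1 : (part mu 1 + n + d <= B)%N by rewrite /B !leq_max leqnn.
have B2 : ((part nu 1).+1 + d <= B)%N by rewrite /B !leq_max leqnn orbT.
have B3 : (part nu 1 + sumn js < B)%N by rewrite /B !leq_max leqnn !orbT.
have B4 : (part mu 1 < B)%N by rewrite /B !leq_max leqnn !orbT.
have H1 := eval_ord He (box_sum_ord lhs_term0 lhs_term_ord B1).
have H2 := eval_ord He (box_sum_ord rhs_term0 rhs_term_ord B2).
rewrite rmorphB rmorphM phi_P /=.
set Sl := \sum_(l <- _) _ in H1; set Sr := \sum_(l <- _) _ in H2.
set L := box_sum _ _ lhs_term in H1 *; set R := box_sum _ _ rhs_term in H2 *.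
have -> : phi L - cst * phi R = phi (L - Sl) - cst * phi (R - Sr).
  by rewrite !rmorphB (phi_sums B3 B4) -/Sr; ring.
by apply: ser_ordB => //; apply: ser_ordMl.
Qed.

End Eval.

Lemma box_sums_eq : box_sum N (part mu 1 + n) lhs_term
  = P * box_sum N (part nu 1).+1 rhs_term.
Proof.
apply/eqP; rewrite -subr_eq0; apply: contraT => f0.
have [e [phi He]] := chi_eval_exists f0 (leqnn m).
by rewrite (phi_eq0 He) eqxx.
Qed.

End Cauchy.

Lemma prefactor_cancel (F : fieldType) (l v u g f : F) : l != 0 ->
  l / v * g * (u / l * f) = u / v * (g * f).
Proof.
move=> l0; transitivity (l / l * (u / v * (g * f))); first by ring.
by rewrite divff // mul1r.
Qed.

Theorem theorem6p1 (K : fieldType) (s : nat -> K) (s_indep : alg_independent s)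
    (n m : nat) (n_ge1 : (1 <= n)%N) (m_ge1 : (1 <= m)%N) (mu nu : intpart) :
  let q := var_q K n m in
  let kappa := fun i : 'I_n => var_kappa K m i in
  let chi := fun j : 'I_m => var_chi K n j in
  let sA := fun i : nat => ser_cst (n + m + 1) (s i) in
  let qF := tofrac q in
  let kappaF := fun i : 'I_n => tofrac (kappa i) in
  let chiF := fun j : 'I_m => tofrac (chi j) in
  let S := fun i : nat => tofrac (sA i) in
  let Sn := seq_shift n S in
  exists lhs rhs : mfps (n + m + 1) K,
    [/\ ser_has_sum (fun la : intpart =>
          bbFstar qF chiF (seq_inv S) S (tau_inv S) la nu
          * bbF qF kappaF S S (tau_self S) la mu) lhs,
        ser_has_sum (fun la : intpart =>
          bbF qF kappaF S S (tau_self S) nu la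
          * bbFstar qF chiF (seq_shift n (seq_inv S)) Sn (tau_inv Sn) mu la) rhs
      & lhs =
        (\prod_(i < n) \prod_(j < m)
           ((qpoch_inf (kappa i) q * qpoch_inf (sA i.+1 ^+ 2 * chi j) q)
            / (qpoch_inf (sA i.+1 ^+ 2) q * qpoch_inf (kappa i * chi j) q)))
        * rhs].
Proof.
move=> q kappa chi sA qF kappaF chiF S Sn.
have s0 := indep_neq0 s_indep; have s1 := indep_sqr_neq1 s_indep.
have sn0 i : s (i + n)%N != 0 by []. have sn1 i : s (i + n)%N ^+ 2 != 1 by [].
pose npow (d : nat) (la : seq nat) :=
  \prod_(1 <= i < (size la).+1) (- sA (i.-1 + d)%N) ^+ nth 0%N la i.-1.
have npowU d la : npow d la \is a GRing.unit.
  rewrite /npow; elim/big_rec: _ => [|i x _ xU]; first exact: unitr1.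
  by rewrite unitrM xU unitrX // unitrN (sB_unit n m s0).
have npowE d (la : intpart) : negpow (seq_shift d S) la = tofrac (npow d la).
  rewrite /npow rmorph_prod; apply: eq_bigr => i _.
  by rewrite rmorphXn rmorphN.
have npow0 (la : intpart) : negpow S la = tofrac (npow 0%N la).
  by rewrite -npowE; congr negpow; apply/funext => i; rewrite /seq_shift addn0.
(* The prefactors depending on lambda cancel in each product: (-S)^lambda on the left and (-tau^n
   S)^lambda on the right. Both sides keep the same constant (-tau^n S)^mu / (-S)^nu. *)
pose pre := npow n mu / npow 0%N nu.
have preE : tofrac pre = negpow Sn mu / negpow S nu.
  by rewrite npowE npow0 rmorph_div.
have negSn (la : intpart) : negpow Sn la != 0 by rewrite npowE; apply: tofrac_unit.
have negS (la : intpart) : negpow S la != 0 by rewrite npow0; apply: tofrac_unit.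
pose N := (plen mu + plen nu + n)%N.
exists (box_sum N (part mu 1 + n) (lhs_term s mu nu pre)).
exists (box_sum N (part nu 1).+1 (rhs_term s mu nu pre)).
split.
- apply: box_has_sum => [l|l d|la]; first exact: lhs_term0.
    exact: lhs_term_ord.
  have [laN|long] := leqP (plen la) N; last first.
    have F0 : bbF qF kappaF S S (tau_self S) la mu = 0.
      by apply: bbF_long => //; apply: leq_ltn_trans long; rewrite leq_add2r leq_addr.
    by rewrite F0 mulr0 tofrac0.
  have XiS i : seq_inv S i * tofrac (ser_cst (n + m + 1) (s i)) = 1.
    by rewrite mulVf // (S_neq0 n m s0).
  have E1 : bbFstar qF chiF (seq_inv S) S (tau_inv S) la nu
      = negpow S la / negpow S nu * tofrac (Gchain q N.+1 (part la 1).+1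
          [seq var_chi K n j | j <- enum 'I_m] (fun c => sA c.+1 ^+ 2)
          (pad N.+1 la) (pad N.+1 nu)).
    by apply: bbFstar_tofrac => //; apply: plen_nu.
  have E2 : bbF qF kappaF S S (tau_self S) la mu
      = negpow Sn mu / negpow S la * tofrac (Fchain q N.+1 (part la 1).+1
          [seq var_kappa K m i | i <- enum 'I_n] (fun c => sA c.+1 ^+ 2)
          (pad N.+1 la) (pad N.+1 mu)).
    by apply: bbF_tofrac => //; apply: plen_mu.
  have laE : nth 0%N (pad N.+1 la) 0%N = part la 1 by rewrite nth_pad ?leqW.
  rewrite E1 E2 /lhs_term laE tofracM preE tofracM.
  by apply: prefactor_cancel; apply: negS.
- apply: box_has_sum => [l|l d|la]; first exact: rhs_term0.
    exact: rhs_term_ord.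
  have [laN|long] := leqP (plen la) N; last first.
    have F0 : bbF qF kappaF S S (tau_self S) nu la = 0.
      by apply: bbF_notin => //; apply: leq_ltn_trans long; apply: plen_nu.
    by rewrite F0 mul0r tofrac0.
  have XiS i : seq_shift n (seq_inv S) i * tofrac (ser_cst (n + m + 1) (s (i + n)%N)) = 1.
    by rewrite mulVf // (S_neq0 n m sn0).
  have E1 : bbF qF kappaF S S (tau_self S) nu la
      = negpow Sn la / negpow S nu * tofrac (Fchain q N.+1 (part nu 1).+1
          [seq var_kappa K m i | i <- enum 'I_n] (fun c => sA c.+1 ^+ 2)
          (pad N.+1 nu) (pad N.+1 la)).
    by apply: bbF_tofrac => //; apply: plen_nu.
  have E2 : bbFstar qF chiF (seq_shift n (seq_inv S)) Sn (tau_inv Sn) mu la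
      = negpow Sn mu / negpow Sn la * tofrac (Gchain q N.+1 (part mu 1).+1
          [seq var_chi K n j | j <- enum 'I_m] (fun c => sA (c.+1 + n)%N ^+ 2)
          (pad N.+1 mu) (pad N.+1 la)).
    by apply: (bbFstar_tofrac sn0 sn1 XiS) => //; apply: plen_mu.
  have bE : (fun c => sA (c.+1 + n)%N ^+ 2) = (fun c => sA (n + c).+1 ^+ 2).
    by apply/funext => c; rewrite [(c.+1 + n)%N]addnC [(n + c.+1)%N]addnS.
  rewrite E1 E2 bE /rhs_term tofracM preE tofracM.
  by apply: prefactor_cancel; apply: negSn.
exact: box_sums_eq.
Qed.
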